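(* There exists a universal constant $C>0$ such that the following holds for every imaginary quadratic number field $K$ (embedded in $\mathbb C$) whose ring of integers $\mathcal O_K$ is principal. For all $k\in\mathcal O_K$ and every nonzero ideal $\mathfrak m$ of $\mathcal O_K$, there exists $c_{\mathfrak m,k}\in\,]0,1]$ such that for all $z\in\mathbb C^\times$, $\theta\in\,]0,2\pi]$ and $x\geq1$, we have $$\Big|\sum_{a\in\mathfrak m\cap C(z,\theta,x)}\varphi_K(a)\,\varphi_K(a+k)-\frac{\theta\,c_{\mathfrak m,k}}{3\,\sqrt{|D_K|}}\;x^6\Big|\leq C\Big(\big(1+\sqrt{\mathtt N(k)}\,\big)\,x^5+\mathtt N(k)\,x^4\Big).$$
   Context: $D_K$ is the discriminant of $K$. For a nonzero ideal $\mathfrak a$ of $\mathcal O_K$, $\varphi_K(\mathfrak a)=\operatorname{Card}\big((\mathcal O_K/\mathfrak a)^\times\big)$; for $a\in\mathcal O_K-\{0\}$, $\varphi_K(a)=\varphi_K(a\mathcal O_K)$. Convention: $\varphi_K(0)=0$, so that a possible term with $a+k=0$ does not contribute. For $k\in\mathcal O_K$, $\mathtt N(k)=|k|^2$ (which is $\operatorname{Card}(\mathcal O_K/k\mathcal O_K)$ if $k\neq0$, and $0$ if $k=0$). For $z\in\mathbb C^\times$, $\theta\in\,]0,2\pi]$ and $R\geq0$, the truncated angular sector is $$C(z,\theta,R)=\Big\{\rho\,e^{it}z:\ t\in\,\big]-\tfrac\theta2,\tfrac\theta2\big],\ 0<\rho\leq\tfrac{R}{|z|}\Big\}\subset\mathbb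 C .$$ *)

(* Defs.v *)
From HB Require Import structures.
From mathcomp Require Import all_boot all_order all_algebra all_field finmap.
From mathcomp Require Import all_classical all_reals all_analysis.
From mathcomp Require Import complex.

Set Implicit Arguments.
Unset Strict Implicit.
Unset Printing Implicit Defensive.

Import Order.TTheory GRing.Theory Num.Theory.

Local Open Scope classical_set_scope.
Local Open Scope ring_scope.

(* A number field is a K : fieldExtType rat. *)

Definition algebraic_integer (K : fieldExtType rat) : {pred K} :=
  fun x => `[< integralOver (intr : int -> K) x >].

Fact algebraic_integer_subring (K : fieldExtType rat) :
  subring_closed (@algebraic_integer K).
Proof.
split=> [|x y /asboolP xint /asboolP yint|x y /asboolP xint /asboolP yint];
  apply/asboolP.
- exact: integral1.
- exact: integral_sub.
- exact: integral_mul.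
Qed.

HB.instance Definition _ (K : fieldExtType rat) :=
  GRing.isSubringClosed.Build K (@algebraic_integer K)
    (@algebraic_integer_subring K).

Record ringOfIntegers (K : fieldExtType rat) : Type := RingOfIntegers {
  integer_val :> K;
  integer_valP : algebraic_integer integer_val
}.

HB.instance Definition _ (K : fieldExtType rat) :=
  [isSub for @integer_val K].
HB.instance Definition _ (K : fieldExtType rat) :=
  [Choice of ringOfIntegers K by <:].
HB.instance Definition _ (K : fieldExtType rat) :=
  [SubChoice_isSubComNzRing of ringOfIntegers K by <:].

(* The library's idealr only covers proper ideals, whereas the unit ideal is
   allowed here. *)
Definition is_ideal (A : comNzRingType) (I : set A) : Prop :=
  [/\ I 0, forall a b, I a -> I b -> I (a + b) & forall a b, I b -> I (a * b)].

Definition principal_ideal (A : comNzRingType) (g : A) : set A :=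
  [set a * g | a in [set: A]].

Definition principal_ideal_ring (A : comNzRingType) : Prop :=
  forall I : set A, is_ideal I -> exists g : A, I = principal_ideal g.

Definition residue_class (A : comNzRingType) (I : set A) (a : A) : set A :=
  [set b | I (b - a)].

(* (A / I)^* as a set of cosets: the class of a is invertible when some class
   of b satisfies [a] [b] = [1]. If I = A this is the unit group of the zero
   ring, which has one element. *)
Definition quotient_units (A : comNzRingType) (I : set A) : set (set A) :=
  [set X | exists a b : A,
     X = residue_class I a /\ residue_class I (a * b) = residue_class I 1].

Definition euler_ideal (K : fieldExtType rat) (I : set (ringOfIntegers K)) : nat :=
  #|` fset_set (quotient_units I)|.

Definition euler (K : fieldExtType rat) (a : ringOfIntegers K) : nat :=
  if a == 0 then 0%N else euler_ideal (principal_ideal a).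

(* Tr_{K/Q}(x): the trace of the Q-linear map y |-> x * y. *)
Definition field_trace (K : fieldExtType rat) (x : K) : rat :=
  \tr (passmx.mxof (vbasis {:K}) (vbasis {:K}) (amull x)).

Definition integral_basis (K : fieldExtType rat) (b : (\dim {:K}).-tuple K) : Prop :=
  basis_of {:K} b /\
  forall x : K, algebraic_integer x <->
    exists c : 'I_(\dim {:K}) -> int, x = \sum_i tnth b i *~ c i.

Definition basis_discriminant (K : fieldExtType rat)
    (b : (\dim {:K}).-tuple K) : rat :=
  \det (\matrix_(i, j) field_trace (tnth b i * tnth b j)).

(* The value does not depend on the integral basis; one always exists, so the
   default value 0 is never used. *)
Definition discriminant (K : fieldExtType rat) : rat :=
  xget 0 [set basis_discriminant b | b in @integral_basis K].

Definition imaginary_quadratic (R : realType) (K : fieldExtType rat)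
    (iota : {rmorphism K -> R[i]}) : Prop :=
  \dim {:K} = 2%N /\ exists x : K, complex.Im (iota x) != 0.

Definition cmod (R : realType) (z : R[i]) : R := ComplexField.Normc.normc z.

Definition expi (R : realType) (t : R) : R[i] := Complex (cos t) (sin t).

Definition angular_sector (R : realType) (z : R[i]) (theta r : R) : set R[i] :=
  [set w | exists t rho : R,
     [/\ - (theta / 2) < t <= theta / 2, 0 < rho <= r / cmod z
       & w = real_complex R rho * expi t * z]].

Definition embed (R : realType) (K : fieldExtType rat)
    (iota : {rmorphism K -> R[i]}) (a : ringOfIntegers K) : R[i] :=
  iota (integer_val a).

Definition abs_norm (R : realType) (K : fieldExtType rat)
    (iota : {rmorphism K -> R[i]}) (a : ringOfIntegers K) : R :=
  cmod (embed iota a) ^+ 2.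

(* Main.v *)
Require Import Defs.
From HB Require Import structures.
From mathcomp Require Import all_boot all_order all_algebra all_field finmap.
From mathcomp Require Import all_classical all_reals all_analysis.
From mathcomp Require Import complex.
From mathcomp Require Import ring lra zify.

(** The ratio [phi_K(a) / N(a)] is the product of [1 - 1 / N(p)] over the primes
    [p] that divide [a]. Expanding the two products in
    [phi_K(a) phi_K(a + k) / (N(a) N(a + k))] shows that the sum of this
    quotient over the elements [a] of [m] in a sector of radius [r] is a
    combination, with coefficients [+-1 / (N(b) N(c))], of the numbers of [a] in
    [m] and in the sector such that [b] divides [a] and [c] divides [a + k],
    where [b] and [c] are products of distinct primes. These congruences are
    incompatible or define a coset of an ideal [(l)], with [l] a multiple of [b]
    and [c], so that the number is proportional to [theta r^2], up to an error
    [O(r / |l| + 1)]. Since [|l| >= sqrt |b c|], the weighted errors add up to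
    [O(r + |k|)] ([progression_count], [truncated_sum_asymp]).

    The errors are uniform in the field because of the shape of its ring of
    integers in the plane: horizontal rows with unit spacing, at distance
    [sqrt |D_K| / 2 >= 1 / 2] from each other ([int_embed_plane_order],
    [sqrt_discriminant]). A quarter of a sector meets the rows in intervals of
    decreasing length, and a Riemann sum of a monotone function differs from the
    integral by at most one term, whatever the step ([cnt_strip], [area_est_sect],
    [lattice_sector]). In particular a disc of radius [r] has at most [210 r^2]
    nonzero integers, so that the sum of [N(p)^(-5/4)] over the primes has a
    bound that is valid for all fields ([sum_cprimes]).

    The sums over [b] and [c] are truncated, which is harmless since only the
    divisors of the elements of a disc occur. Each truncation has its own
    constant, and the error bounds confine all these constants to intervals
    that meet pairwise, which yields the limiting constant
    [c] ([ratio_sum_asymp]). It is at most [1] because the ratios are; it is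
    positive because [phi_K(a)] is at least a constant times [N(a)^(7/8)], which
    rules out a sum of ratios of order [r] ([mean_density]).

    The norm takes integral values, so a discrete summation by parts introduces
    the factor [N(a)^2] ([norm_sqr_sum]); replacing [N(a)^2] by [N(a) N(a + k)]
    produces the terms in [k] ([weighted_sum_asymp]).

    The product formula for [phi_K] is itself obtained by counting the elements
    prime to [a] in large discs in two ways: as a union of invertible classes
    modulo [a], and by inclusion-exclusion over the primes that divide [a]
    ([card_units_prod]). *)

Set Implicit Arguments.
Unset Strict Implicit.
Unset Printing Implicit Defensive.

Import Order.TTheory GRing.Theory Num.Theory.

Local Open Scope classical_set_scope.
Local Open Scope ring_scope.

(** * Counting the points of a planar set row by row *)

Section Counting.
Variable R : realType.
Implicit Types T : choiceType.

Definition cnt T (A : set T) : R := \sum_(a \in A) (1 : R).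

Lemma cnt_ge0 T (A : set T) : 0 <= cnt A.
Proof. by apply: fsumr_ge0. Qed.

Lemma cnt0 T : cnt (@set0 T) = 0.
Proof. exact: fsbig_set0. Qed.

Lemma cntU T (A B : set T) : finite_set A -> finite_set B ->
  A `&` B = set0 -> cnt (A `|` B) = cnt A + cnt B.
Proof. by move=> fA fB AB; rewrite /cnt fsbigU0// AB. Qed.

Lemma cntD T (A B : set T) : finite_set A -> B `<=` A ->
  cnt (A `\` B) = cnt A - cnt B.
Proof.
move=> fA BA; have fB := sub_finite_set BA fA.
rewrite -[in cnt A](setDUK BA) cntU//; last by apply/seteqP; split=> // x [Bx []].
- by rewrite addrAC subrr add0r.
- exact: finite_setD.
Qed.

Lemma cnt_le T (A B : set T) : finite_set B -> A `<=` B -> cnt A <= cnt B.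
Proof.
by move=> fB AB; rewrite -subr_ge0 -cntD// cnt_ge0.
Qed.

Lemma cnt_image T T' (f : T -> T') (A : set T) : {in A &, injective f} ->
  cnt (f @` A) = cnt A.
Proof. by move=> fI; rewrite /cnt fsbig_image. Qed.

Lemma cnt_II k : cnt (`I_k) = k%:R.
Proof. by rewrite /cnt -fsbig_ord sumr_const card_ord. Qed.

Lemma int_segment (m : int) k :
  finite_set [set i : int | m <= i < m + k%:Z] /\
  cnt [set i : int | m <= i < m + k%:Z] = k%:R.
Proof.
have -> : [set i : int | m <= i < m + k%:Z] = (fun l : nat => m + l%:Z) @` `I_k.
  apply/seteqP; split=> [i /= /andP[mi ik]|_ [l /= lk <-]]; last lia.
  by exists `|i - m|%N => /=; lia.
split; first exact/finite_image/finite_II.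
by rewrite cnt_image ?cnt_II// => a b _ _ /addrI [].
Qed.

(** The set lies between a half-open and a closed interval: the rays that bound
    a sector may or may not belong to it. *)
Lemma cnt_interval (x a b : R) (D : set int) : a <= b ->
  (forall i, a < i%:~R + x <= b -> D i) ->
  (forall i, D i -> a <= i%:~R + x <= b) ->
  finite_set D /\ `|cnt D - (b - a)| <= 1.
Proof.
move=> ab Dlo Dup.
have := floor_itv (b - x); set fb := Num.floor (b - x) => /andP[fb1 fb2].
have := floor_itv (a - x); set fa := Num.floor (a - x) => /andP[fa1 fa2].
have := floor_itv (x - a); set ca := Num.floor (x - a) => /andP[ca1 ca2].
move: fb2 fa2 ca2; rewrite !intrD => fb2 fa2 ca2.
have fab : fa <= fb by rewrite -ltzD1 -(ltr_int R) intrD; lra.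
have cab : 0 <= fb + 1 + ca by rewrite -ltzD1 -(ltr_int R) !intrD; lra.
have [f1 c1] := int_segment (fa + 1) `|fb - fa|%N.
have [f2 c2] := int_segment (- ca) (absz (fb + 1 + ca)%R).
have sub1 : [set i : int | (fa + 1)%R <= i < fa + 1 + `|fb - fa|%N%:Z] `<=` D.
  move=> i /= /andP[i1 i2]; apply: Dlo.
  have : fa + 1 <= i by [].
  rewrite -(ler_int R) intrD => ?.
  have : i <= fb by lia.
  rewrite -(ler_int R) => ?; lra.
have sub2 : D `<=` [set i : int | - ca <= i < - ca + (absz (fb + 1 + ca)%R)%:Z].
  move=> i /Dup /andP[i1 i2] /=.
  have : - ca <= i by rewrite -ltzD1 -(ltr_int R) intrD mulrNz; lra.
  have : i <= fb by rewrite -ltzD1 -(ltr_int R) intrD; lra.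
  lia.
have fD := sub_finite_set sub2 f2.
split=> //; have := cnt_le fD sub1; have := cnt_le f2 sub2; rewrite c1 c2.
have -> : (absz (fb + 1 + ca)%R)%:R = fb%:~R + 1 + ca%:~R :> R.
  by rewrite natr_absz ger0_norm// !intrD.
have -> : (absz (fb - fa)%R)%:R = fb%:~R - fa%:~R :> R.
  by rewrite natr_absz ger0_norm ?subr_ge0// intrB.
by move=> h1 h2; rewrite ler_norml; lra.
Qed.

Definition row (D : set (int * int)) (j : int) : set int := [set i | D (i, j)].

Lemma cnt_rows (D : set (int * int)) (j0 : int) n :
  (forall l, (l < n)%N -> finite_set (row D (j0 + l%:Z))) ->
  (forall i j, D (i, j) -> j0 <= j < j0 + n%:Z) ->
  finite_set D /\ cnt D = \sum_(l < n) cnt (row D (j0 + l%:Z)).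
Proof.
elim: n D => [|n IH] D fr Db.
  have -> : D = set0.
    by apply/seteqP; split=> // -[i j] /Db /=; lia.
  by rewrite cnt0 big_ord0.
pose D1 := D `&` [set p | p.2 < j0 + n%:Z].
pose D2 := (fun i => (i, j0 + n%:Z)) @` row D (j0 + n%:Z).
have row1 l : (l < n)%N -> row D1 (j0 + l%:Z) = row D (j0 + l%:Z).
  by move=> ln; apply/seteqP; split=> [i []//|i ?]; split=> //=; lia.
have [] := IH D1.
- by move=> l ln; rewrite row1//; apply: fr; exact: ltnW.
- by move=> i j [/Db/= + /=]; lia.
move=> fD1 cD1.
have fD2 : finite_set D2 by apply: finite_image; exact: fr.
have cD2 : cnt D2 = cnt (row D (j0 + n%:Z)).
  by rewrite cnt_image// => a b _ _ [].
have DE : D = D1 `|` D2.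
  apply/seteqP; split=> [[i j] Dij|[i j] [[]//|[i' ? [<- <-]//]]].
  have := Db _ _ Dij => /andP[jl ju].
  have [jn|jn] := ltP j (j0 + n%:Z); first by left.
  have jE : j = j0 + n%:Z by lia.
  by right; exists i; rewrite /row /= -?jE.
rewrite big_ord_recr /=.
have <- : cnt D1 = \sum_(i < n) cnt (row D (j0 + i%:Z)).
  by rewrite cD1; apply: eq_bigr => l _; rewrite row1.
rewrite -cD2; split; first by rewrite DE finite_setU.
rewrite {1}DE cntU//; apply/seteqP; split=> // -[i j] [[_ /=]].
by move=> jn [i' _ [_ jE]]; move: jn; rewrite jE ltxx.
Qed.

(** The number of points is a Riemann sum of step [y] of the row length [ell].
    Since [ell] decreases, each term is compared with the increments of the
    primitive [G] on its two sides; the telescoping sums differ from [G h] by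
    at most one term. The rounding error of each row adds up to the number of
    rows, which the lower bound on [y] makes linear in [r]. *)
Lemma cnt_strip (D : set (int * int)) (y t0 h r : R) (ell G : R -> R) :
  1 / 2 <= y -> 0 <= h <= r ->
  (forall i j, D (i, j) -> 0 < j%:~R * y + t0 <= h) ->
  (forall j, 0 < j%:~R * y + t0 <= h ->
     finite_set (row D j) /\ `|cnt (row D j) - ell (j%:~R * y + t0)| <= 1) ->
  (forall t : R, 0 <= t <= h -> 0 <= ell t <= r) ->
  (forall s t : R, 0 <= s -> s <= t -> t <= h ->
     (t - s) * ell t <= G t - G s <= (t - s) * ell s) ->
  G 0 = 0 ->
  finite_set D /\ `|cnt D - G h / y| <= 3 * r + 1.
Proof.
move=> y2 /andP[h0 hr] Dh Drow ellr GE G0.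
have y0 : 0 < y by lra.
have := floor_itv (- t0 / y); set f0 := Num.floor _ => /andP[f01 f02].
have := floor_itv ((h - t0) / y); set f1 := Num.floor _ => /andP[f11 f12].
move: f01 f11 f02 f12; rewrite !ler_pdivlMr// !ltr_pdivrMr// !intrD.
move=> f01 f11 f02 f12.
have f0f1 : f0 <= f1 by rewrite -ltzD1 -(ltr_int R) intrD -(ltr_pM2r y0); lra.
have [n nE] : exists n : nat, n%:Z = f1 - f0.
  by exists `|f1 - f0|%N; rewrite gez0_abs ?subr_ge0.
pose j0 := f0 + 1.
pose s (l : nat) : R := (j0 + l%:Z)%:~R * y + t0.
have sS l : s l.+1 = s l + y by rewrite /s intS !intrD; ring.
have sE l : s l = s 0 + l%:R * y by rewrite /s !intrD; ring.
have s0 : 0 < s 0 by rewrite /s !intrD; lra.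
have s0y : s 0 <= y by rewrite /s !intrD; lra.
have sn : h < s n.
  by rewrite /s /j0 nE !intrD mulrNz; lra.
have sn1 l : (l < n)%N -> s l <= h.
  move=> ln; have: s l <= f1%:~R * y + t0; last lra.
  by rewrite lerD2r ler_pM2r// ler_int /j0; move: ln nE; clear; lia.
have s_gt0 l : 0 < s l.
  by rewrite sE ltr_wpDr// mulr_ge0// ltW.
have [//| | fD cD] := @cnt_rows D j0 n.
- by move=> l ln; apply: (Drow _ _).1; rewrite -/(s l) s_gt0 sn1.
- move=> i j /Dh /andP[t1 t2].
  have jf0 : f0 < j by rewrite -(ltr_int R) -(ltr_pM2r y0); lra.
  have jf1 : j <= f1 by rewrite -ltzD1 -(ltr_int R) intrD -(ltr_pM2r y0); lra.
  by rewrite /j0; move: jf0 jf1 nE; clear; lia.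
split=> //.
pose S m := \sum_(l < m) ell (s l).
have cS : `|cnt D - S n| <= n%:R.
  rewrite cD /S -sumrB (le_trans (ler_norm_sum _ _ _))//.
  rewrite -[n in leRHS]card_ord -sumr_const ler_sum// => l _.
  by apply: (Drow _ _).2; rewrite -/(s l) s_gt0 sn1.
have up m : (m < n)%N -> y * S m.+1 <= y * r + G (s m).
  elim: m => [|m IH] mn.
    rewrite /S big_ord1.
    have /andP[g1 _] := GE 0 (s 0) (lexx _) (ltW s0) (sn1 _ mn).
    have /andP[e0 e1] : 0 <= ell (s 0) <= r by rewrite ellr// ltW//= sn1.
    have : 0 <= (s 0 - 0) * ell (s 0) by rewrite mulr_ge0//; lra.
    have : y * ell (s 0) <= y * r by rewrite ler_pM2l.
    lra.
  have := IH (ltnW mn); rewrite {2}/S big_ord_recr /= -/(S m.+1).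
  have ssm : s m <= s m.+1 by rewrite sS lerDl ltW.
  have /andP[g1 _] := GE (s m) (s m.+1) (ltW (s_gt0 _)) ssm (sn1 _ mn).
  move: g1; rewrite {1}sS addrAC subrr add0r; lra.
have lo m : (m < n)%N -> G (s m) <= y * r + y * S m.
  elim: m => [|m IH] mn.
    rewrite /S big_ord0 mulr0 addr0.
    have := GE 0 (s 0) (lexx _) (ltW s0) (sn1 _ mn) => /andP[_].
    rewrite G0 !subr0 => /le_trans; apply.
    have /andP[e0 e1] : 0 <= ell 0 <= r by apply: ellr; rewrite lexx.
    by apply: ler_pM => //; exact: ltW.
  have := IH (ltnW mn); rewrite {2}/S big_ord_recr /= -/(S m).
  have ssm : s m <= s m.+1 by rewrite sS lerDl ltW.
  have /andP[_] := GE (s m) (s m.+1) (ltW (s_gt0 _)) ssm (sn1 _ mn).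
  rewrite {2}sS addrAC subrr add0r; lra.
have nr : n%:R <= 2 * r + 1.
  case: (posnP n) => [->|n0]; first by rewrite addr_ge0// mulr_ge0// (le_trans h0).
  have : s n.-1 <= h by apply: sn1; rewrite prednK.
  rewrite sE => ?; have : n.-1%:R * y <= r by lra.
  have : n.-1%:R * (1 / 2) <= n.-1%:R * y by rewrite ler_wpM2l.
  rewrite -[in n%:R](prednK n0) -[n.-1.+1%:R]natr1; lra.
have key : `|y * S n - G h| <= y * r.
  case: (posnP n) => [n0|n0].
    have := GE 0 h (lexx _) h0 (lexx _); rewrite G0 !subr0 => /andP[g1 g2].
    have /andP[e0 e1] : 0 <= ell 0 <= r by apply: ellr; rewrite lexx.
    have /andP[e2 e3] : 0 <= ell h <= r by apply: ellr; rewrite lexx h0.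
    have : h * ell 0 <= y * r by apply: ler_pM => //; rewrite n0 in sn; lra.
    have : 0 <= h * ell h by apply: mulr_ge0.
    by rewrite n0 /S big_ord0 mulr0 ler_norml; lra.
  have pn : (n.-1 < n)%N by rewrite prednK.
  have := up _ pn; have := lo _ pn; rewrite prednK//.
  have := GE (s n.-1) h (ltW (s_gt0 _)) (sn1 _ pn) (lexx _) => /andP[g1 g2].
  have /andP[e2 e3] : 0 <= ell h <= r by apply: ellr; rewrite lexx h0.
  have : 0 <= (h - s n.-1) * ell h by rewrite mulr_ge0// subr_ge0 sn1.
  have /andP[e4 e5] : 0 <= ell (s n.-1) <= r.
    by apply: ellr; rewrite ltW//= sn1.
  have : (h - s n.-1) * ell (s n.-1) <= y * ell (s n.-1).
    rewrite ler_wpM2r//; move: sn; rewrite -{1}(prednK n0) sS; lra.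
  have : S n = S n.-1 + ell (s n.-1) by rewrite -{1}(prednK n0) /S big_ord_recr.
  by move=> ->; rewrite ler_norml; lra.
have : `|S n - G h / y| <= r.
  rewrite -(ler_pM2l y0) -{1}[y]gtr0_norm// -normrM mulrBr.
  by rewrite [y * (G h / y)]mulrC divfK ?gt_eqF.
by move: cS; rewrite !ler_norml; lra.
Qed.

End Counting.

(** * Polar coordinates and the area of circular segments *)

Section Trigonometry.
Import numFieldNormedType.Exports.
Variable R : realType.
Implicit Types a b d p q r x y al be : R.

Lemma derive_ge0_le (f df : R -> R) a b : a <= b ->
  (forall x, is_derive x 1 f (df x)) -> (forall x, a < x < b -> 0 <= df x) ->
  f a <= f b.
Proof.
move=> ab fD df0.
have fC : {within `[a, b], continuous f}.
  suff fC0 : continuous f by exact: continuous_subspaceT.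
  move=> x; by apply/differentiable_continuous/derivable1_diffP; case: (fD x).
have [c cab fE] := MVT_segment ab (fun x _ => fD x) fC.
rewrite -subr_ge0 fE; move: ab; rewrite le_eqVlt => /predU1P[->|ab].
  by rewrite subrr mulr0.
move: fE; case: (eqVneq (f b - f a) 0) => [<-|]; first by move=> <-.
have [d dab] := MVT ab (fun x _ => fD x) fC.
move=> fE' _ <-; rewrite fE' mulr_ge0 ?subr_ge0// ?(ltW ab)//.
by apply: df0; move: dab; rewrite in_itv.
Qed.

Lemma sin_le_id d : 0 <= d -> sin d <= d.
Proof.
move=> d0; have := @derive_ge0_le (fun x => x - sin x) (fun x => 1 - cos x) 0 d d0.
rewrite sin0 !subr0 subr_ge0; by apply=> x _; rewrite subr_ge0 cos_le1.
Qed.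

(** The derivative of the difference is [2 cos x (1 - cos x)]. *)
Lemma id_le_sin2Bcos d : 0 <= d <= pi / 2 -> d <= sin d * (2 - cos d).
Proof.
move=> /andP[d0 d2].
have := @derive_ge0_le (fun x => sin x * (2 - cos x) - x)
  (fun x => 2 * (cos x * (1 - cos x))) 0 d d0.
rewrite sin0 mul0r !subr0 subr_ge0; apply=> [x|x /andP[x0 xd]].
  apply: is_derive_eq; rewrite /GRing.scale/=.
  by have := cos2Dsin2 x; nra.
have c0 : 0 <= cos x by apply: cos_ge0_pihalf; lra.
by have := cos_le1 x; nra.
Qed.

(** The middle term is the area of the slice of the unit quarter disc between
    the heights [sin p] and [sin q]; the bounds are the rectangles of the same
    height on the longest and on the shortest of its horizontal sides. *)
Lemma arc_area_bounds p q : 0 <= p -> p <= q -> q <= pi / 2 ->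
  (sin q - sin p) * cos q <= (q + sin q * cos q - (p + sin p * cos p)) / 2 <=
  (sin q - sin p) * cos p.
Proof.
move=> p0 pq q2; set d := q - p.
have d0 : 0 <= d by rewrite subr_ge0.
have d2 : d <= pi / 2 by rewrite /d; lra.
have sp : 0 <= sin p by apply: sin_ge0_pi; have := pi_gt0 R; lra.
have cp : 0 <= cos p by apply: cos_ge0_pihalf; have := pi_gt0 R; lra.
have sq : 0 <= sin q by apply: sin_ge0_pi; have := pi_gt0 R; lra.
have cq : 0 <= cos q by apply: cos_ge0_pihalf; have := pi_gt0 R; lra.
have := sin_le_id d0; have /id_le_sin2Bcos : 0 <= d <= pi / 2 by rewrite d0.
have := cos_le1 d; have := cos2Dsin2 p; have := cos2Dsin2 q.
have -> : sin d = sin q * cos p - cos q * sin p by rewrite sinB.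
have -> : cos d = cos q * cos p + sin q * sin p by rewrite cosB.
rewrite /d; set s := sin p in sp *; set c := cos p in cp *.
set s' := sin q in sq *; set c' := cos q in cq *.
move=> e1 e2 cd1 sd2 sd1.
(* the two members differ from [sin d] and from [d] by
   [sin (p + q) * (1 - cos d)], a nonnegative quantity *)
have E : s' * c' + s * c = (s * c' + c * s') * (c' * c + s' * s).
  rewrite -[s' * c']mulr1 -e2 -[s * c]mulr1 -e1; ring.
have S0 : 0 <= (s * c' + c * s') * (1 - (c' * c + s' * s)).
  by rewrite mulr_ge0 ?subr_ge0// addr_ge0// mulr_ge0.
have S1 : 0 <= s * c' * (1 - (c' * c + s' * s)).
  by rewrite mulr_ge0 ?subr_ge0// mulr_ge0.
by lra.
Qed.

(** The flag tells whether the last ray is included: a reflection turns the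
    half-open sectors of the statement into sectors closed at the other end,
    which are differences of sectors open at the end. *)
Definition sect (b : bool) (al be r : R) : set (R * R) :=
  [set p | exists s rho, [/\ al < s, s < be ?<= if b, 0 < rho <= r
                           & p = (rho * cos s, rho * sin s)]].

Lemma polar x y : x != 0 \/ 0 < y -> 0 <= y ->
  exists s rho, [/\ 0 <= s <= pi, 0 < rho, rho ^+ 2 = x ^+ 2 + y ^+ 2,
    x = rho * cos s & y = rho * sin s].
Proof.
move=> xy y0; set N := x ^+ 2 + y ^+ 2.
have N0 : 0 < N.
  case: xy => [x0|y1]; last by rewrite ltr_wpDl ?sqr_ge0// exprn_gt0.
  by rewrite ltr_pwDl ?sqr_ge0// exprn_even_gt0.
have r0 : 0 < Num.sqrt N by rewrite sqrtr_gt0.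
have rN : Num.sqrt N ^+ 2 = N by rewrite sqr_sqrtr// ltW.
have xN : (x / Num.sqrt N) ^+ 2 + (y / Num.sqrt N) ^+ 2 = 1.
  by rewrite !expr_div_n -mulrDl rN divff// gt_eqF.
have x1 : -1 <= x / Num.sqrt N <= 1.
  rewrite -ler_norml -(@expr_le1 _ 2)// real_normK ?num_real//.
  by have := sqr_ge0 (y / Num.sqrt N); lra.
exists (acos (x / Num.sqrt N)), (Num.sqrt N); split=> //.
- by rewrite acos_ge0 ?acos_lepi.
- by rewrite acosK ?in_itv//= mulrC divfK// gt_eqF.
- rewrite sin_acos// -xN addrAC subrr add0r sqrtr_sqr ger0_norm.
    by rewrite mulrC divfK// gt_eqF.
  by rewrite divr_ge0// ltW.
Qed.

(** In the first quadrant, comparing angles amounts to the sign of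
    [sin (be - s)], which is linear in the Cartesian coordinates. *)
Lemma sect0P (b : bool) be r x y : 0 < be <= pi / 2 -> 0 < r ->
  sect b 0 be r (x, y) <->
  [/\ 0 < y, y * cos be < x * sin be ?<= if b & x ^+ 2 + y ^+ 2 <= r ^+ 2].
Proof.
move=> /andP[be0 be2] r0; have pi0 := pi_gt0 R; split.
  move=> [s [rho [s0 sb /andP[rho0 rhor] [-> ->]]]].
  have sbe : s <= be by exact: lteifW sb.
  split; first by rewrite mulr_gt0// sin_gt0_pi//; lra.
    rewrite -subr_lteif0r.
    have -> : rho * cos s * sin be - rho * sin s * cos be = rho * sin (be - s).
      by rewrite sinB; ring.
    rewrite -[X in X < _ ?<= if _](mulr0 rho) lteif_pM2l//.
    case: b sb => /= sb; first by apply: sin_ge0_pi; lra.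
    by apply: sin_gt0_pi; lra.
  rewrite !exprMn -mulrDr cos2Dsin2 mulr1.
  by rewrite ler_pXn2r// nnegrE ltW.
move=> [y0 yx xyr].
have [||s [rho [/andP[s0 spi] rho0 rhoE xE yE]]] := @polar x y; [by right|exact: ltW|].
have ss0 : 0 < s.
  rewrite lt_neqAle s0 andbT eq_sym; apply/eqP => s00.
  by move: y0; rewrite yE s00 sin0 mulr0 ltxx.
exists s, rho; split=> //; last by rewrite -xE -yE.
  have sinE : x * sin be - y * cos be = rho * sin (be - s).
    by rewrite sinB xE yE; ring.
  have : 0 < rho * sin (be - s) ?<= if b.
    by rewrite -sinE subr_lteif0r.
  rewrite -[X in X < _ ?<= if _](mulr0 rho) lteif_pM2l//; case: b {yx} => /=; last first.
    move=> h; rewrite ltNge; apply/negP => bs.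
    have : 0 <= sin (s - be) by apply: sin_ge0_pi; lra.
    by rewrite -opprB sinN; lra.
  move=> h; rewrite leNgt; apply/negP => bs.
  have : 0 < sin (s - be) by apply: sin_gt0_pi; lra.
  by rewrite -opprB sinN; lra.
by rewrite rho0/= -(@ler_pXn2r _ 2)// ?nnegrE ?(ltW rho0) ?(ltW r0)// rhoE.
Qed.

End Trigonometry.

(** * Points of horizontal rows in circular sectors *)

Section Sectors.
Variable R : realType.
Implicit Types (D : set (R * R)) (A e y r al be ga : R) (xs : int -> R).

Definition latpts y (t0 : R) xs D : set (int * int) :=
  [set p | D (p.1%:~R + xs p.2, p.2%:~R * y + t0)].

(** [A] is the area of [D]: the points counted are those of a union of
    horizontal rows at distance [y], with unit spacing inside each row but with
    arbitrary horizontal offsets. This class of point sets is stable under the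
    symmetries of the plane that preserve the two axes. *)
Definition area_est D A e := forall y (t0 : R) xs, 1 / 2 <= y ->
  finite_set (latpts y t0 xs D) /\ `|cnt R (latpts y t0 xs D) - A / y| <= e.

Lemma area_est_eq D D' A A' e : D = D' -> A = A' -> area_est D A e -> area_est D' A' e.
Proof. by move=> -> ->. Qed.

Lemma area_est_le D A e e' : e <= e' -> area_est D A e -> area_est D A e'.
Proof.
by move=> ee D1 y t0 xs y2; have [f c] := D1 y t0 xs y2; rewrite (le_trans c).
Qed.

Lemma area_estU D1 D2 A1 A2 e1 e2 : D1 `&` D2 = set0 -> area_est D1 A1 e1 ->
  area_est D2 A2 e2 -> area_est (D1 `|` D2) (A1 + A2) (e1 + e2).
Proof.
move=> D12 E1 E2 y t0 xs y2.
have [f1 c1] := E1 y t0 xs y2; have [f2 c2] := E2 y t0 xs y2.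
have -> : latpts y t0 xs (D1 `|` D2) = latpts y t0 xs D1 `|` latpts y t0 xs D2.
  by [].
rewrite finite_setU cntU//; last first.
  apply/seteqP; split=> // p [p1 p2].
  by have : (D1 `&` D2) (p.1%:~R + xs p.2, p.2%:~R * y + t0); [|rewrite D12].
split=> //; rewrite mulrDl opprD addrACA (le_trans (ler_normD _ _))//.
exact: lerD.
Qed.

Lemma area_estD D1 D2 A1 A2 e1 e2 : D2 `<=` D1 -> area_est D1 A1 e1 ->
  area_est D2 A2 e2 -> area_est (D1 `\` D2) (A1 - A2) (e1 + e2).
Proof.
move=> D12 E1 E2 y t0 xs y2.
have [f1 c1] := E1 y t0 xs y2; have [f2 c2] := E2 y t0 xs y2.
have -> : latpts y t0 xs (D1 `\` D2) = latpts y t0 xs D1 `\` latpts y t0 xs D2.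
  by [].
split; first exact: finite_setD.
rewrite cntD//; last by move=> p /D12.
rewrite mulrBl opprB addrA addrAC -[X in X + _]addrA [X in `|X|](_ : _ =
  (cnt R (latpts y t0 xs D1) - A1 / y) - (cnt R (latpts y t0 xs D2) - A2 / y)).
  by rewrite (le_trans (ler_normB _ _))// lerD.
by ring.
Qed.

Lemma area_est_reflX D A e : area_est D A e -> area_est [set p | D (- p.1, p.2)] A e.
Proof.
move=> E y t0 xs y2; have [f c] := E y t0 (fun j => - xs j) y2.
have -> : latpts y t0 xs [set p | D (- p.1, p.2)] =
    (fun p => (- p.1, p.2)) @` latpts y t0 (fun j => - xs j) D.
  apply/seteqP; split=> [[i j] Dp|_ [[i j] Dp <-]] /=.
    exists (- i, j) => /=; last by rewrite opprK.
    by move: Dp; rewrite /latpts/= opprD mulrNz.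
  by move: Dp; rewrite /latpts/= opprD mulrNz opprK.
split; first exact: finite_image.
by rewrite cnt_image// => -[i j] [i' j'] _ _ /= [/oppr_inj -> ->].
Qed.

Lemma area_est_opp D A e : area_est D A e -> area_est [set p | D (- p.1, - p.2)] A e.
Proof.
move=> E y t0 xs y2; have [f c] := E y (- t0) (fun j => - xs (- j)) y2.
have -> : latpts y t0 xs [set p | D (- p.1, - p.2)] =
    (fun p => (- p.1, - p.2)) @` latpts y (- t0) (fun j => - xs (- j)) D.
  apply/seteqP; split=> [[i j] Dp|_ [[i j] Dp <-]] /=.
    exists (- i, - j) => /=; last by rewrite !opprK.
    by move: Dp; rewrite /latpts/= !opprD !mulrNz mulNr opprK.
  by move: Dp; rewrite /latpts/= !opprD !mulrNz !mulNr !opprK.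
split; first exact: finite_image.
by rewrite cnt_image// => -[i j] [i' j'] _ _ /= [/oppr_inj -> /oppr_inj ->].
Qed.

Lemma area_est_empty : area_est set0 0 0.
Proof.
move=> y t0 xs y2; have -> : latpts y t0 xs set0 = set0 by [].
by split=> //; rewrite cnt0 mul0r subrr normr0.
Qed.

Lemma sect_nil b al r : sect false al al r = set0 /\ sect b al al r = set0.
Proof.
split; apply/seteqP; split=> // p [s [rho [s1 s2 _ _]]].
  by have := lt_trans s1 s2; rewrite ltxx.
by have := lt_le_trans s1 (lteifW s2); rewrite ltxx.
Qed.

(** The row at height [t] meets the sector in an interval of length
    [sqrt (r^2 - t^2) - t cot be], a decreasing function of [t]. Its primitive
    is the area of a slice of the disc minus that of a triangle; it is written
    with the angle [asin (t / r)], and its increments are estimated by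
    trigonometry, the row length not being differentiable at the top of the
    disc. *)
Lemma area_est_sect0 (b : bool) be r : 0 <= be <= pi / 2 -> 0 < r ->
  area_est (sect b 0 be r) (be * r ^+ 2 / 2) (3 * r + 1).
Proof.
move=> /andP[]; rewrite le_eqVlt => /predU1P[<- _ r0|be0 be2 r0].
  rewrite (sect_nil _ _ _).2 !mul0r; apply: area_est_le area_est_empty; lra.
move=> y t0 xs y2; have pi0 := pi_gt0 R.
have sb0 : 0 < sin be by apply: sin_gt0_pi; lra.
have cb0 : 0 <= cos be by apply: cos_ge0_pihalf; lra.
pose c := cos be / sin be.
have c0 : 0 <= c by rewrite divr_ge0// ltW.
pose h := r * sin be.
have h0 : 0 < h by rewrite mulr_gt0.
have hr : h <= r by rewrite ger_pMr// sin_le1.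
pose ell (t : R) := Num.sqrt (r ^+ 2 - t ^+ 2) - t * c.
pose ph (t : R) := asin (t / r).
pose G t := r ^+ 2 * ((ph t + sin (ph t) * cos (ph t)) / 2) - t ^+ 2 * c / 2.
have phP t : 0 <= t <= h ->
  [/\ 0 <= ph t <= be, t = r * sin (ph t) & Num.sqrt (r ^+ 2 - t ^+ 2) = r * cos (ph t)].
  move=> /andP[t0' th].
  have tr : -1 <= t / r <= 1.
    rewrite ler_pdivrMr// mul1r (le_trans th hr) andbT.
    by rewrite (@le_trans _ _ 0) ?divr_ge0 ?(ltW r0)//; lra.
  have sE : t = r * sin (ph t) by rewrite asinK ?in_itv//= mulrC divfK// gt_eqF.
  have p1 := asin_geNpi2 tr; have p2 := asin_lepi2 tr.
  have pin : ph t \in `[(- (pi / 2)), pi / 2] by rewrite in_itv/= p1.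
  split=> //.
    apply/andP; split; rewrite leNgt; apply/negP.
      rewrite -ltr_sin// ?sin0 ?asinK ?in_itv//=; last lra.
      by rewrite ltNge divr_ge0// ltW.
    rewrite -ltr_sin// ?asinK ?in_itv//=; last lra.
    by rewrite ltNge ler_pdivrMr// mulrC th.
  rewrite cos_asin// -[X in X * _](gtr0_norm r0) -sqrtr_sqr.
  rewrite -sqrtrM ?sqr_ge0//; congr Num.sqrt.
  by rewrite mulrBr mulr1 -exprMn [r * _]mulrC divfK// gt_eqF.
have ellr (t : R) : 0 <= t <= h -> 0 <= ell t <= r.
  move=> t0h; have [/andP[p0 pb] tE sE] := phP _ t0h; rewrite /ell sE.
  have -> : r * cos (ph t) - t * c = r * (sin (be - ph t) / sin be).
    by rewrite sinB {2}tE /c; field; exact: lt0r_neq0.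
  rewrite mulr_ge0 ?(ltW r0) ?divr_ge0 ?(ltW sb0) ?sin_ge0_pi//=; last lra.
  rewrite ger_pMr// ler_pdivrMr// mul1r leNgt; apply/negP.
  by rewrite ltr_sin ?in_itv//=; lra.
have phh : ph h = be by rewrite /ph /h mulrAC divff ?gt_eqF// mul1r sinK// in_itv/=; lra.
have Gh : G h = be * r ^+ 2 / 2.
  rewrite /G phh /h /c exprMn; field; exact: lt0r_neq0.
have G0 : G 0 = 0.
  have as0 : asin 0 = 0 :> R by rewrite -{1}sin0 sinK// in_itv/=; lra.
  by rewrite /G /ph mul0r as0 sin0 mul0r addr0 mul0r mulr0 expr0n mul0r mul0r subrr.
rewrite -Gh; apply: (@cnt_strip R _ y t0 h r ell G) => //.
- by rewrite hr ltW.
- move=> i j /(sect0P _ _ _ _)[||T0 TX XT]; [by rewrite be0|by []|].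
  rewrite T0/= -(@ler_pXn2r _ 2)// ?nnegrE ?(ltW T0) ?(ltW h0)// /h exprMn.
  move: T0 TX XT; set T := (_ + _ : R); set X := (_ + _ : R) => T0 TX XT.
  have XT' : T * cos be <= X * sin be by exact: (lteifW TX).
  have := cos2Dsin2 be => cs.
  have : (T * cos be) ^+ 2 <= (X * sin be) ^+ 2.
    have Tc0 : 0 <= T * cos be by rewrite mulr_ge0// ltW.
    by rewrite ler_pXn2r// nnegrE// (le_trans Tc0).
  have : (X ^+ 2 + T ^+ 2) * sin be ^+ 2 <= r ^+ 2 * sin be ^+ 2.
    by rewrite ler_wpM2r// sqr_ge0.
  rewrite !exprMn mulrDl => h1 h2.
  by rewrite -[T ^+ 2]mulr1 -cs mulrDr; lra.
- move=> j /andP[T0 Th]; set T := j%:~R * y + t0 in T0 Th *.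
  have phT : 0 <= T <= h by rewrite (ltW T0). have [/andP[p0 pb] TE sE] := phP _ phT.
  have rT : 0 <= r ^+ 2 - T ^+ 2.
    by rewrite subr_ge0 ler_pXn2r ?nnegrE ?(ltW T0) ?(ltW r0)// (le_trans Th).
  have rowE i : row (latpts y t0 xs (sect b 0 be r)) j i <->
      T * c < i%:~R + xs j ?<= if b /\ (i%:~R + xs j) ^+ 2 <= r ^+ 2 - T ^+ 2.
    rewrite /row /latpts /= -/T sect0P// ?be0// lerBrDr -lteif_pdivrMr// mulrA.
    by split=> [[]|[]].
  apply: (@cnt_interval _ (xs j)).
  + (* the row is nonempty below the height [h] *)
    by have /andP[] := ellr _ phT; rewrite subr_ge0.
  + move=> i /andP[i1 i2]; apply/rowE; split; first exact: lteifS.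
    have X0 : 0 <= i%:~R + xs j by rewrite (le_trans _ (ltW i1))// mulr_ge0// ltW.
    by rewrite -(@sqr_sqrtr _ (r ^+ 2 - T ^+ 2))// ler_pXn2r// nnegrE sqrtr_ge0.
  + move=> i /rowE [/lteifW i1 i2]; rewrite i1/=.
    have X0 : 0 <= i%:~R + xs j by rewrite (le_trans _ i1)// mulr_ge0// ltW.
    by rewrite -(ger0_norm X0) -sqrtr_sqr ler_wsqrtr.
- move=> s t s0 st th.
  have [/andP[p0 pb] sE sqs] : [/\ 0 <= ph s <= be, s = r * sin (ph s)
      & Num.sqrt (r ^+ 2 - s ^+ 2) = r * cos (ph s)].
    by apply: phP; rewrite s0 (le_trans st).
  have [/andP[q0 qb] tE sqt] : [/\ 0 <= ph t <= be, t = r * sin (ph t)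
      & Num.sqrt (r ^+ 2 - t ^+ 2) = r * cos (ph t)].
    by apply: phP; rewrite th (le_trans s0).
  have pq : ph s <= ph t.
    rewrite leNgt; apply/negP; rewrite -ltr_sin ?in_itv//=; [|lra|lra].
    by rewrite ltNge -(ler_pM2l r0) -sE -tE st.
  have /andP[/(ler_wpM2l (sqr_ge0 r)) a1 /(ler_wpM2l (sqr_ge0 r)) a2] :=
    arc_area_bounds p0 pq (le_trans qb be2).
  rewrite /ell sqs sqt /G.
  have tsc : 0 <= (t - s) ^+ 2 * c by rewrite mulr_ge0// sqr_ge0.
  have E1 : (t - s) * (r * cos (ph t)) = r ^+ 2 * ((sin (ph t) - sin (ph s)) * cos (ph t)).
    by rewrite {1}tE {1}sE; ring.
  have E2 : (t - s) * (r * cos (ph s)) = r ^+ 2 * ((sin (ph t) - sin (ph s)) * cos (ph s)).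
    by rewrite {1}tE {1}sE; ring.
  rewrite !mulrBr E1 E2; move: a1 a2 tsc; clear; nra.
Qed.

End Sectors.

Section GeneralSectors.
Variable R : realType.
Implicit Types (D : set (R * R)) (A e y r al be ga s : R) (xs : int -> R).

Lemma expi_inj s t : - (pi *+ 2) < s - t < pi *+ 2 ->
  cos s = cos t -> sin s = sin t -> s = t :> R.
Proof.
move=> /andP[st1 st2] cE sE.
have c1 : cos (s - t) = 1 by rewrite cosB cE sE -!expr2 cos2Dsin2.
have sh : sin ((s - t) / 2) = 0.
  have : cos ((s - t) / 2 *+ 2) = 1 by rewrite -mulr_natr divfK ?pnatr_eq0.
  rewrite cos_mulr2n cos2sin2 => h; apply/eqP; rewrite -sqrf_eq0; apply/eqP; lra.
apply/eqP; rewrite -subr_eq0; apply: contra_eqT sh; rewrite neq_lt => /orP[lt0|gt0].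
  rewrite -[_ / _]opprK sinN oppr_eq0 gt_eqF// sin_gt0_pi//; lra.
by rewrite gt_eqF// sin_gt0_pi//; lra.
Qed.

Lemma sect_angle (b : bool) al be r s rho : 0 < rho ->
  (forall t, al < t -> t <= be -> - (pi *+ 2) < s - t < pi *+ 2) ->
  sect b al be r (rho * cos s, rho * sin s) -> al < s /\ s < be ?<= if b.
Proof.
move=> rho0 near [t [rho' [t1 t2 /andP[rho'0 _]]]] [E1 E2].
suff -> : s = t by [].
have rE : rho = rho'.
  apply/eqP; rewrite -(@eqrXn2 _ 2)// ?ltW//; apply/eqP.
  rewrite -[LHS]mulr1 -(cos2Dsin2 s) -[RHS]mulr1 -(cos2Dsin2 t) !mulrDr.
  by rewrite -!exprMn E1 E2.
move: E1 E2; rewrite -rE => /(mulfI (lt0r_neq0 rho0)) c /(mulfI (lt0r_neq0 rho0)) s'.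
by apply: expi_inj => //; apply: near => //; exact: lteifW t2.
Qed.

Lemma sect_split al ga be r : al <= ga <= be ->
  sect true al be r = sect true al ga r `|` sect true ga be r.
Proof.
move=> /andP[ag gb]; apply/seteqP; split=> [p [s [rho [s1 s2 rr ->]]]|p].
  by have [sg|sg] := leP s ga; [left|right]; exists s, rho.
move=> [] [s [rho [/= s1 s2 rr ->]]]; exists s, rho; split=> //=.
  exact: le_trans gb.
exact: le_lt_trans s1.
Qed.

Lemma area_est_sect_cut al ga be r A A' e e' :
  al <= ga <= be -> be <= al + pi *+ 2 ->
  area_est (sect true al ga r) A e -> area_est (sect true ga be r) A' e' ->
  area_est (sect true al be r) (A + A') (e + e').
Proof.
move=> agb ab E E'; rewrite (sect_split _ agb); apply: area_estU => //.
apply/seteqP; split=> // p [pa [s [rho [/= s1 s2 /andP[rho0 _] pE]]]].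
move: pa; rewrite pE => /(sect_angle rho0)[t t1 t2|_]; first lra.
by rewrite /= leNgt s1.
Qed.

Lemma sectD (b : bool) al ga be r : al <= ga <= be -> be <= al + pi *+ 2 ->
  sect b al be r `\` sect b al ga r =
  [set p | exists s rho, [/\ al < s, ga < s ?<= if ~~ b, s < be ?<= if b,
      0 < rho <= r & p = (rho * cos s, rho * sin s)]].
Proof.
move=> /andP[ag gb] ab; apply/seteqP; split=> p.
  move=> [[s [rho [s1 s2 rr ->]]] np]; exists s, rho; split=> //.
  by rewrite lteifNE; apply/negP => sg; apply: np; exists s, rho.
move=> [s [rho [s0 gs sb rr pE]]]; have /andP[rho0 _] := rr.
split; first by exists s, rho.
have := lteifW sb; rewrite pE => sbe /(sect_angle rho0)[t t1 t2|_]; first lra.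
by apply/negP; rewrite -lteifNE.
Qed.

Lemma sub_sect (b : bool) al ga be r : ga <= be ->
  sect b al ga r `<=` sect b al be r.
Proof.
move=> gb p [s [rho [s1 s2 rr ->]]]; exists s, rho; split=> //.
by case: b s2 => /= [/le_trans|/lt_le_trans]; apply.
Qed.

Lemma area_est_sect_sub al ga be r A A' e e' : al <= ga <= be -> be <= al + pi *+ 2 ->
  area_est (sect true al be r) A e -> area_est (sect true al ga r) A' e' ->
  area_est (sect true ga be r) (A - A') (e + e').
Proof.
move=> agb ab E E'; have /andP[ag gb] := agb.
apply: area_est_eq (area_estD (sub_sect gb) E E') => //; rewrite sectD//.
apply/seteqP; split=> [p [s [rho [/= s1 s2 s3 rr ->]]]|p [s [rho [/= s1 s2 rr ->]]]].
  by exists s, rho.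
by exists s, rho; split=> //; exact: le_lt_trans s1.
Qed.

(** A reflection in the vertical axis exchanges the two ends of the second
    quadrant, so that the horizontal ray is missing from the open sector that
    it is compared with. This ray lies in a single row. *)
Lemma area_est_ray r : 0 < r -> area_est [set p | p.2 = 0 /\ 0 < p.1 <= r] 0 (r + 1).
Proof.
move=> r0 y t0 xs y2; have y0 : 0 < y by lra.
rewrite mul0r subr0 ger0_norm ?cnt_ge0//.
set L := latpts _ _ _ _.
have [[j jE]|noj] := pselect (exists j : int, j%:~R * y + t0 = 0); last first.
  suff -> : L = set0 by rewrite cnt0; split=> //; lra.
  apply/seteqP; split=> // -[i j] [/= p0 _]; by apply: noj; exists j.
pose I := [set i : int | 0 < i%:~R + xs j <= r].
have [//|i /andP[/ltW -> ->]//|fI cI] := @cnt_interval R (xs j) 0 r I (ltW r0).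
have -> : L = (fun i => (i, j)) @` I.
  apply/seteqP; split=> [[i k] [/= p0 pr]|_ [i Ii <-]]; last by [].
  have kj : k = j.
    have : (k%:~R : R) = j%:~R.
      by apply: (mulIf (lt0r_neq0 y0)); apply: (addIr t0); rewrite p0 jE.
    by move/eqP; rewrite eqr_int => /eqP.
  by exists i; [rewrite /I /= -kj|rewrite kj].
rewrite cnt_image; last by move=> a b _ _ [].
split; first exact: finite_image.
by move: cI; rewrite ler_norml subr0; lra.
Qed.

(** The sector is the mirror image of the difference of two open sectors of the
    first quadrant. *)
Lemma area_est_quadrant2 ga r : 0 <= ga <= pi / 2 -> 0 < r ->
  area_est (sect true (pi / 2) (pi / 2 + ga) r) (ga * r ^+ 2 / 2) (2 * (3 * r + 1)).
Proof.
move=> /andP[g0 g2] r0; have pi0 := pi_gt0 R.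
have hE : area_est (sect false 0 (pi / 2) r) (pi / 2 * r ^+ 2 / 2) (3 * r + 1).
  by apply: area_est_sect0 => //; lra.
have sE s rho : (- (rho * cos s), rho * sin s) = (rho * cos (pi - s), rho * sin (pi - s)).
  by rewrite cosB sinB cospi sinpi; congr (_, _); ring.
have [gE|gpi] := eqVneq ga (pi / 2).
  apply: (@area_est_eq _ [set p | (sect false 0 (pi / 2) r `|`
     [set p : R * R | p.2 = 0 /\ 0 < p.1 <= r]) (- p.1, p.2)]
     _ (pi / 2 * r ^+ 2 / 2 + 0)); last first.
  - apply: area_est_reflX; apply: area_est_le (area_estU _ hE (area_est_ray r0)); first lra.
    apply/seteqP; split=> // p [[s [rho [s0 /= s1 /andP[rho0 _] ->]]] /= [+ _]].
    move/eqP; rewrite mulf_eq0 (gt_eqF rho0)/= gt_eqF// sin_gt0_pi//; lra.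
  - by rewrite gE addr0.
  apply/seteqP; split=> [[X Y]|_ [s [rho [/= s0 s1 rr ->]]]].
    move=> [[s [rho [s0 /= s1 rr pE]]]|/= [Y0 X0]].
      exists (pi - s), rho; split; rewrite /=; [lra|lra|by []|].
      by rewrite -sE; case: pE => <- <-; rewrite opprK.
    exists pi, (- X); split; rewrite /= ?gE; [lra|lra|lra|].
    by rewrite cospi sinpi Y0 mulr0 mulrN1 opprK.
  have [spi|spi] := eqVneq s pi.
    by right; rewrite /= spi sinpi cospi mulr0; split=> //; lra.
  left; rewrite /= sE; exists (pi - s), rho; split; rewrite /=; [lra|lra|by []|by []].
have gp : ga < pi / 2 by rewrite lt_neqAle gpi.
have kE : area_est (sect false 0 (pi / 2 - ga) r) ((pi / 2 - ga) * r ^+ 2 / 2) (3 * r + 1).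
  by apply: area_est_sect0 => //; lra.
have sub : pi / 2 - ga <= pi / 2 by lra.
have dE := area_estD (@sub_sect false _ _ _ _ sub) hE kE.
apply: area_est_eq (area_est_reflX (area_est_le _ dE)); last lra.
  rewrite sectD; [|lra|lra]; apply/seteqP; split=> [[X Y]|_ [s [rho [/= s0 s1 rr ->]]]].
    move=> [s [rho [s0 /= s1 s2 rr pE]]]; exists (pi - s), rho.
    split; rewrite /=; [lra|lra|by []|].
    by rewrite -sE; case: pE => <- <-; rewrite opprK.
  by exists (pi - s), rho; rewrite /= sE; split=> //=; lra.
by ring.
Qed.

Lemma area_est_sectDpi al be r A e : area_est (sect true al be r) A e ->
  area_est (sect true (al + pi) (be + pi) r) A e.
Proof.
move=> /area_est_opp; apply: area_est_eq => //; apply/seteqP; split=> [[X Y]|p] [s [rho]].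
  move=> [s0 /= s1 rr [XE YE]]; exists (s + pi), rho; split; rewrite /=; [lra|lra|by []|].
  by rewrite cosDpi sinDpi !mulrN -XE -YE !opprK.
move=> [s0 /= s1 rr ->]; exists (s - pi), rho; split; rewrite /=; [lra|lra|by []|].
rewrite -{1 2}[s](subrK pi) cosDpi sinDpi !mulrN !opprK//.
Qed.

Lemma area_est_sectBpi al be r A e : area_est (sect true al be r) A e ->
  area_est (sect true (al - pi) (be - pi) r) A e.
Proof.
move=> /area_est_opp; apply: area_est_eq => //; apply/seteqP; split=> [[X Y]|p] [s [rho]].
  move=> [s0 /= s1 rr [XE YE]]; exists (s - pi), rho; split; rewrite /=; [lra|lra|by []|].
  move: XE YE; rewrite -{1 2}[s](subrK pi) cosDpi sinDpi !mulrN.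
  by move=> /oppr_inj -> /oppr_inj ->.
move=> [s0 /= s1 rr ->]; exists (s + pi), rho; split; rewrite /=; [lra|lra|by []|].
by rewrite cosDpi sinDpi !mulrN.
Qed.

Lemma area_est_sectDpiz (k : int) al be r A e : area_est (sect true al be r) A e ->
  area_est (sect true (al + k%:~R * pi) (be + k%:~R * pi) r) A e.
Proof.
move=> E; elim: k => [|k|k]; first by rewrite !mul0r !addr0.
  move=> /area_est_sectDpi; apply: area_est_eq => //.
  by congr (sect _ _ _ _); rewrite intS intrD; ring.
move=> /area_est_sectBpi; apply: area_est_eq => //.
by congr (sect _ _ _ _); rewrite !mulrNz intS intrD; ring.
Qed.

(** The half-turn preserves half-open sectors and the rows, which leaves two
    quadrants to consider. *)
Lemma area_est_quadrant (n : int) ga r : 0 <= ga <= pi / 2 -> 0 < r ->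
  area_est (sect true (n%:~R * (pi / 2)) (n%:~R * (pi / 2) + ga) r)
      (ga * r ^+ 2 / 2) (2 * (3 * r + 1)).
Proof.
move=> g02 r0.
have [k [nE|nE]] : exists k : int, n = k + k \/ n = k + k + 1.
- by exists (n %/ 2)%Z; lia.
- have E0 := area_est_sect0 true g02 r0.
  apply: area_est_eq (area_est_sectDpiz k (area_est_le _ E0)) => //; last lra.
  by congr (sect _ _ _ _); rewrite nE intrD; field.
- apply: area_est_eq (area_est_sectDpiz k (area_est_quadrant2 g02 r0)) => //.
  by congr (sect _ _ _ _); rewrite nE !intrD; field.
Qed.

(** An arc of at most a quarter turn meets at most two quadrants; the two
    doublings that follow reach the full turn. *)
Lemma area_est_sect_quarter al be r : 0 < r -> al <= be <= al + pi / 2 ->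
  area_est (sect true al be r) ((be - al) * r ^+ 2 / 2) (8 * (3 * r + 1)).
Proof.
move=> r0 /andP[ab ba]; have pi0 := pi_gt0 R; have pi2 : 0 < pi / 2 :> R by lra.
have same (n : int) s t : n%:~R * (pi / 2) <= s -> s <= t ->
    t <= n%:~R * (pi / 2) + pi / 2 ->
    area_est (sect true s t r) ((t - s) * r ^+ 2 / 2) (4 * (3 * r + 1)).
  move=> ns st tn; set o := n%:~R * (pi / 2) in ns tn.
  have [Es Et] : area_est (sect true o s r) ((s - o) * r ^+ 2 / 2) (2 * (3 * r + 1)) /\
      area_est (sect true o t r) ((t - o) * r ^+ 2 / 2) (2 * (3 * r + 1)).
    split.
      have /area_est_quadrant/(_ r0) : 0 <= s - o <= pi / 2 by lra.
      by move=> /(_ n); rewrite -/o addrC subrK.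
    have /area_est_quadrant/(_ r0) : 0 <= t - o <= pi / 2 by lra.
    by move=> /(_ n); rewrite -/o addrC subrK.
  have ost : o <= s <= t by rewrite ns.
  have to : t <= o + pi *+ 2 by lra.
  apply: area_est_eq (area_est_le _ (area_est_sect_sub ost to Et Es)) => //; last lra.
  by ring.
have := floor_itv (al / (pi / 2)); set n := Num.floor _ => /andP[].
rewrite ler_pdivlMr// ltr_pdivrMr// intrD => n1 n2.
have [bn|nb] := leP be (n%:~R * (pi / 2) + pi / 2).
  by apply: (area_est_le _ (same n _ _ n1 ab bn)); lra.
pose c : R := n%:~R * (pi / 2) + pi / 2.
have acb : al <= c <= be by rewrite /c; lra.
have bal : be <= al + pi *+ 2 by lra.
have Ec : area_est (sect true al c r) ((c - al) * r ^+ 2 / 2) (4 * (3 * r + 1)).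
  by apply: (same n) => //; rewrite /c; lra.
have Ec' : area_est (sect true c be r) ((be - c) * r ^+ 2 / 2) (4 * (3 * r + 1)).
  by apply: (same (n + 1)); rewrite ?intrD /c; lra.
apply: area_est_eq (area_est_le _ (area_est_sect_cut acb bal Ec Ec')) => //; last lra.
by ring.
Qed.

Theorem area_est_sect al be r : 0 < r -> al <= be <= al + pi *+ 2 ->
  area_est (sect true al be r) ((be - al) * r ^+ 2 / 2) (100 * (r + 1)).
Proof.
move=> r0 /andP[ab ba]; have pi0 := pi_gt0 R.
have half (w c : R) : (forall s t, s <= t <= s + w ->
      area_est (sect true s t r) ((t - s) * r ^+ 2 / 2) c) -> w <= pi ->
    forall s t, s <= t <= s + w *+ 2 ->
      area_est (sect true s t r) ((t - s) * r ^+ 2 / 2) (c + c).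
  move=> H wpi s t st; pose m := (s + t) / 2.
  have smt : s <= m <= t by rewrite /m; lra.
  have ts : t <= s + pi *+ 2 by lra.
  have E1 : area_est (sect true s m r) ((m - s) * r ^+ 2 / 2) c by apply: H; rewrite /m; lra.
  have E2 : area_est (sect true m t r) ((t - m) * r ^+ 2 / 2) c by apply: H; rewrite /m; lra.
  by apply: area_est_eq (area_est_sect_cut smt ts E1 E2) => //; ring.
have H1 := half (pi / 2) _ (fun s t => @area_est_sect_quarter s t r r0).
have H2 := half (pi / 2 *+ 2) _ (H1 _).
apply: (area_est_le _ (H2 _ _ _ _ _)); lra.
Qed.

End GeneralSectors.

(** * Traces and norms of quadratic integers *)

Section ComplexNumbers.
Variable R : realType.

Lemma ratrCE (q : rat) : ratr q = (real_complex R (ratr q)) :> R[i].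
Proof. by rewrite fmorph_rat. Qed.

Lemma conjcM (x y : R[i]) : conjc (x * y) = conjc x * conjc y.
Proof. exact: rmorphM. Qed.
Lemma conjc_ratr (q : rat) : conjc (ratr q : R[i]) = ratr q.
Proof. by rewrite ratrCE conjc_real. Qed.

(** Multiplication by an element of a quadratic field has the two conjugates
    of the element as eigenvalues. *)
Lemma trace_two_eigenvectors n (M : 'M[rat]_n) (u v : 'I_n -> R[i]) (a b : R[i]) :
  n = 2%N ->
  (forall i, \sum_j ratr (M i j) * u j = a * u i) ->
  (forall i, \sum_j ratr (M i j) * v j = b * v i) ->
  (exists i j, u i * v j != u j * v i) ->
  ratr (\tr M) = a + b.
Proof.
move=> n2; subst n; rewrite /mxtrace !big_ord_recl big_ord0 addr0 => Mu Mv.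
set o0 : 'I_2 := ord0; set o1 : 'I_2 := lift ord0 ord0.
have D : (exists i j, u i * v j != u j * v i) -> u o0 * v o1 - u o1 * v o0 != 0.
  move=> [i [j]]; rewrite subr_eq0.
  have oE (k : 'I_2) : k = o0 \/ k = o1.
    by case: k => -[|[|//]] ?; [left|right]; apply: val_inj.
  by case: (oE i) => ->; case: (oE j) => ->; rewrite ?eqxx// eq_sym.
move=> /D /mulIf; apply.
have := Mu o0; have := Mu o1; have := Mv o0; have := Mv o1.
rewrite !big_ord_recl !big_ord0 !addr0 -/o0 -/o1 rmorphD/= => e1 e2 e3 e4.
have -> : (ratr (M o0 o0) + ratr (M o1 o1)) * (u o0 * v o1 - u o1 * v o0) =
   (ratr (M o0 o0) * u o0 + ratr (M o0 o1) * u o1) * v o1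
 - (ratr (M o0 o0) * v o0 + ratr (M o0 o1) * v o1) * u o1
 + (ratr (M o1 o0) * v o0 + ratr (M o1 o1) * v o1) * u o0
 - (ratr (M o1 o0) * u o0 + ratr (M o1 o1) * u o1) * v o0 :> R[i] by ring.
by rewrite e1 e2 e3 e4; ring.
Qed.

End ComplexNumbers.

Section QuadraticField.
Variables (R : realType) (K : fieldExtType rat) (iota : {rmorphism K -> R[i]}).
Hypothesis dimK : \dim {:K} = 2%N.
Hypothesis nonreal : exists x : K, complex.Im (iota x) != 0.

Lemma iotaZ (q : rat) (x : K) : iota (q *: x) = ratr q * iota x.
Proof.
rewrite -mulr_algl rmorphM; congr (_ * _).
exact: (fmorph_eq_rat (iota \o in_alg K) q).
Qed.

(** Otherwise all the elements of the field would be real multiples of a single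
    complex number, and the field, which contains [1], would be real. *)
Lemma basis_wedge (b : (\dim {:K}).-tuple K) : basis_of {:K} b ->
  exists i j, iota (tnth b i) * conjc (iota (tnth b j)) !=
              iota (tnth b j) * conjc (iota (tnth b i)).
Proof.
move=> bB; apply: contrapT => N.
have C i j : iota (tnth b i) * conjc (iota (tnth b j)) =
    iota (tnth b j) * conjc (iota (tnth b i)).
  by apply/eqP; apply: contraT => ne; case: N; exists i, j.
have CK x y : iota x * conjc (iota y) = iota y * conjc (iota x).
  have E z : iota z = \sum_i ratr (coord b i z) * iota (tnth b i).
    rewrite {1}(coord_basis bB (memvf z)) rmorph_sum; apply: eq_bigr => i _.
    by rewrite (tnth_nth 0) iotaZ.
  rewrite (E x) (E y) !rmorph_sum !mulr_suml; under eq_bigr do rewrite mulr_sumr.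
  under [RHS]eq_bigr do rewrite mulr_sumr.
  rewrite exchange_big/=; apply: eq_bigr => i _; apply: eq_bigr => j _.
  rewrite [X in _ * X = _]conjcM [X in _ = _ * X]conjcM !conjc_ratr.
  by rewrite mulrACA C; ring.
case: nonreal => x; have := CK x 1; rewrite rmorph1 conjc1 mulr1 mul1r.
case: (iota x) => p q /= [] /eqP; rewrite -subr_eq0 opprK -mulr2n mulrn_eq0/=.
by move=> /eqP -> /eqP.
Qed.

Lemma iota_trace x : ratr (field_trace x) = iota x + conjc (iota x).
Proof.
have bB := vbasisP {:K}.
set B := vbasis {:K} in bB *.
set M := passmx.mxof B B (amull x).
have ME i j : M i j = coord B j (x * tnth B i).
  by rewrite !mxE/= passmx.vecof_delta lfunE/= (tnth_nth 0).
have key i : \sum_j ratr (M i j) * iota (tnth B j) = iota x * iota (tnth B i).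
  rewrite -rmorphM {1}(coord_basis bB (memvf (x * tnth B i))) rmorph_sum.
  by apply: eq_bigr => j _; rewrite ME iotaZ -(tnth_nth 0 B j).
apply: (@trace_two_eigenvectors R _ M (fun i => iota (tnth B i))
    (fun i => conjc (iota (tnth B i)))) => //.
  move=> i; rewrite -conjcM -key rmorph_sum; apply: eq_bigr => j _.
  by rewrite [RHS]conjcM conjc_ratr.
exact: basis_wedge.
Qed.

Lemma rat_integral_int (q : rat) : integralOver (intr : int -> R[i]) (ratr q) ->
  exists n : int, q = n%:~R.
Proof.
move=> [p pm pq].
have : root (map_poly (intr : int -> algC) p) (ratr q).
  have pE (F : numFieldType) : map_poly (intr : int -> F) p = map_poly ratr (map_poly intr p).
    by rewrite -map_poly_comp; apply: eq_map_poly => n /=; rewrite ratr_int.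
  by move: pq; rewrite (pE R[i]) (pE algC) !fmorph_root.
move=> /(root_monic_Aint) pr.
have /intrP[n nE] : (ratr q : algC) \in Num.int.
  apply: Cint_rat_Aint; first exact: Crat_rat.
  apply: pr; first exact: monic_map.
  by apply/polyOverP => i; rewrite coef_map/= intr_int.
by exists n; apply: (fmorph_inj (ratr : {rmorphism rat -> algC})); rewrite /= nE ratr_int.
Qed.

Local Notation O := (ringOfIntegers K).

Lemma integral_iota (a : O) : integralOver (intr : int -> R[i]) (iota (val a)).
Proof.
have /asboolP/(integral_rmorph iota) := integer_valP a.
by case=> p pm; exists p => //; rewrite -(eq_map_poly (fun n => rmorph_int iota n)).
Qed.

Lemma integral_conj (z : R[i]) : integralOver (intr : int -> R[i]) z ->
  integralOver (intr : int -> R[i]) (conjc z).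
Proof.
move=> /(integral_rmorph (conjc : {rmorphism R[i] -> R[i]})).
case=> p pm; exists p => //.
by rewrite -(eq_map_poly (fun n => rmorph_int (conjc : {rmorphism R[i] -> R[i]}) n)).
Qed.

Lemma trace_int (a : O) : exists t : int,
  iota (val a) + conjc (iota (val a)) = t%:~R.
Proof.
have [|t tE] := @rat_integral_int (field_trace (val a)).
  rewrite iota_trace; apply: integral_add; first exact: integral_iota.
  exact/integral_conj/integral_iota.
by exists t; rewrite -iota_trace tE ratr_int.
Qed.

(** The norm is [(tr x ^ 2 - tr (x ^ 2)) / 2]. *)
Lemma norm_rat (x : K) : exists q : rat, iota x * conjc (iota x) = ratr q.
Proof.
exists ((field_trace x ^+ 2 - field_trace (x ^+ 2)) / 2).
rewrite fmorph_div [X in X / _]rmorphB [X in X - _]rmorphXn/= !iota_trace.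
by rewrite rmorph_nat expr2 rmorphM conjcM; field.
Qed.

Lemma norm_nat (a : O) : exists n : nat,
  iota (val a) * conjc (iota (val a)) = n%:R.
Proof.
have [q qE] := norm_rat (val a).
have [|n nE] := @rat_integral_int q.
  rewrite -qE; apply: integral_mul; first exact: integral_iota.
  exact/integral_conj/integral_iota.
exists `|n|%N; rewrite qE nE ratr_int -[RHS]/(`|n|%N%:~R) gez0_abs//.
rewrite -(ler0z R[i]) -ratr_int -nE -qE.
case: (iota _) => u v; rewrite lecE/= mulrN mulrC addNr eqxx mulrN opprK.
by rewrite -!expr2 addr_ge0 ?sqr_ge0.
Qed.

End QuadraticField.

(** * The ring of integers as a plane lattice *)

(** All that the count of points uses about the ring of integers: it is the
    lattice spanned by [1] and [w], whose horizontal rows have unit spacing and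
    are at distance at least [1 / 2] from each other, uniformly in the field;
    and it is stable under conjugation, with integral norms. *)
Record plane_order (R : realType) (O : comNzRingType)
    (e : {rmorphism O -> R[i]}) (w : O) : Prop := PlaneOrder {
  order_inj : injective e;
  order_basis : forall a, exists i j : int, a = i%:~R + w *~ j;
  order_im : 1 / 2 <= complex.Im (e w);
  order_norm : forall a, exists n : nat, cmod (e a) ^+ 2 = n%:R;
  order_conj : forall a, exists a', e a' = conjc (e a) }.

Section IntegersOrder.
Variables (R : realType) (K : fieldExtType rat) (iota : {rmorphism K -> R[i]}).
Hypothesis dimK : \dim {:K} = 2%N.
Hypothesis nonreal : exists x : K, complex.Im (iota x) != 0.
Local Notation O := (ringOfIntegers K).

Definition int_embed : O -> R[i] := iota \o val.
HB.instance Definition _ := GRing.RMorphism.on int_embed.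

Lemma int_embed_inj : injective int_embed.
Proof. by move=> a b /fmorph_inj/val_inj. Qed.

Lemma mul_conjcE (z : R[i]) : z * conjc z = real_complex R (cmod z ^+ 2).
Proof.
case: z => p q; rewrite /cmod/= sqr_sqrtr ?addr_ge0 ?sqr_ge0//.
by simpc; rewrite !expr2; congr (_ +i* _)%C; ring.
Qed.

Lemma cmod_sqr (z : R[i]) : cmod z ^+ 2 = complex.Re z ^+ 2 + complex.Im z ^+ 2.
Proof. by case: z => p q; rewrite /cmod/= sqr_sqrtr ?addr_ge0 ?sqr_ge0. Qed.

Lemma natCE n : n%:R = real_complex R n%:R.
Proof. by rewrite rmorph_nat. Qed.
Lemma intCE (n : int) : n%:~R = real_complex R n%:~R.
Proof. by rewrite rmorph_int. Qed.

Lemma int_embed_norm (a : O) : exists n : nat, cmod (int_embed a) ^+ 2 = n%:R.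
Proof.
have [n nE] := norm_nat dimK nonreal a; exists n.
by move: nE; rewrite mul_conjcE natCE => -[].
Qed.

Lemma int_embed_trace (a : O) : exists t : int, 2 * complex.Re (int_embed a) = t%:~R.
Proof.
have [t tE] := trace_int dimK nonreal a; exists t.
move: tE; rewrite intCE /int_embed/=; case: (iota _) => p q /= [] <- _; ring.
Qed.

Lemma int_embed_conj (a : O) : exists a', int_embed a' = conjc (int_embed a).
Proof.
have [t tE] := trace_int dimK nonreal a; exists (t%:~R - a).
by rewrite rmorphB rmorph_int -tE /int_embed/= addrAC subrr add0r.
Qed.

Lemma real_integer (a : O) : complex.Im (int_embed a) = 0 -> exists n : int, a = n%:~R.
Proof.
move=> im0; have [t tE] := int_embed_trace a; have [n nE] := int_embed_norm a.
move: nE; rewrite cmod_sqr im0 expr0n addr0 => nE.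
have : t * t = 4 * n%:Z.
  apply/eqP; rewrite -(eqr_int R) !intrM -tE -[n%:~R]/(n%:R) -nE; apply/eqP; ring.
move=> tn; have [s sE] : exists s : int, t = s + s.
  exists (t %/ 2)%Z; have := divz_eq t 2; have := modz_ge0 t (isT : (2 : int) != 0).
  have := ltz_pmod t (isT : (0 : int) < 2).
  set q := (t %/ 2)%Z; set m := (t %% 2)%Z => m2 m0 tq.
  have [m0'|m1] : m = 0 \/ m = 1 by lia.
    lia.
  exfalso; move: tn; rewrite tq m1 => tn.
  have : (q * 2 + 1) * (q * 2 + 1) = 4 * (q * q + q) + 1 by ring.
  lia.
exists s; apply: int_embed_inj; rewrite rmorph_int intCE.
move: tE im0; rewrite sE intrD; case: (int_embed a) => p q /= pE ->.
by congr (_ +i* _)%C; lra.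
Qed.

(** A non-real element [x] becomes integral after multiplication by the
    denominators of its trace and of its norm. *)
Lemma nonreal_integer : exists a : O, 0 < complex.Im (int_embed a).
Proof.
have [x x0] := nonreal.
have [n nE] := norm_rat dimK nonreal x.
pose t := field_trace x; have tE := iota_trace dimK nonreal x.
have xE : x ^+ 2 - t *: x + n *: 1 = 0.
  apply: (fmorph_inj iota); rewrite rmorph0 rmorphD rmorphB rmorphXn !iotaZ.
  by rewrite rmorph1 -nE tE; ring.
pose d : int := denq t * denq n.
have d0 : (d%:~R : rat) != 0 by rewrite intr_eq0 mulf_neq0 ?denq_neq0.
pose T : int := numq t * denq n.
pose N : int := d * (numq n * denq t).
have TE : T%:~R = d%:~R * t :> rat.
  by rewrite /T /d !intrM -[X in _ = _ * X]divq_num_den; field; rewrite intr_eq0 denq_neq0.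
have NE : N%:~R = d%:~R ^+ 2 * n :> rat.
  rewrite /N /d !intrM -[X in _ = _ * X]divq_num_den; field.
  by rewrite intr_eq0 denq_neq0.
have ai : algebraic_integer ((d%:~R : rat) *: x).
  apply/asboolP; exists ('X^2 - T *: 'X + N%:P).
    rewrite monicE -addrA lead_coefDl ?lead_coefXn//.
    rewrite size_polyXn (leq_ltn_trans (size_polyD _ _))// gtn_max size_polyN.
    rewrite (leq_ltn_trans (size_scale_leq _ _)) ?size_polyX//.
    by rewrite (leq_ltn_trans (size_polyC_leq1 _)).
  rewrite /root !rmorphD/= rmorphN/= map_polyXn map_polyZ/= map_polyX map_polyC/=.
  rewrite !hornerE.
  have inA (k : int) : k%:~R = (k%:~R : rat) *: 1 :> K by rewrite scaler_int.
  rewrite !inA TE NE; apply/eqP.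
  transitivity ((d%:~R ^+ 2 : rat) *: (x ^+ 2 - t *: x + n *: 1)); last first.
    by rewrite xE scaler0.
  rewrite exprZn -scalerAl mul1r !scalerA !scalerDr scalerN !scalerA.
  by congr (_ - _ *: _ + _); ring.
pose a : O := RingOfIntegers ai.
have aE : int_embed a = (d%:~R : R[i]) * iota x.
  by rewrite /int_embed /= iotaZ ratr_int.
have im0 : complex.Im (int_embed a) != 0.
  rewrite aE intCE; move: x0; case: (iota x) => p q /= q0.
  by simpc; rewrite mulf_neq0// intr_eq0; move: d0; rewrite intr_eq0.
have [h|h] := leP 0 (complex.Im (int_embed a)).
  by exists a; rewrite lt_neqAle h eq_sym im0.
exists (- a); have -> : int_embed (- a) = - int_embed a by exact: rmorphN.
by move: h; case: (int_embed a) => p q /=; rewrite oppr_gt0.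
Qed.

Lemma im_nat (a : O) : exists n : nat, 4 * complex.Im (int_embed a) ^+ 2 = n%:R.
Proof.
have [n nE] := int_embed_norm a; have [t tE] := int_embed_trace a.
have E : 4 * complex.Im (int_embed a) ^+ 2 = (4 * n%:Z - t * t)%:~R.
  rewrite intrB !intrM -tE -[n%:~R]/(n%:R) -nE cmod_sqr; ring.
move: E; set u := (_ - _ : int) => E; exists `|u|%N.
rewrite E -[RHS]/(`|u|%N%:~R) gez0_abs//.
by rewrite -(ler_int R) -E mulr_ge0 ?sqr_ge0.
Qed.

(** The second basis vector is an integer [w] of least positive imaginary part;
    it exists because [4 (Im a)^2 = 4 N(a) - tr(a)^2] is a natural number.
    Subtracting a multiple of [w] from an integer leaves a real integer, which
    is rational. *)
Lemma int_embed_plane_order : exists w, plane_order int_embed w.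
Proof.
pose P n := `[< exists a : O,
  0 < complex.Im (int_embed a) /\ 4 * complex.Im (int_embed a) ^+ 2 = n%:R >].
have exP : exists n, P n.
  have [a a0] := nonreal_integer; have [n nE] := im_nat a.
  by exists n; apply/asboolP; exists a.
case: (ex_minnP exP) => n /asboolP[w [w0 wn]] nmin.
exists w; split.
- exact: int_embed_inj.
- move=> a; have := floor_itv (complex.Im (int_embed a) / complex.Im (int_embed w)).
  set j := Num.floor _ => /andP[]; rewrite ler_pdivlMr// ltr_pdivrMr// intrD => j1 j2.
  pose a' := a - w *~ j.
  have imE : complex.Im (int_embed a') =
      complex.Im (int_embed a) - j%:~R * complex.Im (int_embed w).
    have -> : int_embed a' = int_embed a - j%:~R * int_embed w.
      by rewrite mulrzl -(rmorphMz int_embed) -(rmorphB int_embed).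
    rewrite intCE.
    by case: (int_embed a) => ? ?; case: (int_embed w) => ? ? /=; rewrite mul0r addr0.
  have im0 : complex.Im (int_embed a') = 0.
    have [m mE] := im_nat a'.
    apply/eqP; rewrite eq_le; apply/andP; split; last by rewrite imE; lra.
    rewrite leNgt; apply/negP => h.
    have /nmin : P m by apply/asboolP; exists a'.
    rewrite -(ler_nat R) -wn -mE ler_pM2l// ler_pXn2r ?nnegrE ?(ltW w0) ?(ltW h)//.
    by rewrite imE; lra.
  have [i iE] := real_integer im0; exists i, j.
  by rewrite -iE /a' subrK.
- have n0 : (0 < n)%N by rewrite -(ltr0n R) -wn mulr_gt0// exprn_gt0.
  have n1 : 1 <= n%:R :> R by rewrite ler1n.
  rewrite -(@ler_pXn2r _ 2)// ?nnegrE ?(ltW w0)//.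
  by move: n1; rewrite -wn; lra.
- exact: int_embed_norm.
- exact: int_embed_conj.
Qed.

End IntegersOrder.

(** * The discriminant and the covolume *)

Section Discriminant.
Variables (R : realType) (K : fieldExtType rat) (iota : {rmorphism K -> R[i]}).
Hypothesis dimK : \dim {:K} = 2%N.
Hypothesis nonreal : exists x : K, complex.Im (iota x) != 0.
Local Notation O := (ringOfIntegers K).

Definition wedge (u v : R[i]) : R :=
  complex.Im u * complex.Re v - complex.Re u * complex.Im v.

Lemma wedge_comb (u v : R[i]) (p q r s : int) :
  wedge (u *~ p + v *~ q) (u *~ r + v *~ s) = (p * s - q * r)%:~R * wedge u v.
Proof.
rewrite -[u *~ p]mulrzl -[v *~ q]mulrzl -[u *~ r]mulrzl -[v *~ s]mulrzl !intCE.
rewrite /wedge intrB !intrM.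
by case: u v => [u1 u2] [v1 v2] /=; ring.
Qed.

(** The Gram matrix of the trace form is the product of the matrix of the
    conjugates and its transpose; the determinant of the former is [2i] times
    the wedge. *)
Lemma det_conjugates n (b : 'I_n -> K) : n = 2%N ->
  exists u v : 'I_n, (forall i, i = u \/ i = v) /\ u != v /\
  (forall F : 'I_n -> K, \sum_i F i = F u + F v) /\
  ratr (\det (\matrix_(i, j) field_trace (b i * b j))) =
    - 4 * wedge (iota (b u)) (iota (b v)) ^+ 2 :> R.
Proof.
move=> n2; subst n; exists ord0, (lift ord0 ord0).
split; first by case=> -[|[|//]] ?; [left|right]; apply: val_inj.
split=> //; split; first by move=> F; rewrite !big_ord_recl big_ord0 addr0.
set u : 'I_2 := ord0; set v : 'I_2 := lift ord0 ord0.
have detE (M : 'M[rat]_2) : \det M = M u u * M v v - M u v * M v u.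
  rewrite (expand_det_row _ u) !big_ord_recl big_ord0 /cofactor !det_mx11 !mxE/=.
  have -> : lift u (ord0 : 'I_1) = v by apply: val_inj.
  have -> : lift v (ord0 : 'I_1) = u by apply: val_inj.
  by rewrite -/v; ring.
rewrite detE !mxE.
have tE x : ratr (field_trace x) = 2 * complex.Re (iota x) :> R.
  have := iota_trace dimK nonreal x; rewrite ratrCE.
  by case: (iota x) => p q /= [] -> _; ring.
rewrite rmorphB [X in X - _]rmorphM [X in _ - X]rmorphM/= !tE !rmorphM/=.
rewrite /wedge; case: (iota (b u)) => p q; case: (iota (b v)) => r s /=; ring.
Qed.

Lemma int_mul_eq1 (y : R) (m n : int) : y != 0 -> y = m%:~R * (n%:~R * y) ->
  (n%:~R : R) ^+ 2 = 1.
Proof.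
move=> y0; rewrite mulrA -[X in X = _]mul1r => /(mulIf y0).
rewrite -intrM => /esym/eqP; rewrite -[1]/(1%:~R) eqr_int => /eqP mn.
have : n = 1 \/ n = -1.
  have : (n %| 1)%Z by apply/dvdzP; exists m.
  by rewrite dvdzE dvdn1; lia.
by case=> ->; rewrite ?expr1n// mulrN1z sqrrN expr1n.
Qed.

(** Two integral bases are exchanged by integer matrices of determinant [1] or
    [-1]; hence the wedge of any integral basis is, up to sign, that of [1] and
    [w], which is the imaginary part of [w]. *)
Lemma sqrt_discriminant (w : O) : plane_order (int_embed iota) w ->
  Num.sqrt `|ratr (discriminant K) : R| = 2 * complex.Im (int_embed iota w).
Proof.
move=> wP; set y := complex.Im (int_embed iota w); have y2 : 1 / 2 <= y := order_im wP.
have y0 : 0 < y by lra.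
have wedge1 : wedge 1 (int_embed iota w) = - y.
  by rewrite /wedge /y; case: (int_embed iota w) => p q /=; ring.
have discE (b : (\dim {:K}).-tuple K) : integral_basis b ->
    `|ratr (basis_discriminant b) : R| = (2 * y) ^+ 2.
  move=> [bB bI].
  have [u [v [uv [neuv [sumE detE]]]]] := det_conjugates (fun i => tnth b i) dimK.
  rewrite /basis_discriminant detE.
  have bint i : algebraic_integer (tnth b i).
    apply/bI; exists (fun j => (j == i)%:Z).
    rewrite (bigD1 i)//= eqxx mulr1z big1 ?addr0// => j /negPf ->.
    by rewrite mulr0z.
  pose B i : O := RingOfIntegers (bint i).
  have [p [q BuE]] := order_basis wP (B u).
  have [r [s BvE]] := order_basis wP (B v).
  have w1 : wedge (iota (tnth b u)) (iota (tnth b v)) = (p * s - q * r)%:~R * - y.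
    rewrite -wedge1 -wedge_comb -[iota (tnth b u)]/(int_embed iota (B u)).
    rewrite -[iota (tnth b v)]/(int_embed iota (B v)) BuE BvE.
    rewrite !(rmorphD (int_embed iota)) !(rmorphMz (int_embed iota)).
    by rewrite !(rmorph1 (int_embed iota)).
  have comb (a : O) : exists c d : int,
      int_embed iota a = iota (tnth b u) *~ c + iota (tnth b v) *~ d.
    have /bI [c cE] := integer_valP a; exists (c u), (c v).
    by rewrite /int_embed /= cE sumE rmorphD !rmorphMz.
  have [c [d cdE]] := comb 1; have [c' [d' cdE']] := comb w.
  have w2 : wedge 1 (int_embed iota w) =
      (c * d' - d * c')%:~R * wedge (iota (tnth b u)) (iota (tnth b v)).
    by rewrite -wedge_comb -cdE -cdE' rmorph1.
  have nz : - y != 0 by rewrite oppr_eq0 gt_eqF.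
  have n1 : ((p * s - q * r)%:~R : R) ^+ 2 = 1.
    by apply: (@int_mul_eq1 _ (c * d' - d * c') _ nz); rewrite -w1 -w2 wedge1.
  rewrite w1 exprMn n1 mul1r sqrrN normrM normrN normr_nat ger0_norm ?sqr_ge0//.
  by ring.
rewrite /discriminant; case: xgetP => [D _ [b bI <-]|/(_ _)noD].
  by rewrite discE// sqrtr_sqr ger0_norm// mulr_ge0// ltW.
exfalso.
have sz : size [:: (1 : K); val w] == \dim {:K} by rewrite dimK.
pose t := Tuple sz.
have tE i : tnth t i = if val i == 0%N then 1 else val w.
  rewrite (tnth_nth 0)/=; case: i => -[|[|i]] //= hi.
  by move: hi; rewrite dimK.
have sum2 n (F : nat -> K) : n = 2%N -> \sum_(i < n) F i = F 0%N + F 1%N.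
  by move=> ->; rewrite !big_ord_recl big_ord0 addr0.
apply: (noD (basis_discriminant t)); exists t => //; split.
  rewrite basisEfree subvf size_tuple leqnn/= andbT free_cons seq1_free span_seq1.
  apply/andP; split.
    apply/vlineP => -[k kE].
    have := congr1 iota kE; rewrite rmorph1 iotaZ ratrCE.
    move=> /(congr1 (@complex.Im _))/=; rewrite -[iota (val w)]/(int_embed iota w).
    move: (y0); rewrite /y; case: (int_embed iota w) => p q /= q0.
    rewrite mul0r addr0 => /esym/eqP; rewrite mulf_eq0 (gt_eqF q0) orbF.
    rewrite fmorph_eq0 => /eqP k0; move: kE; rewrite k0 scale0r => /eqP.
    by rewrite oner_eq0.
  apply/eqP => w0; move: y0; rewrite /y /int_embed /=.
  by rewrite (_ : integer_val w = 0)// rmorph0 ltxx.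
move=> x; split=> [xI|[c ->]].
  have [i [j ij]] := order_basis wP (RingOfIntegers xI).
  exists (fun o => if val o == 0%N then i else j).
  have := @sum2 _
    (fun n => (if n == 0%N then 1 else val w) *~ (if n == 0%N then i else j)) dimK.
  under eq_bigr => o _ do rewrite -tE.
  move=> ->; rewrite -[x]/(val (RingOfIntegers xI)) ij.
  by rewrite rmorphD !rmorphMz rmorph1.
apply: rpred_sum => i _; rewrite -mulrzl; apply: rpredM.
  by apply: rpred_int.
by rewrite tE; case: ifP => _; [exact: rpred1|exact: integer_valP].
Qed.

End Discriminant.

(** * Elements of a coset of an ideal in a sector *)

Section Modulus.
Variable R : realType.
Implicit Types z u : R[i].

Lemma cmodM z u : cmod (z * u) = cmod z * cmod u.
Proof. exact: ComplexField.Normc.normcM. Qed.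

Lemma cmod_ge0 z : 0 <= cmod z.
Proof. by case: z => p q; exact: sqrtr_ge0. Qed.

Lemma cmod_eq0 z : (cmod z == 0) = (z == 0).
Proof.
apply/eqP/eqP => [|->]; first exact: ComplexField.Normc.eq0_normc.
exact: ComplexField.Normc.normc0.
Qed.

Lemma cmod_gt0 z : (0 < cmod z) = (z != 0).
Proof. by rewrite lt_def cmod_ge0 andbT cmod_eq0. Qed.

Lemma cmod1 : cmod (1 : R[i]) = 1.
Proof. exact: ComplexField.Normc.normc1. Qed.

Lemma cmodN z : cmod (- z) = cmod z.
Proof. by case: z => p q; rewrite /cmod/= !sqrrN. Qed.

Lemma cmodV z : cmod z^-1 = (cmod z)^-1.
Proof. exact: ComplexField.Normc.normcV. Qed.

Lemma cmod_real (x : R) : 0 <= x -> cmod (real_complex R x) = x.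
Proof. by move=> x0; rewrite /cmod/= expr0n addr0 sqrtr_sqr ger0_norm. Qed.

Lemma cmod_expi (t : R) : cmod (expi t) = 1.
Proof. by rewrite /cmod/= cos2Dsin2 sqrtr1. Qed.

Lemma le_cmodD z u : cmod (z + u) <= cmod z + cmod u.
Proof. exact: complex.le_normcD. Qed.

Lemma expiD (s t : R) : expi (s + t) = expi s * expi t.
Proof. by rewrite /expi cosD sinD; simpc; congr (_ +i* _)%C; ring. Qed.

Lemma polar_form z : z != 0 ->
  exists t : R, - pi < t <= pi /\ z = real_complex R (cmod z) * expi t.
Proof.
have pi0 := pi_gt0 R.
have up u : u != 0 -> 0 <= complex.Im u ->
    exists t : R, 0 <= t <= pi /\ u = real_complex R (cmod u) * expi t.
  case: u => p q; rewrite eq_complex/= negb_and => u0 q0.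
  have pq : p != 0 \/ 0 < q.
    by case/orP: u0 => [|q1]; [left|right; rewrite lt_def q1].
  have [s [rho [s0 rho0 rhoE pE qE]]] := polar pq q0.
  exists s; split=> //; rewrite /cmod/= -rhoE sqrtr_sqr gtr0_norm// /expi.
  by simpc; rewrite -pE -qE.
move=> z0; have [im0|im0] := leP 0 (complex.Im z).
  by have [t [t0 tE]] := up _ z0 im0; exists t; split=> //; lra.
have [||t [/andP[]]] := up (- z); first by rewrite oppr_eq0.
  by move: im0; case: (z) => p q /= ?; rewrite oppr_ge0 ltW.
rewrite le_eqVlt => /predU1P[<- _ | t0 t1] tE.
  move: im0; rewrite -[z]opprK tE /expi sin0 /=.
  by rewrite mulr0 mul0r addr0 oppr0 ltxx.
exists (t - pi); split; first lra.
rewrite expiD mulrA -(cmodN z) -tE /expi cosN sinN cospi sinpi.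
by case: (z) => p q; simpc; congr (_ +i* _)%C; ring.
Qed.

Lemma sector_expi z (theta r : R) t rho : z != 0 -> 0 < rho <= r ->
  - (theta / 2) < t <= theta / 2 ->
  angular_sector z theta r (real_complex R (rho / cmod z) * expi t * z).
Proof.
move=> z0 /andP[rho0 rhor] tt; exists t, (rho / cmod z); split=> //.
by rewrite divr_gt0 ?cmod_gt0//= ler_pM2r// invr_gt0 cmod_gt0.
Qed.

Lemma sectorP z (theta r : R) v : z != 0 -> angular_sector z theta r v <->
  exists t rho, [/\ - (theta / 2) < t <= theta / 2, 0 < rho <= r
    & v = real_complex R (rho / cmod z) * expi t * z].
Proof.
move=> z0; split=> [[t [rho [tt /andP[rho0 rhor] ->]]]|[t [rho [tt rr ->]]]].
  have cz : 0 < cmod z by rewrite cmod_gt0.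
  exists t, (rho * cmod z); split=> //; last by rewrite mulfK// gt_eqF.
  by rewrite mulr_gt0//= -ler_pdivlMr.
exact: sector_expi.
Qed.

(** Sectors only depend on the direction of their axis, and are mapped to
    sectors by a change of scale and a rotation. *)
Lemma sector_mul z u (theta r : R) v : z != 0 -> u != 0 ->
  angular_sector z theta r (u * v) <-> angular_sector (z / u) theta (r / cmod u) v.
Proof.
move=> z0 u0; have zu : z / u != 0 by rewrite mulf_neq0 ?invr_eq0.
have cz : 0 < cmod z by rewrite cmod_gt0.
have cu : 0 < cmod u by rewrite cmod_gt0.
have cC : real_complex R (cmod u) != 0 by rewrite fmorph_eq0 gt_eqF.
have cC' : real_complex R (cmod z) != 0 by rewrite fmorph_eq0 gt_eqF.
split=> /sectorP => /(_ _)[//|t [rho [tt /andP[rho0 rhor] vE]]]; apply/sectorP => //.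
  exists t, (rho / cmod u); split=> //; first by rewrite divr_gt0//= ler_pM2r// invr_gt0.
  apply: (mulfI u0); rewrite vE cmodM cmodV !rmorphM/= !fmorphV/= !rmorphM/= fmorphV.
  by field; rewrite cC cC' u0.
exists t, (rho * cmod u); split=> //.
  by rewrite mulr_gt0//= -ler_pdivlMr.
rewrite vE cmodM cmodV !rmorphM/= !fmorphV/= !rmorphM/= fmorphV.
by field; rewrite cC cC' u0.
Qed.

Lemma sector_sect z (theta r phi : R) p q :
  z != 0 -> z = real_complex R (cmod z) * expi phi ->
  angular_sector z theta r (Complex p q) <->
  sect true (phi - theta / 2) (phi + theta / 2) r (p, q).
Proof.
move=> z0 zE; have cz : 0 < cmod z by rewrite cmod_gt0.
have E rho t : real_complex R (rho / cmod z) * expi t * z =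
    Complex (rho * cos (phi + t)) (rho * sin (phi + t)).
  rewrite {2}zE mulrACA -rmorphM divfK ?gt_eqF// -expiD addrC /expi.
  by simpc.
split=> [/(sectorP _ _ _ z0) [t [rho [/andP[t1 t2] rr]]]|].
  rewrite E => -[-> ->]; exists (phi + t), rho.
  by split=> //=; [rewrite ltrD2l|rewrite lerD2l].
move=> [s [rho [s1 /= s2 rr [-> ->]]]]; apply/sectorP => //.
exists (s - phi), rho; split=> //; first lra.
by rewrite E addrC subrK.
Qed.

End Modulus.

Definition odvd (O : comNzRingType) (l a : O) := exists u, a = u * l.

Section LatticeCount.
Variables (R : realType) (O : comNzRingType) (e : {rmorphism O -> R[i]}) (w : O).
Hypothesis eP : plane_order e w.
Implicit Types (a l v : O).

Definition nm a : R := cmod (e a).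

Lemma e_eq0 a : (e a == 0) = (a == 0).
Proof.
by apply/eqP/eqP => [|->]; [rewrite -(rmorph0 e) => /(order_inj eP)|exact: rmorph0].
Qed.

Lemma nmM a l : nm (a * l) = nm a * nm l.
Proof. by rewrite /nm rmorphM cmodM. Qed.

Lemma nm_ge0 a : 0 <= nm a. Proof. exact: cmod_ge0. Qed.

Lemma nm_eq0 a : (nm a == 0) = (a == 0).
Proof. by rewrite /nm cmod_eq0 e_eq0. Qed.

Lemma nm_gt0 a : (0 < nm a) = (a != 0).
Proof. by rewrite lt_def nm_ge0 andbT nm_eq0. Qed.

Lemma nm1 : nm 1 = 1. Proof. by rewrite /nm rmorph1 cmod1. Qed.

Lemma nm_nat a : exists n : nat, nm a ^+ 2 = n%:R.
Proof. exact: (order_norm eP). Qed.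

Lemma nm_ge1 a : a != 0 -> 1 <= nm a.
Proof.
rewrite -nm_gt0 => a0; have [n nE] := nm_nat a.
rewrite -(@ler_pXn2r _ 2) ?nnegrE ?nm_ge0// expr1n nE ler1n -(ltr0n R) -nE.
by rewrite exprn_gt0.
Qed.

Lemma le_nmD a l : nm (a + l) <= nm a + nm l.
Proof. by rewrite /nm rmorphD le_cmodD. Qed.

Lemma order_coord_uniq (i j i' j' : int) :
  i%:~R + w *~ j = i'%:~R + w *~ j' -> (i, j) = (i', j').
Proof.
move=> /(congr1 e); rewrite !rmorphD !rmorphMz !rmorph1 -![e w *~ _]mulrzl !intCE.
have := order_im eP; case: (e w) => p q /= q2.
move=> [+ jE]; have q0 : q != 0 by apply/eqP; lra.
move: jE; rewrite !mul0r !add0r !addr0 => /(mulIf q0)/eqP; rewrite eqr_int => /eqP ->.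
by move=> /addIr/eqP; rewrite eqr_int => /eqP ->.
Qed.

(** The elements of the coset [v + l O] that lie in a sector are, up to the
    similarity of ratio [e l], the points of a translate of the whole lattice
    in a sector of radius [r / nm l]. The error term thus decays with [l], and
    depends neither on the field nor on the coset. *)
Lemma lattice_sector l v (z : R[i]) (theta r : R) :
  l != 0 -> z != 0 -> 0 < theta <= 2 * pi -> 0 < r ->
  let A := [set a | odvd l (a - v) /\ angular_sector z theta r (e a)] in
  finite_set A /\
  `|cnt R A - theta * r ^+ 2 / (2 * complex.Im (e w)) / nm l ^+ 2| <=
    100 * (r / nm l + 1).
Proof.
move=> l0 z0 /andP[th0 th2] r0 A; set y := complex.Im (e w).
have y2 : 1 / 2 <= y := order_im eP.
have el0 : e l != 0 by rewrite e_eq0.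
have zl0 : z / e l != 0 by rewrite mulf_neq0 ?invr_eq0.
have [phi [_ phiE]] := polar_form zl0.
pose c := e v / e l; pose r' := r / nm l.
have nl : 0 < nm l by rewrite nm_gt0.
have r'0 : 0 < r' by rewrite divr_gt0.
pose t0 := complex.Im c; pose xs (j : int) := j%:~R * complex.Re (e w) + complex.Re c.
pose S := sect true (phi - theta / 2) (phi + theta / 2) r'.
pose f (p : int * int) := v + (p.1%:~R + w *~ p.2) * l.
have fE p : e (f p) = e l * Complex (p.1%:~R + xs p.2) (p.2%:~R * y + t0).
  have -> : Complex (p.1%:~R + xs p.2) (p.2%:~R * y + t0) = c + (p.1%:~R + p.2%:~R * e w).
    rewrite !intCE /xs /t0 /y; case: (c) => c1 c2; case: (e w) => w1 w2 /=.
    by simpc; congr (_ +i* _)%C; ring.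
  rewrite /f rmorphD rmorphM rmorphD !rmorphMz rmorph1 -[e w *~ _]mulrzl /c.
  by rewrite mulrDr [e l * (_ / _)]mulrC divfK// [e l * _]mulrC.
have AE : A = f @` latpts y t0 xs S.
  apply/seteqP; split=> [a [[u uE] aS]|_ [p pS <-]].
    have [i [j ij]] := order_basis eP u.
    exists (i, j); last by rewrite /f/= -ij -uE addrC subrK.
    have aE : a = f (i, j) by rewrite /f/= -ij -uE addrC subrK.
    by move: aS; rewrite aE fE => /(sector_mul _ _ _ z0 el0)/(sector_sect _ _ _ _ zl0 phiE).
  split; first by exists (p.1%:~R + w *~ p.2); rewrite /f addrAC subrr add0r.
  by rewrite fE; apply/(sector_mul _ _ _ z0 el0)/(sector_sect _ _ _ _ zl0 phiE).
have fI : {in latpts y t0 xs S &, injective f}.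
  move=> [i j] [i' j'] _ _ /addrI /(congr1 e); rewrite !rmorphM => /(mulIf el0).
  by move=> /(order_inj eP)/order_coord_uniq.
have pi0 := pi_gt0 R.
have th : phi - theta / 2 <= phi + theta / 2 <= phi - theta / 2 + pi *+ 2 by lra.
have [fin cE] := area_est_sect r'0 th t0 xs y2.
rewrite AE; split; first exact: finite_image.
rewrite cnt_image//; move: cE.
rewrite (_ : _ / y = theta * r ^+ 2 / (2 * y) / nm l ^+ 2)//.
by rewrite /r'; field; rewrite !gt_eqF//; lra.
Qed.

Lemma full_sectorE a (r : R) :
  angular_sector 1 (2 * pi) r (e a) <-> a != 0 /\ nm a <= r.
Proof.
split=> [[t [rho [tt /andP[rho0 rhor]]]]|[a0 ar]].
  rewrite mulr1 => aE; have nE : nm a = rho.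
    by rewrite /nm aE cmodM cmod_expi mulr1 cmod_real// ltW.
  by split; [rewrite -nm_gt0 nE|rewrite nE; move: rhor; rewrite cmod1 divr1].
have [t [tt tE]] : exists t : R, - pi < t <= pi /\ e a = real_complex R (nm a) * expi t.
  by apply: polar_form; rewrite e_eq0.
exists t, (nm a); split; last by rewrite mulr1.
  by rewrite mulrC mulKf ?pnatr_eq0//.
by rewrite cmod1 divr1 ar nm_gt0 a0.
Qed.

Lemma lattice_disc l v (r : R) : l != 0 -> 0 < r ->
  let A := [set a | odvd l (a - v) /\ (a != 0 /\ nm a <= r)] in
  finite_set A /\
  `|cnt R A - pi * r ^+ 2 / complex.Im (e w) / nm l ^+ 2| <= 100 * (r / nm l + 1).
Proof.
move=> l0 r0; have pi0 := pi_gt0 R.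
have pi02 : 0 < 2 * @pi R <= 2 * @pi R by lra.
have [fin cE] := lattice_sector v l0 (oner_neq0 _) pi02 r0.
rewrite (_ : [set a | _] =
    [set a | odvd l (a - v) /\ angular_sector 1 (2 * pi) r (e a)]); last first.
  by apply/seteqP; split=> a [la /full_sectorE].
split=> //; rewrite (_ : pi * _ / _ = 2 * pi * r ^+ 2 / (2 * complex.Im (e w)))//.
by have y2 := order_im eP; field; apply/eqP; lra.
Qed.

(** A pure multiple of [r ^ 2] suffices, since there is no point when [r] is
    less than [1]. *)
Lemma disc_count (r : R) : 0 <= r ->
  finite_set [set a | a != 0 /\ nm a <= r] /\
  cnt R [set a | a != 0 /\ nm a <= r] <= 210 * r ^+ 2.
Proof.
move=> r0; have [r1|r1] := ltP r 1.
  have -> : [set a | a != 0 /\ nm a <= r] = set0.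
    apply/seteqP; split=> // a [/nm_ge1 a1 ar].
    by have := le_lt_trans (le_trans a1 ar) r1; rewrite ltxx.
  by rewrite cnt0; split; [exact: finite_set0|have := sqr_ge0 r; lra].
have pi0 := pi_gt0 R.
have pi4 : pi < 4 :> R by have := pihalf_lt2 R; lra.
have y2 : 1 / 2 <= complex.Im (e w) := order_im eP.
have E : [set a | a != 0 /\ nm a <= r] = [set a | odvd 1 (a - 0) /\ (a != 0 /\ nm a <= r)].
  by apply/seteqP; split=> [a h|a []//]; split=> //; exists a; rewrite subr0 mulr1.
have [fin cE] := lattice_disc 0 (oner_neq0 O) (lt_le_trans ltr01 r1).
rewrite E; split=> //; move: cE; rewrite nm1 expr1n !divr1 => cE.
set y := complex.Im _ in y2 cE.
have : pi * r ^+ 2 / y <= 8 * r ^+ 2.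
  rewrite ler_pdivrMr; last lra.
  have : 0 <= r ^+ 2 * (2 * y - 1) by rewrite mulr_ge0 ?sqr_ge0//; lra.
  have : 0 <= r ^+ 2 * (4 - pi) by rewrite mulr_ge0 ?sqr_ge0//; lra.
  lra.
have : r <= r ^+ 2 by rewrite expr2 ler_peMr.
have : 1 <= r ^+ 2 by rewrite exprn_ege1.
by move: cE; rewrite ler_norml; lra.
Qed.

End LatticeCount.

(** * Primes of a principal order *)

Section Divisibility.
Variable O : comNzRingType.
Implicit Types a b l p q x y : O.

Lemma odvd_refl a : odvd a a. Proof. by exists 1; rewrite mul1r. Qed.

Lemma odvd0 a : odvd a 0. Proof. by exists 0; rewrite mul0r. Qed.

Lemma odvd_trans a b l : odvd a b -> odvd b l -> odvd a l.
Proof. by move=> [u ->] [v ->]; exists (v * u); rewrite mulrA. Qed.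

Lemma odvdD a x y : odvd a x -> odvd a y -> odvd a (x + y).
Proof. by move=> [u ->] [v ->]; exists (u + v); rewrite mulrDl. Qed.

Lemma odvdMl a x y : odvd a y -> odvd a (x * y).
Proof. by move=> [u ->]; exists (x * u); rewrite mulrA. Qed.

Lemma odvdMr a x y : odvd a x -> odvd a (x * y).
Proof. by rewrite mulrC; exact: odvdMl. Qed.

Lemma odvdN a x : odvd a x -> odvd a (- x).
Proof. by move=> [u ->]; exists (- u); rewrite mulNr. Qed.

Lemma odvdB a x y : odvd a x -> odvd a y -> odvd a (x - y).
Proof. by move=> ax ay; apply: odvdD => //; exact: odvdN. Qed.

Lemma principal_idealE (g : O) : principal_ideal g = [set a | odvd g a].
Proof.
by apply/seteqP; split=> [a [u _ uE]|a [u uE]]; exists u.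
Qed.

Definition oprime p :=
  [/\ p != 0, ~ odvd p 1 & forall x y, odvd p (x * y) -> odvd p x \/ odvd p y].

(** The element chosen by [xget] depends only on the set it is taken from, so
    that associate elements have the same representative. *)
Definition canon p : O := xget 1 [set q | odvd p q /\ odvd q p].

Lemma canonP p : odvd p (canon p) /\ odvd (canon p) p.
Proof.
rewrite /canon; case: xgetP => [q _ //|/(_ p)]; case.
by split; exact: odvd_refl.
Qed.

Lemma canon_eq p q : odvd p q -> odvd q p -> canon p = canon q.
Proof.
move=> pq qp; congr xget; apply/seteqP; split=> x [h1 h2]; split.
- exact: odvd_trans h1.
- exact: odvd_trans pq.
- exact: odvd_trans h1.
- exact: odvd_trans qp.
Qed.

Definition cprime p := oprime p /\ canon p = p.

Lemma oprime_prod p (s : seq O) : oprime p -> odvd p (\prod_(q <- s) q) ->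
  exists2 q, q \in s & odvd p q.
Proof.
move=> [p0 p1 pM]; elim: s => [|q s IH]; first by rewrite big_nil.
rewrite big_cons => /pM [pq|/IH [x xs px]]; first by exists q; rewrite ?mem_head.
by exists x; rewrite ?inE ?xs ?orbT.
Qed.

End Divisibility.

Section PrincipalOrder.
Variables (R : realType) (O : comNzRingType) (e : {rmorphism O -> R[i]}) (w : O).
Hypothesis eP : plane_order e w.
Hypothesis pid : principal_ideal_ring O.
Implicit Types a b l p q x y : O.
Local Notation nm := (nm e).

Lemma oM_eq0 x y : x * y = 0 -> x = 0 \/ y = 0.
Proof.
move=> /eqP; rewrite -(nm_eq0 eP) nmM mulf_eq0 !(nm_eq0 eP).
by case/orP=> /eqP ->; [left|right].
Qed.

Lemma omulIf x y a : a != 0 -> x * a = y * a -> x = y.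
Proof.
move=> a0 /eqP; rewrite -subr_eq0 -mulrBl => /eqP/oM_eq0[/eqP|a00].
  by rewrite subr_eq0 => /eqP.
by rewrite a00 eqxx in a0.
Qed.

Lemma le_nm_odvd l a : odvd l a -> a != 0 -> nm l <= nm a.
Proof.
move=> [u ->] ul0; rewrite nmM ler_peMl ?nm_ge0//; apply: (nm_ge1 eP).
by apply: contraNneq ul0 => ->; rewrite mul0r.
Qed.

Lemma unit_nm1 u : nm u = 1 -> odvd u 1.
Proof.
move=> u1; have [u' u'E] := order_conj eP u; exists u'.
apply: (order_inj eP); rewrite rmorphM u'E rmorph1 mulrC mul_conjcE.
by rewrite -/(nm u) u1 expr1n.
Qed.

Lemma nm_sqr_odvd a : exists n : nat, nm a ^+ 2 = n%:R /\ odvd a n%:R.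
Proof.
have [n nE] := nm_nat eP a; have [a' a'E] := order_conj eP a.
exists n; split=> //; exists a'; apply: (order_inj eP).
by rewrite rmorphM a'E rmorph_nat mulrC mul_conjcE -/(nm a) nE rmorph_nat.
Qed.

Lemma bezout x y : exists g, [/\ odvd g x, odvd g y & exists s t, g = s * x + t * y].
Proof.
pose I : set O := [set z | exists s t, z = s * x + t * y].
have [|g gE] := pid (I := I).
  split=> [|a b [s [t ->]] [s' [t' ->]]|a b [s [t ->]]].
  - by exists 0, 0; rewrite !mul0r addr0.
  - by exists (s + s'), (t + t'); ring.
  - by exists (a * s), (a * t); ring.
rewrite principal_idealE in gE; exists g; split.
- have : I x by exists 1, 0; ring.
  by rewrite gE.
- have : I y by exists 0, 1; ring.
  by rewrite gE.
- have : I g by rewrite gE; exact: odvd_refl.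
  by [].
Qed.

(** A divisor of least modulus among the non-units is prime. *)
Lemma prime_divisor a : a != 0 -> ~ odvd a 1 -> exists p, oprime p /\ odvd p a.
Proof.
move=> a0 a1.
pose P n := `[< exists d, [/\ odvd d a, ~ odvd d 1 & nm d ^+ 2 = n%:R] >].
have exP : exists n, P n.
  have [n nE] := nm_nat eP a; exists n; apply/asboolP; exists a; split=> //.
  exact: odvd_refl.
case: (ex_minnP exP) => n /asboolP[d [da d1 dn]] nmin.
have d0 : d != 0.
  by apply: contraNneq a0 => d0; move: da => [u ->]; rewrite d0 mulr0.
exists d; split=> //; split=> // x y dxy.
have [g [gd gx [s [t gE]]]] := bezout d x.
have [g1|g1] := pselect (odvd g 1).
  right; have [v vE] := g1.
  have -> : y = y * v * s * d + v * t * (x * y).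
    by rewrite -[LHS]mulr1 vE gE; ring.
  by apply: odvdD; [exact/odvdMl/odvd_refl|exact: odvdMl].
left; have [m mE] := nm_nat eP g.
have /nmin : P m.
  by apply/asboolP; exists g; split=> //; exact: odvd_trans da.
rewrite -(ler_nat R) -dn -mE => dg.
have [u uE] := gd.
have u1 : nm u = 1.
  have u0 : u != 0 by apply: contraNneq d0 => u0; rewrite uE u0 mul0r.
  have g0 : g != 0 by apply: contraNneq d0 => g0; rewrite uE g0 mulr0.
  have ng : 0 < nm g by rewrite (nm_gt0 eP).
  apply/eqP; rewrite eq_le (nm_ge1 eP)// andbT.
  rewrite -(ler_pM2r ng) mul1r -nmM -uE.
  by rewrite -(@ler_pXn2r _ 2) ?nnegrE ?nm_ge0.
have [v vE] := unit_nm1 u1.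
apply: odvd_trans gx; exists v; rewrite uE mulrA -vE mul1r//.
Qed.

(** A common divisor of [a] and [x] generated by a Bezout relation is either a
    unit, which makes [x] invertible, or divisible by a prime. *)
Lemma invertible_coprime a x : a != 0 ->
  (exists b, odvd a (x * b - 1)) <-> (forall p, oprime p -> odvd p a -> ~ odvd p x).
Proof.
move=> a0; split=> [[b axb] p [_ p1 _] pa px|cop].
  apply: p1; rewrite -[1](subKr (x * b)); apply: odvdB; first exact: odvdMr.
  exact: odvd_trans axb.
have [g [ga gx [s [t gE]]]] := bezout a x.
have [[v vE]|g1] := pselect (odvd g 1).
  exists (v * t); exists (- (v * s)); rewrite vE gE; ring.
have g0 : g != 0.
  by apply: contraNneq a0 => g0; move: ga => [u ->]; rewrite g0 mulr0.
have [p [pP pg]] := prime_divisor g0 g1.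
by case: (cop p pP); exact: odvd_trans pg _.
Qed.

Lemma oprime_canon p : oprime p -> oprime (canon p).
Proof.
have [pc cp] := canonP p; move=> [p0 p1 pM]; split.
- by apply: contraNneq p0 => c0; move: cp => [u ->]; rewrite c0 mulr0.
- by move=> c1; apply: p1; exact: odvd_trans c1.
- move=> x y cxy; have [px|py] := pM x y (odvd_trans pc cxy).
    by left; exact: odvd_trans px.
  by right; exact: odvd_trans py.
Qed.

Lemma cprime_canon p : oprime p -> cprime (canon p).
Proof.
move=> pP; split; first exact: oprime_canon.
by have [pc cp] := canonP p; exact: canon_eq.
Qed.

Lemma cprime_odvd_eq p q : cprime p -> cprime q -> odvd p q -> p = q.
Proof.
move=> [[p0 p1 pM] pc] [[q0 q1 qM] qc] pq; rewrite -pc -qc; apply: canon_eq => //.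
have [u uE] := pq; have := odvd_refl q; rewrite {2}uE => /qM[[v vE]|//].
case: p1; exists v; apply: (omulIf q0).
by rewrite mul1r {1}uE vE; ring.
Qed.

(** Distinct representatives do not divide each other, hence a prime that
    divides [a] divides the cofactor of the product of the other ones. *)
Lemma cprime_prod_odvd (s : seq O) a : uniq s -> (forall p, p \in s -> cprime p) ->
  (forall p, p \in s -> odvd p a) -> odvd (\prod_(p <- s) p) a.
Proof.
elim: s => [|p s IH] /=; first by rewrite big_nil => _ _ _; exists a; rewrite mulr1.
move=> /andP[ps us] sP sa; rewrite big_cons.
have [//|||u uE] := IH.
- by move=> q qs; apply: sP; rewrite inE qs orbT.
- by move=> q qs; apply: sa; rewrite inE qs orbT.
have pP : cprime p by apply: sP; rewrite mem_head.
have [[p0 p1 pM] _] := pP.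
have := sa p (mem_head _ _); rewrite uE => /pM[[v ->]|].
  by exists v; rewrite mulrA.
move=> /(oprime_prod pP.1) [q qs pq].
have pqE : p = q by apply: cprime_odvd_eq => //; apply: sP; rewrite inE qs orbT.
by move: ps; rewrite pqE qs.
Qed.

End PrincipalOrder.

(** * The product formula for Euler's function *)

Section Auxiliary.
Variable R : realType.

Lemma cnt_setI (T : choiceType) (D X : set T) : finite_set D ->
  cnt R (D `&` X) = \sum_(x \in D) ((x \in X)%:R : R).
Proof.
move=> fD; rewrite /cnt fsbig_mkcondr; apply: eq_fsbigr => x _.
by case: (x \in X).
Qed.

Lemma quadratic_le_linear (r0 A C : R) :
  (forall r : R, r0 <= r -> A * r ^+ 2 <= C * r) -> A <= 0.
Proof.
move=> H; rewrite leNgt; apply/negP => A0.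
pose r := 1 + `|r0| + `|C| / A.
have CA : 0 <= `|C| / A by rewrite divr_ge0// ltW.
have r1 : 0 < r by rewrite /r; have := normr_ge0 r0; lra.
have rr0 : r0 <= r by rewrite /r; have := ler_norm r0; lra.
have := H r rr0; rewrite expr2 mulrA ler_pM2r// mulrDr [A * (_ / _)]mulrC divfK ?gt_eqF//.
have : 0 <= A * `|r0| by rewrite mulr_ge0// ltW.
by have := ler_norm C; lra.
Qed.

End Auxiliary.

Section EulerProduct.
Variables (R : realType) (O : comNzRingType) (e : {rmorphism O -> R[i]}) (w : O).
Hypothesis eP : plane_order e w.
Hypothesis pid : principal_ideal_ring O.
Implicit Types a b l x y : O.
Local Notation nm := (nm e).

Definition disc (r : R) : set O := [set x | x != 0 /\ nm x <= r].

Lemma finite_disc (r : R) : finite_set (disc r).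
Proof.
have [r0|r0] := leP 0 r; first by have [] := disc_count eP r0.
rewrite (_ : disc r = set0)//; apply/seteqP; split=> // x [_ xr].
by have := le_lt_trans (le_trans (nm_ge0 e x) xr) r0; rewrite ltxx.
Qed.

Definition odvd_ind l a : R := (`[< odvd l a >])%:R.

Section PrimeSet.
Variable P : {fset O}.
Hypothesis PP : forall p, p \in P -> cprime p.

Definition set_prod (S : {set P}) : O := \prod_(p in S) val p.

Lemma set_prod_enum (S : {set P}) : set_prod S = \prod_(p <- [seq val p | p <- enum S]) p.
Proof. by rewrite big_map big_enum. Qed.

Lemma set_prod_odvd (S : {set P}) a :
  odvd (set_prod S) a <-> forall p, p \in S -> odvd (val p) a.
Proof.
split=> [dSa p pS|pa].
  apply: odvd_trans dSa; rewrite /set_prod (bigD1 p)//= mulrC.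
  by apply: odvdMl; exact: odvd_refl.
rewrite set_prod_enum; apply: (cprime_prod_odvd eP).
- by rewrite (map_inj_uniq val_inj) enum_uniq.
- by move=> _ /mapP[p _ ->]; apply: PP; exact: valP.
- by move=> _ /mapP[p pS ->]; apply: pa; rewrite mem_enum in pS.
Qed.

Lemma set_prod_neq0 (S : {set P}) : set_prod S != 0.
Proof.
rewrite -(nm_gt0 eP) /set_prod; elim/big_ind: _ => [|x y x0 y0|p _].
- by rewrite nm1.
- by rewrite nmM mulr_gt0.
- by rewrite (nm_gt0 eP); have [[]] := PP (valP p).
Qed.

Lemma nm_set_prod (S : {set P}) : nm (set_prod S) = \prod_(p in S) nm (val p).
Proof. by apply: big_morph; [exact: nmM|exact: nm1]. Qed.

Lemma prod_odvd_ind (S : {set P}) a : \prod_(p in S) odvd_ind (val p) a = odvd_ind (set_prod S) a.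
Proof.
rewrite /odvd_ind; have [/asboolP dSa|/asboolP dSa] := boolP `[< odvd (set_prod S) a >].
  rewrite big1// => p pS; have /asboolP -> // := (set_prod_odvd S a).1 dSa p pS.
have [p pS pa] : exists2 p, p \in S & ~ odvd (val p) a.
  apply: contrapT => N; apply: dSa; apply/set_prod_odvd => p pS.
  by apply: contrapT => pa; apply: N; exists p.
by rewrite (bigD1 p)//= asboolF// mul0r.
Qed.

Lemma prod_expand (c : P -> R) :
  \prod_(p : P) (1 + c p) = \sum_(S : {set P}) \prod_(p in S) c p.
Proof.
under eq_bigr do rewrite addrC.
by rewrite bigA_distr; apply: eq_bigr => S _; rewrite [RHS]big_mkcond.
Qed.

(** Legendre's inclusion-exclusion. The sets of primes stand for the squarefree
    divisors, with the parity of the set as Moebius function; sums over them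
    factor as products over the primes. *)
Lemma sieve_expand (c : P -> R) a : \prod_(p : P) (1 - c p * odvd_ind (val p) a) =
  \sum_(S : {set P}) (\prod_(p in S) - c p) * odvd_ind (set_prod S) a.
Proof.
rewrite prod_expand; apply: eq_bigr => S _; rewrite -prod_odvd_ind -big_split/=.
by apply: eq_bigr => p _; rewrite mulNr.
Qed.

End PrimeSet.

Lemma residue_class_eq a x y : odvd a (y - x) ->
  residue_class (principal_ideal a) x = residue_class (principal_ideal a) y.
Proof.
move=> xy; rewrite /residue_class principal_idealE; apply/seteqP; split=> z /= h.
  by rewrite (_ : z - y = (z - x) - (y - x)); [exact: odvdB|ring].
by rewrite (_ : z - x = (z - y) + (y - x)); [exact: odvdD|ring].
Qed.

Lemma residue_class_mem a x y : residue_class (principal_ideal a) x y <-> odvd a (y - x).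
Proof. by rewrite /residue_class principal_idealE. Qed.

Lemma quotient_unitsP a X : quotient_units (principal_ideal a) X <->
  exists x, X = residue_class (principal_ideal a) x /\ exists b, odvd a (x * b - 1).
Proof.
split=> [[x [b [-> h]]]|[x [-> [b h]]]]; exists x.
  split=> //; exists b; apply/residue_class_mem; rewrite -h.
  by apply/residue_class_mem; rewrite subrr; exact: odvd0.
exists b; split=> //; apply: residue_class_eq.
by rewrite -opprB; exact: odvdN.
Qed.

(** The ideal generated by [a] contains the norm of [a], modulo which the
    coordinates in the basis [1], [w] take finitely many values. *)
Lemma finite_quotient_units a : a != 0 -> finite_set (quotient_units (principal_ideal a)).
Proof.
move=> a0; have [n [nE an]] := nm_sqr_odvd eP a.
have n0 : (0 < n)%N by rewrite -(ltr0n R) -nE exprn_gt0// (nm_gt0 eP).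
pose g (p : nat * nat) := residue_class (principal_ideal a) (p.1%:R + w *+ p.2).
apply: (@sub_finite_set _ _ (g @` (`I_n `*` `I_n))); last first.
  by apply: finite_image; apply: finite_setX; exact: finite_II.
move=> _ /quotient_unitsP [x [-> _]].
have [i [j ->]] := order_basis eP x.
have nz : (n%:Z : int) != 0 by case: (n) n0.
have red (k : int) : exists m : nat, (m < n)%N /\ exists q : int, k = m%:Z + q * n%:Z.
  exists `|(k %% n)%Z|%N; have := modz_ge0 k nz; have := ltz_pmod k (n0 : 0 < n%:Z).
  have := divz_eq k n; move=> kE k1 k2; split; first lia.
  by exists (k %/ n)%Z; rewrite {1}kE gez0_abs// addrC.
have [i' [i'n [q iE]]] := red i; have [j' [j'n [q' jE]]] := red j.
exists (i', j') => //; apply: residue_class_eq => /=.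
have -> : i%:~R + w *~ j - (i'%:R + w *+ j') = (q%:~R + w *~ q') * n%:R.
  have mz (k : int) : w *~ k = w * k%:~R by rewrite mulrzr.
  rewrite iE jE !mz -(mulr_natr w) !intrD !intrM -!pmulrn; ring.
exact: odvdMl.
Qed.

Lemma sieve_indicator (P : {fset O}) a x : a != 0 -> (forall p, p \in P -> cprime p) ->
  (forall p, cprime p -> odvd p a -> p \in P) ->
  (`[< exists b, odvd a (x * b - 1) >])%:R =
  \prod_(p : P) (1 - odvd_ind (val p) a * odvd_ind (val p) x).
Proof.
move=> a0 PP Pa; have [/asboolP|/asboolP] := boolP `[< _ >].
  move=> /(invertible_coprime eP pid _ a0) cop; rewrite big1// => p _.
  have [pP _] := PP _ (valP p).
  rewrite /odvd_ind; have [/asboolP pa|_] := boolP `[< odvd (val p) a >]; last first.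
    by rewrite mul0r subr0.
  by rewrite (asboolF (cop _ pP pa)) mulr0 subr0.
move=> ninv; have [p [pP pa px]] : exists p, [/\ oprime p, odvd p a & odvd p x].
  apply: contrapT => N; apply: ninv; apply/(invertible_coprime eP pid _ a0) => p pP pa px.
  by apply: N; exists p.
have [pc cp] := canonP p.
have cP : canon p \in P by apply: Pa; [exact: cprime_canon|exact: odvd_trans pa].
rewrite (bigD1 [` cP]%fset)//= /odvd_ind !asboolT ?mulr1 ?subrr ?mul0r//.
  exact: odvd_trans px.
exact: odvd_trans pa.
Qed.

Definition card_units a : nat := #|` fset_set (quotient_units (principal_ideal a))|.

(** The elements prime to [a] form [card_units a] cosets of the ideal, each of
    density [1 / N(a)]. *)
Lemma coprime_count a r : a != 0 -> 1 <= r ->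
  `|cnt R (disc r `&` [set x | exists b, odvd a (x * b - 1)]) -
     pi * r ^+ 2 / complex.Im (e w) * ((card_units a)%:R / nm a ^+ 2)| <=
  (card_units a)%:R * (200 * r).
Proof.
move=> a0 r1; set U := [set x | _]; set m := pi * _ / _.
have fQ := finite_quotient_units a0; have fD := finite_disc r.
have -> : cnt R (disc r `&` U) =
    \sum_(X \in quotient_units (principal_ideal a)) cnt R (disc r `&` X).
  under [RHS]eq_fsbigr do rewrite cnt_setI//.
  rewrite exchange_fsbig// cnt_setI//; apply: eq_fsbigr => x _.
  have [/set_mem xU|/negP xU] := boolP (x \in U).
    pose X := residue_class (principal_ideal a) x.
    rewrite (fsbigD1 X)//=; last by apply/quotient_unitsP; exists x.
    rewrite mem_set ?fsbig1 ?addr0//.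
      move=> Y [/quotient_unitsP[z [YE _]] YX]; rewrite memNset// => xY.
      apply: YX; rewrite YE; apply: residue_class_eq.
      by move: xY; rewrite YE residue_class_mem.
    by rewrite /X residue_class_mem subrr; exact: odvd0.
  rewrite fsbig1// => X /quotient_unitsP[z [-> [b zb]]]; rewrite memNset//.
  rewrite residue_class_mem => xz; apply: xU; rewrite inE; exists b.
  rewrite (_ : x * b - 1 = (x - z) * b + (z * b - 1)); last by ring.
  by apply: odvdD => //; exact: odvdMr.
rewrite fsbig_finite//= /card_units -[X in X%:R / _]sum1_size.
set s := fset_set _.
rewrite natr_sum mulr_suml mulr_sumr -sumrB (le_trans (ler_norm_sum _ _ _))//.
rewrite -sum1_size natr_sum mulr_suml big_seq [leRHS]big_seq.
apply: ler_sum => X; rewrite in_fset_set// inE => /quotient_unitsP[z [-> _]].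
rewrite mul1r (_ : disc r `&` _ =
    [set x | odvd a (x - z) /\ (x != 0 /\ nm x <= r)]); last first.
  by apply/seteqP; split=> x [h1 h2]; split=> //; apply/residue_class_mem.
have [_] := lattice_disc eP z a0 (lt_le_trans ltr01 r1).
rewrite mul1r => /le_trans; apply.
have : r / nm a <= r.
  by rewrite ler_pdivrMr ?(nm_gt0 eP)// ler_peMr ?(nm_ge1 eP)//; lra.
lra.
Qed.

(** The indicator of the elements prime to [a] is expanded by
    inclusion-exclusion, and the multiples of each product of primes are counted
    in turn. *)
Lemma coprime_count_sieve (P : {fset O}) a r : a != 0 -> 1 <= r ->
  (forall p, p \in P -> cprime p) -> (forall p, cprime p -> odvd p a -> p \in P) ->
  `|cnt R (disc r `&` [set x | exists b, odvd a (x * b - 1)]) -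
     pi * r ^+ 2 / complex.Im (e w) * \prod_(p : P) (1 - odvd_ind (val p) a / nm (val p) ^+ 2)| <=
  #|{: {set P}}|%:R * (200 * r).
Proof.
move=> a0 r1 PP Pa; set m := pi * _ / _; have fD := finite_disc r.
have -> : cnt R (disc r `&` [set x | exists b, odvd a (x * b - 1)]) =
    \sum_(S : {set P}) (\prod_(p in S) - odvd_ind (val p) a) *
      cnt R (disc r `&` [set x | odvd (set_prod S) x]).
  rewrite cnt_setI// fsbig_finite//=.
  under eq_bigr => x _.
    rewrite -[_ \in _]asboolb (_ : `[< _ >] = `[< exists b, odvd a (x * b - 1) >]); last first.
      by apply: asbool_equiv_eq; rewrite inE.
    rewrite (sieve_indicator _ a0 PP Pa) sieve_expand//.
    over.
  rewrite exchange_big/=; apply: eq_bigr => S _.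
  rewrite cnt_setI// fsbig_finite//= mulr_sumr; apply: eq_bigr => x _.
  by rewrite /odvd_ind; congr (_ * (nat_of_bool _)%:R); apply/asboolP/idP; rewrite inE.
have -> : \prod_(p : P) (1 - odvd_ind (val p) a / nm (val p) ^+ 2) =
    \sum_(S : {set P}) (\prod_(p in S) - odvd_ind (val p) a) / nm (set_prod S) ^+ 2.
  rewrite prod_expand; apply: eq_bigr => S _.
  rewrite nm_set_prod -prodrXl -prodfV -big_split/=.
  by apply: eq_bigr => p _; rewrite mulNr.
rewrite mulr_sumr -sumrB (le_trans (ler_norm_sum _ _ _))//.
rewrite -sum1_card natr_sum mulr_suml; apply: ler_sum => S _.
rewrite [m * _]mulrCA -mulrBr normrM ler_pM//.
  rewrite normr_prod; apply: prodr_ile1 => p _.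
  by rewrite normrN /odvd_ind; case: `[< _ >]; rewrite ?normr1 ?normr0 lexx ler01.
have [_] := lattice_disc eP 0 (set_prod_neq0 PP S) (lt_le_trans ltr01 r1).
rewrite (_ : [set x | odvd (set_prod S) (x - 0) /\ (x != 0 /\ nm x <= r)] =
    disc r `&` [set x | odvd (set_prod S) x]); last first.
  by apply/seteqP; split=> x /=; rewrite subr0 => -[].
move=> /le_trans; apply.
have : r / nm (set_prod S) <= r.
  by rewrite ler_pdivrMr ?(nm_gt0 eP) ?set_prod_neq0// ler_peMr ?(nm_ge1 eP) ?set_prod_neq0//; lra.
lra.
Qed.

(** The two preceding counts of the elements prime to [a] have the same leading
    coefficient as functions of the radius. *)
Theorem card_units_prod (P : {fset O}) a : a != 0 ->
  (forall p, p \in P -> cprime p) -> (forall p, cprime p -> odvd p a -> p \in P) ->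
  (card_units a)%:R / nm a ^+ 2 = \prod_(p : P) (1 - odvd_ind (val p) a / nm (val p) ^+ 2).
Proof.
move=> a0 PP Pa; set X := _ / _; set Y := \prod_(p : P) _.
apply/eqP; rewrite -subr_eq0 -normr_le0.
have pi0 := pi_gt0 R; have y2 := order_im eP; set y := complex.Im _ in y2.
have piy : 0 < pi / y by rewrite divr_gt0//; lra.
rewrite -(pmulr_rle0 _ piy).
apply: (@quadratic_le_linear R 1 _
  ((card_units a)%:R * 200 + #|{: {set P}}|%:R * 200)) => r r1.
have := coprime_count_sieve a0 r1 PP Pa; have := coprime_count a0 r1.
rewrite -/X -/Y -/y; set c := cnt _ _ => h1 h2.
have -> : pi / y * `|X - Y| * r ^+ 2 =
    `|(c - pi * r ^+ 2 / y * Y) - (c - pi * r ^+ 2 / y * X)|.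
  rewrite -[X in X * _ * _ = _](gtr0_norm piy) -[X in _ * X = _](ger0_norm (sqr_ge0 r)).
  by rewrite -!normrM; congr `|_|; ring.
by rewrite (le_trans (ler_normB _ _))//; lra.
Qed.

End EulerProduct.

(** * Summation by parts and uniform convergence over the primes *)

Section Summation.
Variable R : realType.

Definition level (T : Type) (A : set T) (N : T -> nat) n : set T :=
  [set a | A a /\ (N a <= n)%N].

Lemma abel_levels (T : choiceType) (A : set T) (N : T -> nat) (F : T -> R)
    (h : nat -> R) n : (forall n, finite_set (level A N n)) ->
  \sum_(a \in level A N n) (h (N a) * F a) =
  h n * (\sum_(a \in level A N n) F a) -
  \sum_(l < n) (h l.+1 - h l) * (\sum_(a \in level A N l) F a).
Proof.
move=> fin; elim: n => [|n IH].
  rewrite big_ord0 subr0 fsbig_distrr//; apply: eq_fsbigr => a.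
  by rewrite inE => -[_]; rewrite leqn0 => /eqP ->.
pose X := [set a | A a /\ N a = n.+1].
have E : level A N n.+1 = level A N n `|` X.
  apply/seteqP; split=> [a [Aa]|a [[Aa an]|[Aa aE]]].
  - by rewrite leq_eqVlt => /orP[/eqP aE|an]; [right|left].
  - by split=> //; exact: leqW.
  - by split=> //; rewrite aE.
have fX : finite_set X by apply: sub_finite_set (fin n.+1); rewrite E; right.
have dis : level A N n `&` X `<=` set0.
  by move=> a [[_ an] [_ aE]]; rewrite aE ltnn in an.
have SE (G : T -> R) : \sum_(a \in level A N n.+1) G a =
    \sum_(a \in level A N n) G a + \sum_(a \in X) G a.
  by rewrite E fsbigU0.
have XE : \sum_(a \in X) (h (N a) * F a) = h n.+1 * \sum_(a \in X) F a.
  by rewrite fsbig_distrr//; apply: eq_fsbigr => a; rewrite inE => -[_ ->].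
rewrite !SE IH XE big_ord_recr /=; ring.
Qed.

Definition root4 (x : R) := Num.sqrt (Num.sqrt x).

Lemma root4_gt0 x : (0 < root4 x) = (0 < x).
Proof. by rewrite /root4 !sqrtr_gt0. Qed.

Lemma root4E x : 0 <= x -> root4 x ^+ 4 = x.
Proof.
by move=> x0; rewrite -[4%N]/(2 * 2)%N exprM /root4 !sqr_sqrtr ?sqrtr_ge0.
Qed.

Lemma root4_le x y : x <= y -> root4 x <= root4 y.
Proof. by move=> xy; rewrite /root4 !ler_wsqrtr. Qed.

(** The sum telescopes when it is compared with the increments of
    [- 4 l^(-1/4)]. *)
Lemma sum_root4 n : \sum_(l < n.+1) root4 l.+1%:R ^- 5 <= 5 - 4 / root4 n.+1%:R.
Proof.
elim: n => [|n IH].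
  by rewrite big_ord1 /root4 !sqrtr1 expr1n invr1; lra.
rewrite big_ord_recr /=; apply: (le_trans (lerD IH (lexx _))).
set u := root4 n.+1%:R; set v := root4 n.+2%:R.
have u0 : 0 < u by rewrite root4_gt0 ltr0n.
have v0 : 0 < v by rewrite root4_gt0 ltr0n.
have uv : u <= v by apply: root4_le; rewrite ler_nat.
have uvE : v ^+ 4 = u ^+ 4 + 1 by rewrite !root4E// natr1.
(* [v - u] is [1] divided by [(v + u) (v^2 + u^2)], which is at most [4 v^3] *)
have duv : 1 <= (v - u) * (4 * v ^+ 3).
  have E1 : 1 = (v - u) * ((v + u) * (v ^+ 2 + u ^+ 2)).
    by rewrite -[LHS](addrK (u ^+ 4)) [1 + _]addrC -uvE; ring.
  rewrite [leLHS]E1 ler_wpM2l ?subr_ge0//.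
  have : (v + u) * (v ^+ 2 + u ^+ 2) <= (v + v) * (v ^+ 2 + v ^+ 2).
    apply: ler_pM; rewrite ?addr_ge0 ?sqr_ge0 ?(ltW u0) ?(ltW v0)//.
      by rewrite lerD2l.
    by rewrite lerD2l ler_pXn2r ?nnegrE ?(ltW u0) ?(ltW v0).
  by move=> /le_trans; apply; rewrite le_eqVlt; apply/orP; left; apply/eqP; ring.
suff : v ^- 5 <= 4 / u - 4 / v by lra.
have -> : 4 / u - 4 / v = (v - u) * (4 * v ^+ 3) / (u * v ^+ 4).
  by field; rewrite !gt_eqF.
rewrite ler_pdivlMr ?mulr_gt0 ?exprn_gt0//; apply: le_trans duv.
rewrite mulrC ler_pdivrMr ?exprn_gt0// mul1r [v ^+ 5]exprS.
by rewrite ler_wpM2r// exprn_ge0// ltW.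
Qed.

Lemma sum_by_parts (h : nat -> R) n : n%:R * h n + \sum_(l < n) l%:R * (h l - h l.+1) =
  \sum_(l < n) h l.+1.
Proof.
elim: n => [|n IH]; first by rewrite !big_ord0 mul0r addr0.
by rewrite !big_ord_recr /= -IH -natr1; ring.
Qed.

(** Summation by parts twice reduces the sum of [N^(-5/4)] to that of
    [l^(-5/4)] over the integers. *)
Lemma sum_levels_root4 (T : choiceType) (A : set T) (N : T -> nat) (C : R) n :
  (forall n, finite_set (level A N n)) -> 0 <= C ->
  (forall n, cnt R (level A N n) <= C * n%:R) ->
  \sum_(a \in level A N n) root4 (N a)%:R ^- 5 <= 5 * C.
Proof.
move=> fin C0 AC; pose h (n : nat) := root4 n%:R ^- 5.
rewrite (eq_fsbigr (fun a => h (N a) * 1)); last by move=> a _; rewrite mulr1.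
rewrite (abel_levels (fun=> 1) h) // -sumrN.
have c0 : cnt R (level A N 0) = 0.
  by apply/eqP; rewrite eq_le cnt_ge0 andbT (le_trans (AC _))// mulr0.
have hdec l : (0 < l)%N -> h l.+1 <= h l.
  move=> l0; have q0 : 0 < root4 (l%:R : R) by rewrite root4_gt0 ltr0n.
  have q1 : 0 < root4 (l.+1%:R : R) by rewrite root4_gt0 ltr0n.
  rewrite /h lef_pV2 ?posrE ?exprn_gt0// ler_pXn2r ?nnegrE ?(ltW q0) ?(ltW q1)//.
  by rewrite root4_le// ler_nat.
have h0 l : 0 <= h l by rewrite invr_ge0 exprn_ge0// sqrtr_ge0.
apply: (@le_trans _ _ (C * (n%:R * h n + \sum_(l < n) l%:R * (h l - h l.+1)))).
  rewrite mulrDr lerD//.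
    by rewrite mulrC mulrA ler_wpM2r//; exact: AC.
  rewrite mulr_sumr; apply: ler_sum => -[[|l] ln] _ /=.
    by rewrite -/(cnt R _) c0 mul0r !mulr0 oppr0.
  by rewrite -mulNr opprB mulrA mulrC ler_wpM2r ?subr_ge0 ?hdec//; exact: AC.
rewrite sum_by_parts mulrC ler_wpM2r//; case: n => [|n]; first by rewrite big_ord0.
apply: (le_trans (sum_root4 n)); rewrite gerBl divr_ge0//.
by rewrite ltW// root4_gt0 ltr0n.
Qed.

End Summation.

Lemma fsum_le_subset (R : realType) (T : choiceType) (A B : set T) (F : T -> R) :
  finite_set B -> A `<=` B -> (forall x, B x -> 0 <= F x) ->
  \sum_(x \in A) F x <= \sum_(x \in B) F x.
Proof.
move=> fB AB F0; rewrite [leRHS](fsbigID A)//= (setIidr AB) lerDl.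
by apply: fsumr_ge0 => x [Bx _]; exact: F0.
Qed.

Lemma fsum_le (R : realType) (T : choiceType) (A : set T) (F G : T -> R) :
  finite_set A -> (forall x, A x -> F x <= G x) ->
  \sum_(x \in A) F x <= \sum_(x \in A) G x.
Proof.
move=> fA FG; rewrite !fsbig_finite//= big_seq [leRHS]big_seq.
by apply: ler_sum => x; rewrite in_fset_set// inE; exact: FG.
Qed.

Section PrimeSums.
Variables (R : realType) (O : comNzRingType) (e : {rmorphism O -> R[i]}) (w : O).
Hypothesis eP : plane_order e w.
Hypothesis pid : principal_ideal_ring O.
Implicit Types a b l x y : O.
Local Notation nm := (nm e).

Definition nnorm a : nat := Num.trunc (nm a ^+ 2).

Lemma nnormE a : (nnorm a)%:R = nm a ^+ 2.
Proof. by have [n nE] := nm_nat eP a; rewrite /nnorm nE natrK. Qed.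

Lemma nnorm_disc a n : (nnorm a <= n)%N = (nm a <= Num.sqrt (n%:R : R)).
Proof.
rewrite -(ler_nat R) nnormE; apply/idP/idP => h.
  by rewrite -[nm a](ger0_norm (nm_ge0 e a)) -sqrtr_sqr ler_wsqrtr.
by rewrite -(sqr_sqrtr (ler0n R n)) ler_pXn2r ?nnegrE ?nm_ge0 ?sqrtr_ge0.
Qed.

Lemma level_disc n : level [set a | a != 0] nnorm n = disc e (Num.sqrt n%:R).
Proof.
by apply/seteqP; split=> a [h1 h2]; split=> //=; rewrite ?nnorm_disc// -nnorm_disc.
Qed.

Definition cprimes M : {fset O} := fset_set [set p | cprime p /\ (nnorm p <= M)%N].

Lemma mem_cprimes M p : p \in cprimes M <-> cprime p /\ (nnorm p <= M)%N.
Proof.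
rewrite /cprimes in_fset_set; first by rewrite inE.
apply: (@sub_finite_set _ _ (level [set a | a != 0] nnorm M)).
  by move=> q [[[q0 _ _] _] qM].
by rewrite level_disc; exact: finite_disc eP _.
Qed.

Lemma cprimesP M p : p \in cprimes M -> cprime p.
Proof. by move=> /mem_cprimes[]. Qed.

Definition sqrt_nm a : R := Num.sqrt (nm a).

Lemma root4_nnorm a : root4 (nnorm a)%:R = sqrt_nm a.
Proof. by rewrite /root4 nnormE sqrtr_sqr ger0_norm// nm_ge0. Qed.

Lemma sqrt_nm_gt0 a : a != 0 -> 0 < sqrt_nm a.
Proof. by move=> a0; rewrite sqrtr_gt0 (nm_gt0 eP). Qed.

(** The bound is [5 * 210], where [210] comes from the count of the elements
    of a disc; it is the same for all fields. *)
Lemma sum_cprimes M : \sum_(p : cprimes M) sqrt_nm (val p) ^- 5 <= 1050.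
Proof.
rewrite -(big_seq_fsetE _ _ xpredT (fun p => sqrt_nm p ^- 5)) /=.
have lev n : finite_set (level [set a | a != 0] nnorm n).
  by rewrite level_disc; exact: finite_disc eP _.
apply: (@le_trans _ _
  (\sum_(a \in level [set a | a != 0] nnorm M) root4 (nnorm a)%:R ^- 5)).
  rewrite fsbig_seq ?fset_uniq//.
  under [leRHS]eq_fsbigr do rewrite root4_nnorm.
  apply: fsum_le_subset => // [p /= /mem_cprimes[[[p0 _ _] _] pM]|a _] //.
  by rewrite invr_ge0 exprn_ge0// sqrtr_ge0.
have -> : 1050 = 5 * 210 :> R by ring.
have c0 : 0 <= 210 :> R by lra.
apply: (sum_levels_root4 _ lev c0) => n; rewrite level_disc.
by rewrite -{2}[n%:R](sqr_sqrtr (ler0n _ _)); exact: (disc_count eP (sqrtr_ge0 _)).2.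
Qed.

(** A bound, valid for all fields, for the sum of [N(d)^(-5/4)] over the
    squarefree elements [d]. *)
Definition subset_bound : R := expR 1050.

Lemma sum_subsets M :
  \sum_(S : {set cprimes M}) \prod_(p in S) sqrt_nm (val p) ^- 5 <= subset_bound.
Proof.
rewrite -prod_expand /subset_bound.
apply: (@le_trans _ _ (expR (\sum_(p : cprimes M) sqrt_nm (val p) ^- 5))).
  rewrite expR_sum; apply: ler_prod => p _.
  have q0 : 0 <= sqrt_nm (val p) ^- 5 by rewrite invr_ge0 exprn_ge0// sqrtr_ge0.
  by rewrite addr_ge0//= expR_ge1Dx.
by rewrite ler_expR sum_cprimes.
Qed.

Definition phi_ratio a : R := if a == 0 then 0 else (card_units a)%:R / nm a ^+ 2.

Definition truncated_ratio M a : R :=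
  \prod_(p : cprimes M) (1 - odvd_ind R (val p) a / nm (val p) ^+ 2).

Lemma phi_ratio_truncated M a : a != 0 -> (nnorm a <= M)%N ->
  phi_ratio a = truncated_ratio M a.
Proof.
move=> a0 aM; rewrite /phi_ratio (negPf a0).
apply: (card_units_prod eP pid a0); first exact: cprimesP.
move=> p pP pa; apply/mem_cprimes; split=> //; apply: leq_trans aM.
rewrite -(ler_nat R) !nnormE ler_pXn2r ?nnegrE ?nm_ge0//.
exact: (le_nm_odvd eP pa a0).
Qed.

Lemma phi_ratio_itv a : 0 <= phi_ratio a <= 1.
Proof.
have [->|a0] := eqVneq a 0; first by rewrite /phi_ratio eqxx lexx ler01.
rewrite (phi_ratio_truncated a0 (leqnn _)).
have f01 (p : cprimes (nnorm a)) : 0 <= 1 - odvd_ind R (val p) a / nm (val p) ^+ 2 <= 1.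
  have [[p0 _ _] _] := cprimesP (valP p).
  have p1 := nm_ge1 eP p0.
  have : 0 <= odvd_ind R (val p) a / nm (val p) ^+ 2 <= 1.
    rewrite divr_ge0 ?sqr_ge0//= ?ler0n// ler_pdivrMr ?exprn_gt0 ?(nm_gt0 eP)// mul1r.
    apply: (le_trans _ (exprn_ege1 2 p1)).
    by rewrite /odvd_ind; case: `[< _ >]; rewrite ?lexx ?ler01.
  lra.
rewrite /truncated_ratio prodr_ge0 => [|p _]; last by have /andP[] := f01 p.
by apply: prodr_ile1 => p _; exact: f01.
Qed.

End PrimeSums.

(** * Simultaneous divisibility of [a] and [a + k] *)

Section Progressions.
Variables (R : realType) (O : comNzRingType) (e : {rmorphism O -> R[i]}) (w : O).
Hypothesis eP : plane_order e w.
Hypothesis pid : principal_ideal_ring O.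
Variables (k g : O).
Hypothesis g0 : g != 0.
Implicit Types a b c l x y : O.
Local Notation nm := (nm e).
Local Notation sqrt_nm := (sqrt_nm e).

Lemma sector_cmod (z v : R[i]) (theta r : R) : z != 0 ->
  angular_sector z theta r v -> 0 < cmod v <= r.
Proof.
move=> z0 /(sectorP _ _ _ z0)[t [rho [_ /andP[rho0 rhor] ->]]].
have cz : 0 < cmod z by rewrite cmod_gt0.
rewrite !cmodM cmod_expi mulr1 cmod_real ?divr_ge0 ?(ltW rho0) ?(ltW cz)//.
by rewrite divfK ?gt_eqF// rho0.
Qed.

Lemma oM_neq0 a b : a != 0 -> b != 0 -> a * b != 0.
Proof. by move=> a0 b0; apply/eqP => /(oM_eq0 eP)[/eqP|/eqP]; apply/negP. Qed.

(** The three congruences are compatible or not; in the first case they amount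
    to a single one, modulo a generator of the intersection of the ideals. *)
Lemma progression_coset b c : b != 0 -> c != 0 ->
  exists l, [/\ l != 0, nm b <= nm l, nm c <= nm l &
    (forall a, ~ [/\ odvd g a, odvd b a & odvd c (a + k)]) \/
    exists v, forall a, [/\ odvd g a, odvd b a & odvd c (a + k)] <-> odvd l (a - v)].
Proof.
move=> b0 c0; pose J : set O := [set a | [/\ odvd g a, odvd b a & odvd c a]].
have [|l lE] := pid (I := J).
  split=> [|x y [? ? ?] [? ? ?]|x y [? ? ?]].
  - by split; exact: odvd0.
  - by split; exact: odvdD.
  - by split; exact: odvdMl.
rewrite principal_idealE in lE.
have JE a : J a <-> odvd l a by rewrite lE.
have [gl bl cl] : J l by apply/JE; exact: odvd_refl.
have l0 : l != 0.
  have : odvd l (g * b * c).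
    apply/JE; split.
    - by apply/odvdMr/odvdMr; exact: odvd_refl.
    - by apply/odvdMr/odvdMl; exact: odvd_refl.
    - by apply/odvdMl; exact: odvd_refl.
  move=> [u uE]; apply/eqP => l0; move: uE; rewrite l0 mulr0 => /eqP.
  by apply/negP; rewrite !oM_neq0.
exists l; split=> //; [exact: (le_nm_odvd eP)|exact: (le_nm_odvd eP)|].
have [[v [gv bv cv]]|N] := pselect (exists v, [/\ odvd g v, odvd b v & odvd c (v + k)]).
  right; exists v => a; split=> [[ga ba ca]|].
    apply/JE; split; [exact: odvdB|exact: odvdB|].
    by rewrite (_ : a - v = (a + k) - (v + k)); [exact: odvdB|ring].
  move=> /JE[gav bav cav]; rewrite -[a](subrK v).
  split; [exact: odvdD|exact: odvdD|].
  by rewrite -addrA; exact: odvdD.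
by left=> a ga; apply: N; exists a.
Qed.

Definition progression b c (z : R[i]) (theta r : R) : set O :=
  [set a | [/\ odvd g a, angular_sector z theta r (e a) & a + k != 0]] `&`
  [set a | odvd b a /\ odvd c (a + k)].

Lemma sqrt_nmE a : sqrt_nm a ^+ 2 = nm a. Proof. by rewrite sqr_sqrtr// nm_ge0. Qed.

Lemma sqrt_nmM_le b c (x : R) : nm b <= x -> nm c <= x -> sqrt_nm b * sqrt_nm c <= x.
Proof.
rewrite -!sqrt_nmE => bx cx; have := sqr_ge0 (sqrt_nm b - sqrt_nm c); rewrite sqrrB.
lra.
Qed.

(** The point of this bound is that it decays with [b] and [c]: its sum over
    all pairs, with weights [1 / (N(b) N(c))], converges and stays linear in
    [r]. The modulus [l] of the coset is a multiple of [b] and of [c], hence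
    [nm l >= sqrt_nm b * sqrt_nm c], which controls the boundary term [r / nm l]. The
    bounded term is absorbed when [nm b <= r] and [nm c <= r + nm k]; otherwise
    the progression has no point, and the main term is small because
    [nm l >= r]. The excluded element [a = - k] accounts for one more point. *)
Lemma progression_count b c : b != 0 -> c != 0 ->
  exists kap : R, forall z (theta r : R), z != 0 -> 0 < theta <= 2 * pi -> 1 <= r ->
  `|cnt R (progression b c z theta r) - theta * r ^+ 2 / (2 * complex.Im (e w)) * kap| <=
     202 * (r + nm k) / (sqrt_nm b * sqrt_nm c).
Proof.
move=> b0 c0; have [l [l0 bl cl coset]] := progression_coset b0 c0.
have rtb : 0 < sqrt_nm b by rewrite (sqrt_nm_gt0 eP).
have rtc : 0 < sqrt_nm c by rewrite (sqrt_nm_gt0 eP).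
have nl : 0 < nm l by rewrite (nm_gt0 eP).
have k0 := nm_ge0 e k.
case: coset => [N|[v vE]].
  exists 0 => z theta r z0 th r1.
  rewrite (_ : progression _ _ _ _ _ = set0); last first.
    by apply/seteqP; split=> // a [[ga _ _] [ba ca]]; case: (N a).
  rewrite cnt0 mulr0 subr0 normr0; apply: divr_ge0; last exact: mulr_ge0 (ltW rtb) (ltW rtc).
  by lra.
exists (nm l ^- 2) => z theta r z0 th r1; have r0 : 0 < r by lra.
have [fA cA] := lattice_sector eP v l0 z0 th r0.
set A := [set a | _] in fA cA; set m := theta * _ / _ in cA *.
set D := progression _ _ _ _ _; set q := _ / (sqrt_nm b * sqrt_nm c).
have DA : D `<=` A.
  by move=> a [[ga sa _] [ba ca]]; split=> //; apply/vE.
have rl : r / nm l <= r / (sqrt_nm b * sqrt_nm c).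
  by rewrite ler_pM2l// lef_pV2 ?posrE ?mulr_gt0// sqrt_nmM_le.
have rq : r / (sqrt_nm b * sqrt_nm c) <= (r + nm k) / (sqrt_nm b * sqrt_nm c).
  by rewrite ler_pM2r ?invr_gt0 ?mulr_gt0// lerDl.
have qE : q = 202 * ((r + nm k) / (sqrt_nm b * sqrt_nm c)) by rewrite /q mulrA.
have [/andP[br ck]|big] := boolP ((nm b <= r) && (nm c <= r + nm k)).
  have q1 : 1 <= (r + nm k) / (sqrt_nm b * sqrt_nm c).
    by rewrite ler_pdivlMr ?mulr_gt0// mul1r sqrt_nmM_le//; lra.
  have fD := sub_finite_set DA fA.
  have D1 : cnt R A <= cnt R D + 1.
    apply: (@le_trans _ _ (cnt R (D `|` [set - k]))).
      apply: cnt_le; first by rewrite finite_setU.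
      move=> a [/vE[ga ba ca] sa]; have [ak|ak] := eqVneq (a + k) 0.
        by right; apply/eqP; rewrite -addr_eq0 ak.
      by left; split=> //; split.
    rewrite cntU//; last first.
      apply/seteqP; split=> // a [[[_ _ ak] _] aE]; move: ak.
      by rewrite (_ : a = - k)// addNr eqxx.
    by rewrite lerD2l /cnt fsbig_set1.
  have := cnt_le R fA DA; move: cA; rewrite !ler_norml; lra.
have -> : D = set0.
  apply/seteqP; split=> // a [[ga sa ak] [ba ca]]; move: big.
  have /andP[a0 ar] := sector_cmod z0 sa.
  have an0 : a != 0 by rewrite -(nm_gt0 eP).
  rewrite (le_trans (le_nm_odvd eP ba an0))//= (le_trans (le_nm_odvd eP ca ak))//.
  by rewrite (le_trans (le_nmD e a k))// lerD2r.
have lr : r <= nm l.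
  move: big; rewrite negb_and -!ltNge => /orP[rb|rc]; lra.
have pi0 := pi_gt0 R; have pi4 : pi < 4 :> R by have := pihalf_lt2 R; lra.
have y2 := order_im eP; set y := complex.Im _ in y2 m cA *.
have m8 : m <= 8 * r ^+ 2.
  rewrite /m ler_pdivrMr; last lra.
  have h1 : theta * r ^+ 2 <= 8 * r ^+ 2 by rewrite ler_wpM2r ?sqr_ge0//; lra.
  have h2 : 0 <= r ^+ 2 * (2 * y - 1) by rewrite mulr_ge0 ?sqr_ge0//; lra.
  lra.
have m0 : 0 <= m.
  apply: divr_ge0; last lra.
  by apply: mulr_ge0; rewrite ?sqr_ge0//; lra.
have rl1 : r / nm l <= 1 by rewrite ler_pdivrMr// mul1r.
rewrite cnt0 sub0r normrN ger0_norm; last by apply: mulr_ge0; rewrite ?invr_ge0 ?sqr_ge0.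
have : m * nm l ^- 2 <= 8 * (r / nm l).
  apply: (@le_trans _ _ (8 * (r / nm l) ^+ 2)).
    by rewrite expr_div_n mulrA ler_wpM2r// invr_ge0 sqr_ge0.
  by rewrite ler_pM2l// expr2 ger_pMr// divr_gt0.
rewrite qE; have : 0 <= r / nm l by rewrite divr_ge0// ltW.
lra.
Qed.

Lemma progression_densities : exists kap : O * O -> R,
  forall b c, b != 0 -> c != 0 ->
  forall z (theta r : R), z != 0 -> 0 < theta <= 2 * pi -> 1 <= r ->
  `|cnt R (progression b c z theta r) -
      theta * r ^+ 2 / (2 * complex.Im (e w)) * kap (b, c)| <=
     202 * (r + nm k) / (sqrt_nm b * sqrt_nm c).
Proof.
pose Q (bc : O * O) (kp : R) := bc.1 != 0 -> bc.2 != 0 ->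
  forall z (theta r : R), z != 0 -> 0 < theta <= 2 * pi -> 1 <= r ->
  `|cnt R (progression bc.1 bc.2 z theta r) -
      theta * r ^+ 2 / (2 * complex.Im (e w)) * kp| <=
     202 * (r + nm k) / (sqrt_nm bc.1 * sqrt_nm bc.2).
have [bc|kap kapP] := @choice _ _ Q.
  have [[b0 c0]|N] := pselect (bc.1 != 0 /\ bc.2 != 0).
    by have [kp kpP] := progression_count b0 c0; exists kp => _ _.
  by exists 0 => b0 c0; case: N.
by exists kap => b c; exact: (kapP (b, c)).
Qed.

(** The element with [a + k = 0] is left out: its ratio is [0] by convention,
    while its truncated product is not. *)
Definition truncated_sum M (z : R[i]) (theta r : R) : R :=
  \sum_(a \in [set a | [/\ odvd g a, angular_sector z theta r (e a) & a + k != 0]])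
     truncated_ratio e M a * truncated_ratio e M (a + k).

Lemma finite_sector (z : R[i]) (theta r : R) : z != 0 ->
  finite_set [set a | angular_sector z theta r (e a)].
Proof.
move=> z0; apply: sub_finite_set (finite_disc eP r) => a /(sector_cmod z0)/andP[a0 ar].
by split=> //; rewrite -(nm_gt0 eP).
Qed.

Definition weight M (S : {set cprimes e M}) : R := \prod_(p in S) - (nm (val p) ^- 2).

Lemma truncated_weight M a : truncated_ratio e M a =
  \sum_(S : {set cprimes e M}) weight S * odvd_ind R (set_prod S) a.
Proof.
rewrite -(sieve_expand eP (@cprimesP _ _ _ _ eP M)).
by apply: eq_bigr => p _; rewrite mulrC.
Qed.

Lemma weight_sqrt_nm M (S : {set cprimes e M}) :
  `|weight S| / sqrt_nm (set_prod S) = \prod_(p in S) sqrt_nm (val p) ^- 5.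
Proof.
rewrite /weight normr_prod.
have -> : sqrt_nm (set_prod S) = \prod_(p in S) sqrt_nm (val p).
  rewrite /sqrt_nm nm_set_prod; elim/big_rec2: _ => [|p x y _ xy]; first by rewrite sqrtr1.
  by rewrite sqrtrM ?nm_ge0// xy.
rewrite -prodfV -big_split/=; apply: eq_bigr => p _.
by rewrite normrN ger0_norm ?invr_ge0 ?sqr_ge0// -sqrt_nmE -exprM -invfM -exprSr.
Qed.

Lemma truncated_sum_expand M (z : R[i]) (theta r : R) : z != 0 ->
  truncated_sum M z theta r =
  \sum_(S : {set cprimes e M}) \sum_(S' : {set cprimes e M})
    weight S * weight S' * cnt R (progression (set_prod S) (set_prod S') z theta r).
Proof.
move=> z0; rewrite /truncated_sum; set A := [set a | _].
have fA : finite_set A by apply: sub_finite_set (finite_sector theta r z0) => a [].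
rewrite fsbig_finite//=.
under eq_bigr => a _.
  rewrite !truncated_weight big_distrlr/=.
  over.
rewrite exchange_big/=; apply: eq_bigr => S _.
rewrite exchange_big/=; apply: eq_bigr => S' _.
rewrite cnt_setI// fsbig_finite//= mulr_sumr; apply: eq_bigr => a _.
rewrite mulrACA; congr (_ * _); rewrite /odvd_ind -natrM mulnb; congr (nat_of_bool _)%:R.
apply/andP/idP => [[/asboolP h1 /asboolP h2]|]; first by rewrite inE.
by rewrite inE => -[h1 h2]; split; apply/asboolP.
Qed.

(** The error bounds of the progressions multiply the weights [1 / N(p)] into
    [N(p)^(-5/4)], whose sum over all sets of primes is bounded independently
    of the truncation. *)
Lemma truncated_sum_asymp M : exists c : R, forall z (theta r : R),
  z != 0 -> 0 < theta <= 2 * pi -> 1 <= r ->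
  `|truncated_sum M z theta r - theta * r ^+ 2 / (2 * complex.Im (e w)) * c| <=
     202 * subset_bound R ^+ 2 * (r + nm k).
Proof.
have [kap kapP] := progression_densities.
exists (\sum_(S : {set cprimes e M}) \sum_(S' : {set cprimes e M})
    weight S * weight S' * kap (set_prod S, set_prod S')) => z theta r z0 th r1.
rewrite truncated_sum_expand// mulr_sumr -sumrB.
have dS0 (S : {set cprimes e M}) : set_prod S != 0.
  by apply: (set_prod_neq0 eP) => p; exact: (cprimesP eP).
have rk : 0 <= r + nm k by rewrite addr_ge0 ?nm_ge0//; lra.
rewrite (le_trans (ler_norm_sum _ _ _))//.
apply: (@le_trans _ _ (\sum_(S : {set cprimes e M}) \sum_(S' : {set cprimes e M})
   202 * (r + nm k) *
     (\prod_(p in S) sqrt_nm (val p) ^- 5 * \prod_(p in S') sqrt_nm (val p) ^- 5))).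
  apply: ler_sum => S _; rewrite mulr_sumr -sumrB.
  rewrite (le_trans (ler_norm_sum _ _ _))//; apply: ler_sum => S' _.
  rewrite [_ * (_ * kap _)]mulrCA -mulrBr normrM -!weight_sqrt_nm.
  apply: (le_trans (ler_wpM2l (normr_ge0 _) (kapP _ _ (dS0 S) (dS0 S') z theta r z0 th r1))).
  by rewrite normrM invfM le_eqVlt; apply/orP; left; apply/eqP; ring.
under eq_bigr do rewrite -mulr_sumr.
rewrite -mulr_sumr -big_distrlr/= -expr2 mulrAC.
have s0 : 0 <= \sum_(S : {set cprimes e M}) \prod_(p in S) sqrt_nm (val p) ^- 5.
  apply: sumr_ge0 => S _; apply: prodr_ge0 => p _.
  by rewrite invr_ge0 exprn_ge0// sqrtr_ge0.
rewrite ler_wpM2r//; apply: ler_wpM2l; first lra.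
rewrite ler_pXn2r ?nnegrE ?s0 ?expR_ge0//.
exact: (sum_subsets eP).
Qed.

End Progressions.

(** * The mean value of the product of the two ratios *)

Section MeanDensity.
Variables (R : realType) (O : comNzRingType) (e : {rmorphism O -> R[i]}) (w : O).
Hypothesis eP : plane_order e w.
Hypothesis pid : principal_ideal_ring O.
Variables (k g : O).
Hypothesis g0 : g != 0.
Implicit Types a b c l x y : O.
Local Notation nm := (nm e).
Local Notation y := (complex.Im (e w)).

Definition ratio_sum (z : R[i]) (theta r : R) : R :=
  \sum_(a \in [set a | odvd g a /\ angular_sector z theta r (e a)])
     phi_ratio e a * phi_ratio e (a + k).

Lemma ratio_sum_truncated M (z : R[i]) (theta r : R) : z != 0 -> 1 <= r ->
  (r + nm k) ^+ 2 <= M%:R -> ratio_sum z theta r = truncated_sum e k g M z theta r.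
Proof.
move=> z0 r1 rM.
have -> : ratio_sum z theta r =
    \sum_(a \in [set a | [/\ odvd g a, angular_sector z theta r (e a) & a + k != 0]])
     phi_ratio e a * phi_ratio e (a + k).
  apply/esym/fsbig_widen => [a []//|a [[ga sa] N]] /=.
  have [->|ak] := eqVneq (a + k) 0; first by rewrite /phi_ratio eqxx mulr0.
  by case: N.
apply: eq_fsbigr => a; rewrite inE => -[ga sa ak].
have /andP[a0 ar] := sector_cmod z0 sa.
have nk := nm_ge0 e k.
have le_M b : nm b <= r + nm k -> (nnorm e b <= M)%N.
  move=> br; rewrite -(ler_nat R) (nnormE eP) (le_trans _ rM)//.
  by rewrite ler_pXn2r ?nnegrE ?nm_ge0//; lra.
rewrite !(phi_ratio_truncated (M := M) eP pid)//.
- by apply: le_M; rewrite (le_trans (le_nmD e a k))// lerD2r.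
- by rewrite -(nm_gt0 eP).
- by apply: le_M; rewrite -[nm a]/(cmod (e a)); lra.
Qed.

Definition ratio_error : R := 202 * subset_bound R ^+ 2 * (1 + nm k).

(** Each sector confines the constants of all large enough truncations to an
    interval. Any two of these intervals therefore meet, and the supremum of
    their left ends belongs to all of them. *)
Lemma ratio_sum_asymp : exists c : R, forall z (theta r : R),
  z != 0 -> 0 < theta <= 2 * pi -> 1 <= r ->
  `|ratio_sum z theta r - theta * r ^+ 2 / (2 * y) * c| <= ratio_error * r.
Proof.
have [cM cMP] := choice (truncated_sum_asymp eP pid k g0).
pose ok (t : R[i] * R * R) := [/\ t.1.1 != 0, 0 < t.1.2 <= 2 * pi & 1 <= t.2].
pose m (t : R[i] * R * R) := t.1.2 * t.2 ^+ 2 / (2 * y).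
pose B (t : R[i] * R * R) := ratio_sum t.1.1 t.1.2 t.2.
have y2 := order_im eP.
have m0 t : ok t -> 0 < m t.
  by move=> [t1 t2 t3]; rewrite /m divr_gt0 ?mulr_gt0 ?exprn_gt0//; lra.
have near t : ok t -> exists M0, forall M, (M0 <= M)%N ->
    `|B t - m t * cM M| <= ratio_error * t.2.
  move=> [t1 t2 t3]; exists (Num.trunc ((t.2 + nm k) ^+ 2)).+1 => M M0.
  have tM : (t.2 + nm k) ^+ 2 <= M%:R.
    apply: (@le_trans _ _ (Num.trunc ((t.2 + nm k) ^+ 2)).+1%:R); last by rewrite ler_nat.
    by rewrite ltW// truncnS_gt.
  rewrite /B (ratio_sum_truncated _ t1 t3 tM) (le_trans (cMP M _ _ _ t1 t2 t3))//.
  rewrite /ratio_error -[leRHS]mulrA; apply: ler_wpM2l.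
    by have := sqr_ge0 (subset_bound R); lra.
  by rewrite mulrDl mul1r lerD2l ler_peMr ?nm_ge0.
pose L t := (B t - ratio_error * t.2) / m t.
pose U t := (B t + ratio_error * t.2) / m t.
have LU t t' : ok t -> ok t' -> L t <= U t'.
  move=> tok t'ok; have [M1 H1] := near t tok; have [M2 H2] := near t' t'ok.
  have := H1 _ (leq_maxl M1 M2); have := H2 _ (leq_maxr M1 M2).
  set c := cM _; rewrite !ler_norml => h2 h1.
  apply: (@le_trans _ _ c); rewrite /L /U.
    by rewrite ler_pdivrMr ?m0// mulrC; lra.
  by rewrite ler_pdivlMr ?m0// mulrC; lra.
pose E := [set x | exists t, ok t /\ x = L t].
have pi0 := pi_gt0 R.
have ok1 : ok (1, 2 * pi, 1) by split=> //=; lra.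
have E0 : E !=set0 by exists (L (1, 2 * pi, 1)), (1, 2 * pi, 1).
exists (sup E) => z theta r z0 th r1.
pose t := (z, theta, r); have tok : ok t by [].
have up : sup E <= U t by apply: ge_sup => // _ [t' [t'ok ->]]; exact: LU.
have lo : L t <= sup E.
  apply: ub_le_sup; last by exists t.
  by exists (U t) => _ [t' [t'ok ->]]; exact: LU.
move: up lo; rewrite /L /U ler_pdivlMr ?m0// ler_pdivrMr ?m0// => up lo.
by rewrite -/(B t) -/(m t) ler_norml [m t * _]mulrC -[r]/(t.2); lra.
Qed.

Lemma bernoulli8 (n : R) : 9 <= n -> n^-1 <= (1 - n^-1) ^+ 8.
Proof.
move=> n9; have n0 : 0 < n by lra.
have x0 : 0 < n^-1 by rewrite invr_gt0.
have x1 : n^-1 <= 1 / 9 by rewrite -[n^-1]div1r ler_pdivrMr//; lra.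
set x := n^-1 in x0 x1 *.
have h2 : 1 - 2 * x <= (1 - x) ^+ 2 by have := sqr_ge0 x; lra.
have h4 : 1 - 4 * x <= (1 - x) ^+ 4.
  rewrite -[4%N]/(2 * 2)%N exprM; apply: (@le_trans _ _ ((1 - 2 * x) ^+ 2)).
    by have := sqr_ge0 x; lra.
  by rewrite ler_pXn2r ?nnegrE ?sqr_ge0//; lra.
have h8 : 1 - 8 * x <= (1 - x) ^+ 8.
  rewrite -[8%N]/(4 * 2)%N exprM; apply: (@le_trans _ _ ((1 - 4 * x) ^+ 2)).
    by have := sqr_ge0 x; lra.
  by rewrite ler_pXn2r ?nnegrE ?exprn_even_ge0//; lra.
lra.
Qed.

Definition small_primes : nat := size (cprimes e 9).

(** The ratio is at least a constant times [N(a)^(-1/8)]: all but finitely many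
    primes satisfy [(1 - 1/N)^8 >= 1/N], and the product of the norms of the
    primes that divide [a] is at most the norm of [a]. *)
Lemma phi_ratio_lower a : a != 0 ->
  (1 / 256) ^+ small_primes <= phi_ratio e a ^+ 8 * nm a ^+ 2.
Proof.
move=> a0; set M := nnorm e a.
rewrite (phi_ratio_truncated (M := M) eP pid)// /truncated_ratio.
pose S : {set cprimes e M} := [set p | `[< odvd (val p) a >]]%SET.
pose u (p : O) : R := if (nnorm e p <= 9)%N then 1 / 256 else 1.
have pr (p : cprimes e M) : 2 <= nm (val p) ^+ 2.
  have [[p0 p1 _] _] := cprimesP eP (valP p).
  have [n nE] := nm_nat eP (val p); rewrite nE ler_nat.
  rewrite ltn_neqAle -(ltr0n R) -nE exprn_gt0 ?(nm_gt0 eP)// andbT.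
  apply/eqP => n1; apply: p1; apply: (unit_nm1 eP).
  by apply/eqP; rewrite -(@eqrXn2 _ 2) ?nm_ge0 ?ler01// expr1n nE -n1.
have trE : \prod_(p : cprimes e M) (1 - odvd_ind R (val p) a / nm (val p) ^+ 2) =
    \prod_(p in S) (1 - (nm (val p) ^+ 2)^-1).
  rewrite [RHS]big_mkcond; apply: eq_bigr => p _.
  by rewrite inE /odvd_ind; case: ifP => _; rewrite ?mul1r ?mul0r ?subr0.
rewrite trE -prodrXl.
have dSa : odvd (set_prod S) a.
  apply/(set_prod_odvd eP (@cprimesP _ _ _ _ eP M)) => p.
  by rewrite inE => /asboolP.
have nS := le_nm_odvd eP dSa a0.
have nSE : nm (set_prod S) ^+ 2 = \prod_(p in S) nm (val p) ^+ 2 by rewrite nm_set_prod prodrXl.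
apply: (@le_trans _ _ (\prod_(p in S) ((1 - (nm (val p) ^+ 2)^-1) ^+ 8) * nm (set_prod S) ^+ 2)).
  rewrite nSE -big_split/=.
  apply: (@le_trans _ _ (\prod_(p : cprimes e M) u (val p))).
    rewrite -(big_seq_fsetE _ _ xpredT u)/=.
    rewrite /u -big_mkcond/= -big_filter big_const_seq count_predT.
    rewrite -[iter _ _ _]/(_) iter_mulr_1.
    have i0 : 0 <= 1 / 256 :> R by lra.
    have i1 : 1 / 256 <= 1 :> R by lra.
    rewrite (ler_wiXn2l i0 i1)//; apply: uniq_leq_size.
      by rewrite filter_uniq// fset_uniq.
    move=> p; rewrite mem_filter => /andP[p9 /(mem_cprimes eP)[pP _]].
    by apply/(mem_cprimes eP).
  rewrite [leRHS]big_mkcond/=; apply: ler_prod => p _.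
  have p2 := pr p; set n := nm _ ^+ 2 in p2 *.
  have nE : (nnorm e (val p))%:R = n by rewrite (nnormE eP).
  have n0 : 0 < n by lra.
  have u01 : 0 <= u (val p) <= 1 by rewrite /u; case: ifP => _; lra.
  case: ifP => _ //; rewrite (andP u01).1/=.
  rewrite /u; case: leqP => [n9|n9].
    have x2 : n^-1 <= 1 / 2 by rewrite -[n^-1]div1r ler_pdivrMr//; lra.
    have : (1 / 2) ^+ 8 <= (1 - n^-1) ^+ 8 by rewrite ler_pXn2r ?nnegrE//; lra.
    move=> h8; have -> : 1 / 256 = (1 / 2) ^+ 8 * 1 :> R by field.
    by apply: ler_pM => //; rewrite ?exprn_ge0//; lra.
  have n9' : 9 <= n by rewrite -nE ler_nat ltnW.
  by have /(ler_wpM2r (ltW n0)) := bernoulli8 n9'; rewrite mulVf ?gt_eqF.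
rewrite ler_wpM2l//.
  by apply: prodr_ge0 => p _; rewrite exprn_even_ge0.
by rewrite ler_pXn2r ?nnegrE ?nm_ge0.
Qed.

Lemma ideal_disc_count r : 1 <= r ->
  let A := [set a | odvd g a /\ angular_sector 1 (2 * pi) r (e a)] in
  finite_set A /\ `|cnt R A - pi * r ^+ 2 / y / nm g ^+ 2| <= 200 * r.
Proof.
move=> r1 A; have r0 : 0 < r by lra.
have -> : A = [set a | odvd g (a - 0) /\ (a != 0 /\ nm a <= r)].
  apply/seteqP; split=> a [/= ga sa]; split; rewrite ?subr0//.
  - exact/(full_sectorE eP).
  - by move: ga; rewrite subr0.
  - exact/(full_sectorE eP).
have [fin cE] := lattice_disc eP 0 g0 r0; split=> //; apply: le_trans cE _.
have : r / nm g <= r.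
  by rewrite ler_pdivrMr ?(nm_gt0 eP)// ler_peMr ?(nm_ge1 eP) ?(ltW r0).
lra.
Qed.

Lemma mean_density_le1 (c : R) : (forall r : R, 1 <= r ->
  `|ratio_sum 1 (2 * pi) r - 2 * pi * r ^+ 2 / (2 * y) * c| <= ratio_error * r) ->
  c <= 1.
Proof.
move=> H; have pi0 := pi_gt0 R; have y2 := order_im eP.
have piy : 0 < pi / y by rewrite divr_gt0//; lra.
rewrite -subr_le0 -(pmulr_rle0 _ piy).
apply: (@quadratic_le_linear R 1 _ (200 + ratio_error)) => r r1.
have [fA cA] := ideal_disc_count r1.
have BA : ratio_sum 1 (2 * pi) r <=
    cnt R [set a | odvd g a /\ angular_sector 1 (2 * pi) r (e a)].
  apply: fsum_le => // a _.
  have /andP[f0 f1] := phi_ratio_itv eP pid a.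
  have /andP[h0 h1] := phi_ratio_itv eP pid (a + k).
  by rewrite mulr_ile1.
have g1 : pi * r ^+ 2 / y / nm g ^+ 2 <= pi * r ^+ 2 / y.
  rewrite ler_pdivrMr ?exprn_gt0 ?(nm_gt0 eP)// ler_peMr ?exprn_ege1 ?(nm_ge1 eP)//.
  by rewrite divr_ge0 ?mulr_ge0 ?sqr_ge0//; lra.
have E : 2 * pi * r ^+ 2 / (2 * y) = pi / y * r ^+ 2 by field; apply/eqP; lra.
have E' : pi * r ^+ 2 / y = pi / y * r ^+ 2 by rewrite mulrAC.
have := H r r1; rewrite E; rewrite E' in cA g1.
by move: cA; rewrite !ler_norml; lra.
Qed.

(** If the constant were not positive, the sum over a disc of radius [r] would
    be at most linear in [r]. But each of its terms is at least of order
    [r^(-1/2)], so that the sum is at least of order [r^(3/2)]; with [r = s^2],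
    these are [s^2] and [s^3]. *)
Lemma mean_density_gt0 (c : R) : (forall r : R, 1 <= r ->
  `|ratio_sum 1 (2 * pi) r - 2 * pi * r ^+ 2 / (2 * y) * c| <= ratio_error * r) ->
  0 < c.
Proof.
move=> H; rewrite ltNge; apply/negP => c_le0.
have pi0 := pi_gt0 R; have y2 := order_im eP; have nk := nm_ge0 e k.
pose c0 : R := (1 / 256) ^+ small_primes.
have c00 : 0 < c0 by apply: exprn_gt0; lra.
have c01 : c0 <= 1 by apply: exprn_ile1; lra.
pose kap := c0 ^+ 2 / 4.
have kap0 : 0 < kap by rewrite divr_gt0// exprn_gt0.
have kap1 : kap <= 1.
  have : c0 ^+ 2 <= 1 by rewrite exprn_ile1// ltW.
  by rewrite ler_pdivrMr//; lra.
pose be := pi / y / nm g ^+ 2.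
have be0 : 0 < be by rewrite divr_gt0 ?exprn_gt0 ?(nm_gt0 eP)// divr_gt0//; lra.
suff : kap * be <= 0 by rewrite leNgt mulr_gt0.
apply: (@quadratic_le_linear R (1 + nm k) _ (ratio_error + 201 * kap)) => s sk.
have s1 : 1 <= s by lra.
have s0 : 0 < s by lra.
set r := s ^+ 2.
have sr : s <= r by rewrite /r expr2 ler_peMr// ltW.
have r1 : 1 <= r by lra.
have r0 : 0 < r by lra.
have [] := ideal_disc_count r1; set A := [set a | _] => fA cA.
have low a : A a -> a + k != 0 -> kap / s <= phi_ratio e a * phi_ratio e (a + k).
  move=> [ga /(full_sectorE eP)[a0 ar]] ak0.
  have := phi_ratio_lower a0; have := phi_ratio_lower ak0.
  have /andP[] := phi_ratio_itv eP pid a.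
  have /andP[] := phi_ratio_itv eP pid (a + k).
  rewrite -/c0; set f := phi_ratio e a; set f' := phi_ratio e (a + k).
  move=> f'0 _ f0 _ h' h.
  have akr : nm (a + k) <= 2 * r by have := le_nmD e a k; lra.
  have H1 : c0 <= f ^+ 8 * r ^+ 2.
    apply: (le_trans h); rewrite ler_wpM2l ?exprn_ge0//.
    by rewrite ler_pXn2r ?nnegrE ?nm_ge0 ?(ltW r0).
  have H2 : c0 <= f' ^+ 8 * (2 * r) ^+ 2.
    apply: (le_trans h'); rewrite ler_wpM2l ?exprn_ge0//.
    have r20 : 0 <= 2 * r by lra.
    by rewrite ler_pXn2r ?nnegrE ?nm_ge0 ?r20.
  have H3 : kap <= (f * f' * s) ^+ 8.
    have : c0 * c0 <= f ^+ 8 * r ^+ 2 * (f' ^+ 8 * (2 * r) ^+ 2).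
      by apply: ler_pM => //; exact: ltW.
    have -> : f ^+ 8 * r ^+ 2 * (f' ^+ 8 * (2 * r) ^+ 2) = (f * f' * s) ^+ 8 * 4.
      by rewrite /r; ring.
    by rewrite -expr2 /kap ler_pdivrMr.
  (* since [kap <= 1], a number whose eighth power is at least [kap] is itself
     at least [kap] *)
  rewrite ler_pdivrMr// leNgt; apply/negP => small.
  have F0 : 0 <= f * f' * s by rewrite !mulr_ge0// ltW.
  have : (f * f' * s) ^+ 8 <= f * f' * s.
    by rewrite -[leRHS]expr1 ler_wiXn2l//; lra.
  lra.
have ks0 : 0 <= kap / s by exact: divr_ge0 (ltW kap0) (ltW s0).
have BA : kap / s * (cnt R A - 1) <= ratio_sum 1 (2 * pi) r.
  have fAk : finite_set (A `\ (- k)) by exact: finite_setD.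
  apply: (@le_trans _ _ (\sum_(a \in A `\ (- k)) phi_ratio e a * phi_ratio e (a + k))).
    apply: (@le_trans _ _ (\sum_(a \in A `\ (- k)) kap / s * 1)).
      rewrite -fsbig_distrr// ler_wpM2l ?ks0//.
      rewrite lerBlDr -/(cnt R _).
      apply: (@le_trans _ _ (cnt R ((A `\ (- k)) `|` [set - k]))).
        apply: cnt_le; first by rewrite finite_setU.
        by move=> a Aa; have [->|ak] := eqVneq a (- k); [right|left; split=> //; exact/eqP].
      rewrite cntU//; last by apply/seteqP; split=> // a [[]].
      by rewrite lerD2l /cnt fsbig_set1.
    apply: fsum_le => // a [Aa ak]; rewrite mulr1; apply: low => //.
    by rewrite addr_eq0; exact/eqP.
  apply: fsum_le_subset => // a _.
  have /andP[f0 _] := phi_ratio_itv eP pid a.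
  have /andP[h0 _] := phi_ratio_itv eP pid (a + k).
  exact: mulr_ge0.
have B_le : ratio_sum 1 (2 * pi) r <= ratio_error * r.
  have : 2 * pi * r ^+ 2 / (2 * y) * c <= 0.
    by rewrite pmulr_rle0// divr_gt0 ?mulr_gt0 ?exprn_gt0//; lra.
  by have := H r r1; rewrite ler_norml; lra.
have cA' : be * r ^+ 2 - 200 * r <= cnt R A.
  have E : pi * r ^+ 2 / y / nm g ^+ 2 = be * r ^+ 2 by rewrite /be; ring.
  by move: cA; rewrite E ler_norml; lra.
have : kap / s * (be * r ^+ 2 - 201 * r) <= ratio_error * r.
  apply: le_trans B_le; apply: le_trans BA; rewrite ler_wpM2l ?ks0//.
  lra.
have -> : kap / s * (be * r ^+ 2 - 201 * r) = (kap * be * s ^+ 2 - 201 * kap) * s.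
  by rewrite /r; field; rewrite gt_eqF.
have -> : ratio_error * r = ratio_error * s * s by rewrite /r; ring.
rewrite ler_pM2r//.
have : kap <= kap * s by rewrite ler_peMr// ltW.
by rewrite -/r; lra.
Qed.

Theorem mean_density : exists c : R, 0 < c <= 1 /\
  forall z (theta r : R), z != 0 -> 0 < theta <= 2 * pi -> 1 <= r ->
  `|ratio_sum z theta r - theta * r ^+ 2 / (2 * y) * c| <= ratio_error * r.
Proof.
have [c cP] := ratio_sum_asymp; have pi0 := pi_gt0 R.
have c1 r : 1 <= r ->
    `|ratio_sum 1 (2 * pi) r - 2 * pi * r ^+ 2 / (2 * y) * c| <= ratio_error * r.
  by apply: cP; [exact: oner_neq0|lra].
by exists c; split=> //; rewrite mean_density_gt0//= mean_density_le1.
Qed.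

End MeanDensity.

(** * Restoring the norms *)

Section WeightedSum.
Variables (R : realType) (O : comNzRingType) (e : {rmorphism O -> R[i]}) (w : O).
Hypothesis eP : plane_order e w.
Hypothesis pid : principal_ideal_ring O.
Variables (k g : O).
Hypothesis g0 : g != 0.
Implicit Types a b : O.
Local Notation nm := (nm e).
Local Notation y := (complex.Im (e w)).
Local Notation nnorm := (nnorm e).

Lemma sector_radius (z v : R[i]) (theta r r' : R) : z != 0 ->
  angular_sector z theta r v -> cmod v <= r' -> angular_sector z theta r' v.
Proof.
move=> z0 /(sectorP _ _ _ z0)[t [rho [tt /andP[rho0 rhor] vE]]] vr.
apply/sectorP => //; exists t, rho; split=> //; rewrite rho0/=.
move: vr; rewrite vE !cmodM cmod_expi mulr1.
have cz : 0 < cmod z by rewrite cmod_gt0.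
by rewrite cmod_real ?divr_ge0 ?(ltW rho0) ?(ltW cz)// divfK ?gt_eqF.
Qed.

Definition ideal_sector z (theta r : R) : set O :=
  [set a | odvd g a /\ angular_sector z theta r (e a)].

Lemma level_ideal_sector (z : R[i]) (theta x : R) n : z != 0 -> Num.sqrt n%:R <= x ->
  level (ideal_sector z theta x) nnorm n = ideal_sector z theta (Num.sqrt n%:R).
Proof.
move=> z0 nx; apply/seteqP; split=> [a [[ga sa]]|a [ga sa]].
  rewrite (nnorm_disc eP) => an; split=> //; exact: sector_radius sa an.
have /andP[a0 an] := sector_cmod z0 sa.
split; last by rewrite (nnorm_disc eP).
by split=> //; apply: sector_radius sa _ => //; exact: le_trans nx.
Qed.

Lemma sum_squares n :
  n%:R ^+ 3 - \sum_(l < n) (l.+1%:R ^+ 2 - l%:R ^+ 2) * l%:R =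
  n%:R ^+ 3 / 3 + n%:R ^+ 2 / 2 + n%:R / 6 :> R.
Proof.
elim: n => [|n IH]; first by rewrite big_ord0; field.
move: IH; rewrite big_ord_recr /= -[n.+1%:R]natr1; set S := \sum_(l < n) _; lra.
Qed.

Lemma sum_sqrB n : \sum_(l < n) (l.+1%:R ^+ 2 - l%:R ^+ 2) = n%:R ^+ 2 :> R.
Proof.
elim: n => [|n IH]; first by rewrite big_ord0 expr0n.
by rewrite big_ord_recr /= IH addrC subrK.
Qed.

Lemma sum_squares_approx (u : R) n : 1 <= u -> n%:R <= u -> u < n%:R + 1 ->
  `|n%:R ^+ 3 / 3 + n%:R ^+ 2 / 2 + n%:R / 6 - u ^+ 3 / 3| <= u ^+ 2.
Proof.
move=> u1 nu un; set v : R := n%:R.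
have v0 : 0 <= v := ler0n _ _.
have E : v ^+ 3 / 3 + v ^+ 2 / 2 + v / 6 = v * (v + 1) * (2 * v + 1) / 6 by field.
have up : v * (v + 1) * (2 * v + 1) <= u * (u + 1) * (2 * u + 1).
  by rewrite !ler_pM ?addr_ge0 ?mulr_ge0//; rewrite /v; lra.
have lo : (u - 1) * u * (2 * u - 1) <= v * (v + 1) * (2 * v + 1).
  by rewrite !ler_pM ?subr_ge0 ?mulr_ge0//; rewrite /v; lra.
have u2 : u <= u ^+ 2 by rewrite expr2 ler_peMr//; lra.
rewrite E ler_norml; lra.
Qed.

(** The norm is an integer, so that the weight [N(a)^2] is introduced by a
    discrete summation by parts, which turns the linear error in the radius
    into [x^4 * x]. *)
Lemma norm_sqr_sum (z : R[i]) (theta x c : R) : z != 0 -> 0 < theta <= 2 * pi -> 1 <= x ->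
  0 < c <= 1 ->
  (forall r, 1 <= r -> `|ratio_sum e k g z theta r - theta * r ^+ 2 / (2 * y) * c| <=
     ratio_error e k * r) ->
  `|\sum_(a \in ideal_sector z theta x) (nm a ^+ 4 * (phi_ratio e a * phi_ratio e (a + k))) -
     theta * c / (2 * y) * (x ^+ 6 / 3)| <= (2 * ratio_error e k + 8) * x ^+ 5.
Proof.
move=> z0 /andP[th0 th2] x1 /andP[c0 c1] H.
set F := fun a => phi_ratio e a * phi_ratio e (a + k).
have pi0 := pi_gt0 R; have pi4 : pi < 4 :> R by have := pihalf_lt2 R; lra.
have y2 := order_im eP.
pose kap := theta * c / (2 * y).
have kap8 : 0 <= kap <= 8.
  rewrite /kap divr_ge0 ?mulr_ge0//=; [|lra|lra|lra].
  rewrite ler_pdivrMr; last lra.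
  have : theta * c <= theta by rewrite ger_pMr.
  lra.
have u1 : 1 <= x ^+ 2 by rewrite exprn_ege1.
pose n := Num.trunc (x ^+ 2).
have nu : n%:R <= x ^+ 2 by rewrite truncn_le// (le_trans _ u1).
have un : x ^+ 2 < n%:R + 1 by rewrite natr1 truncnS_gt.
have sq l : (l <= n)%N -> Num.sqrt l%:R <= x.
  move=> ln; rewrite -[x in leRHS]ger0_norm; last lra.
  by rewrite -sqrtr_sqr ler_wsqrtr// (le_trans _ nu)// ler_nat.
have level_top : level (ideal_sector z theta x) nnorm n = ideal_sector z theta x.
  apply/seteqP; split=> [a []//|a [ga sa]]; split=> //.
  have /andP[a0 ax] := sector_cmod z0 sa.
  rewrite -ltnS -(ltr_nat R) (nnormE eP) -natr1 (le_lt_trans _ un)//.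
  by rewrite ler_pXn2r ?nnegrE ?nm_ge0//; lra.
have fin l : finite_set (level (ideal_sector z theta x) nnorm l).
  apply: sub_finite_set (finite_sector eP theta x z0) => a [[_ sa] _]; exact: sa.
pose B l : R := \sum_(a \in level (ideal_sector z theta x) nnorm l) F a.
have BE l : (l <= n)%N -> `|B l - kap * l%:R| <= ratio_error e k * x.
  move=> ln; have re0 : 0 <= ratio_error e k.
    apply: mulr_ge0; last by rewrite addr_ge0 ?nm_ge0.
    by have := sqr_ge0 (subset_bound R); lra.
  case: l => [|l] in ln *.
    have -> : B 0 = 0.
      rewrite /B (_ : level _ _ _ = set0) ?fsbig_set0//.
      apply/seteqP; split=> // a [[ga sa]]; rewrite leqn0 => /eqP a0.
      have /andP[na _] := sector_cmod z0 sa; have := nnormE eP a.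
      by rewrite a0 => /esym/eqP; rewrite sqrf_eq0 gt_eqF.
    by rewrite mulr0 subrr normr0 mulr_ge0//; lra.
  rewrite /B level_ideal_sector ?sq//.
  have r1 : 1 <= Num.sqrt (l.+1%:R : R) by rewrite -[X in X <= _]sqrtr1 ler_wsqrtr// ler1n.
  have E : theta * Num.sqrt l.+1%:R ^+ 2 / (2 * y) * c = kap * l.+1%:R.
    by rewrite sqr_sqrtr ?ler0n// /kap; ring.
  have h := H _ r1; rewrite E in h; apply: le_trans h _.
  by rewrite ler_wpM2l// sq.
have -> : \sum_(a \in ideal_sector z theta x) (nm a ^+ 4 * F a) =
    \sum_(a \in level (ideal_sector z theta x) nnorm n) ((nnorm a)%:R ^+ 2 * F a).
  by rewrite level_top; apply: eq_fsbigr => a _; rewrite (nnormE eP) -exprM.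
rewrite (abel_levels F (fun l => l%:R ^+ 2)) // -/(B n).
set S := \sum_(l < n) _.
pose main := n%:R ^+ 2 * (kap * n%:R) -
  \sum_(l < n) (l.+1%:R ^+ 2 - l%:R ^+ 2) * (kap * l%:R).
have mainE : main = kap * (n%:R ^+ 3 / 3 + n%:R ^+ 2 / 2 + n%:R / 6).
  rewrite -sum_squares mulrBr mulr_sumr /main; congr (_ - _); first by ring.
  by apply: eq_bigr => l _; ring.
have err : `|n%:R ^+ 2 * B n - S - main| <= 2 * ratio_error e k * x ^+ 5.
  have -> : n%:R ^+ 2 * B n - S - main = n%:R ^+ 2 * (B n - kap * n%:R) -
     \sum_(l < n) (l.+1%:R ^+ 2 - l%:R ^+ 2) * (B l - kap * l%:R).
    rewrite /main /S; under [in RHS]eq_bigr do rewrite mulrBr.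
    by rewrite sumrB; ring.
  set D := ratio_error e k * x in BE.
  have D0 : 0 <= D by apply: le_trans (BE n (leqnn _)).
  apply: (@le_trans _ _ (n%:R ^+ 2 * D + n%:R ^+ 2 * D)).
    apply: (le_trans (ler_normB _ _)); apply: lerD.
      by rewrite normrM ger0_norm ?sqr_ge0// ler_wpM2l ?sqr_ge0// BE.
    apply: (le_trans (ler_norm_sum _ _ _)).
    rewrite -[in leRHS]sum_sqrB mulr_suml; apply: ler_sum => l _.
    have s0 : 0 <= l.+1%:R ^+ 2 - l%:R ^+ 2 :> R.
      by rewrite subr_ge0 ler_pXn2r ?nnegrE// ler_nat.
    by rewrite normrM ger0_norm// ler_wpM2l// BE// ltnW.
  have : n%:R ^+ 2 * D <= (x ^+ 2) ^+ 2 * D.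
    by rewrite ler_wpM2r// ler_pXn2r ?nnegrE ?sqr_ge0.
  rewrite (_ : (x ^+ 2) ^+ 2 * D = ratio_error e k * x ^+ 5); last by rewrite /D; ring.
  lra.
have app : `|main - kap * (x ^+ 6 / 3)| <= 8 * x ^+ 5.
  rewrite mainE -mulrBr normrM ger0_norm; last by case/andP: kap8.
  apply: ler_pM => //; [by case/andP: kap8|by case/andP: kap8|].
  rewrite (_ : x ^+ 6 = (x ^+ 2) ^+ 3); last by rewrite -exprM.
  apply: (le_trans (sum_squares_approx u1 nu un)).
  by rewrite -exprM ler_weXn2l.
rewrite -/kap; move: err app; rewrite !ler_norml; lra.
Qed.

Definition weighted_sum z (theta x : R) : R :=
  \sum_(a \in ideal_sector z theta x)
     (phi_ratio e a * nm a ^+ 2) * (phi_ratio e (a + k) * nm (a + k) ^+ 2).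

Definition final_constant : R := 404 * subset_bound R ^+ 2 + 428.

(** Replacing [N(a + k)] by [N(a)] costs at most [2 |a| |k| + |k|^2] for each of
    the [O(x^2)] points, with the weight [N(a) <= x^2]; this gives the terms
    that depend on [k]. *)
Theorem weighted_sum_asymp : exists c : R, 0 < c <= 1 /\
  forall (z : R[i]) (theta x : R), z != 0 -> 0 < theta <= 2 * pi -> 1 <= x ->
  `|weighted_sum z theta x - theta * c / (3 * (2 * y)) * x ^+ 6| <=
    final_constant * ((1 + nm k) * x ^+ 5 + nm k ^+ 2 * x ^+ 4).
Proof.
have [c [c01 H]] := mean_density eP pid k g0.
exists c; split=> // z theta x z0 th x1.
have x0 : 0 < x by lra.
have nk := nm_ge0 e k.
have := norm_sqr_sum z0 th x1 c01 (fun r => H z theta r z0 th).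
set T1 := \sum_(a \in _) _ => hT1.
have fA : finite_set (ideal_sector z theta x).
  by apply: sub_finite_set (finite_sector eP theta x z0) => a [].
pose D := x ^+ 2 * (2 * x * nm k + nm k ^+ 2).
have D0 : 0 <= D by rewrite /D mulr_ge0 ?sqr_ge0// addr_ge0 ?sqr_ge0// !mulr_ge0 ?(ltW x0).
have diff : `|weighted_sum z theta x - T1| <= 210 * x ^+ 2 * D.
  have cA : cnt R (ideal_sector z theta x) <= 210 * x ^+ 2.
    have [fd cd] := disc_count eP (ltW x0); apply: le_trans cd; apply: cnt_le => // a [_ sa].
    have /andP[a0 ax] := sector_cmod z0 sa; split=> //.
    by rewrite -(nm_gt0 eP).
  apply: (@le_trans _ _ (cnt R (ideal_sector z theta x) * D)); last by rewrite ler_wpM2r.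
  rewrite /weighted_sum /T1 !fsbig_finite//= -sumrB (le_trans (ler_norm_sum _ _ _))//.
  rewrite /cnt fsbig_finite//= mulr_suml big_seq [leRHS]big_seq.
  apply: ler_sum => a; rewrite in_fset_set// inE mul1r => -[ga sa].
  have /andP[a0 ax] := sector_cmod z0 sa; rewrite -[cmod _]/(nm a) in a0 ax.
  have /andP[f0 f1] := phi_ratio_itv eP pid a.
  have /andP[h0 h1] := phi_ratio_itv eP pid (a + k).
  set f := phi_ratio e a in f0 f1 *; set f' := phi_ratio e (a + k) in h0 h1 *.
  have -> : f * nm a ^+ 2 * (f' * nm (a + k) ^+ 2) - nm a ^+ 4 * (f * f') =
     (f * f') * (nm a ^+ 2 * (nm (a + k) ^+ 2 - nm a ^+ 2)) by ring.
  rewrite normrM ger0_norm ?mulr_ge0// -[leRHS]mul1r ler_pM ?mulr_ge0// ?mulr_ile1//.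
  rewrite normrM ger0_norm ?sqr_ge0// ler_pM ?sqr_ge0//.
    by rewrite ler_pXn2r ?nnegrE ?(ltW a0) ?(ltW x0).
  have t1 := le_nmD e a k.
  have t2 : nm a <= nm (a + k) + nm k.
    by have := le_nmD e (a + k) (- k); rewrite addrK /nm rmorphN cmodN.
  have n0 := nm_ge0 e (a + k).
  set p := nm (a + k) in t1 t2 n0 *; set q := nm a in a0 ax t1 t2 *.
  set s := nm k in nk t1 t2 *.
  have -> : p ^+ 2 - q ^+ 2 = (p - q) * (p + q) by ring.
  have -> : 2 * x * s + s ^+ 2 = s * (2 * x + s) by ring.
  rewrite normrM; apply: ler_pM => //.
    by rewrite ler_norml; lra.
  by rewrite ger0_norm ?addr_ge0 ?(ltW a0)//; lra.
have E : theta * c / (3 * (2 * y)) * x ^+ 6 = theta * c / (2 * y) * (x ^+ 6 / 3).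
  by have y2 := order_im eP; field; apply/eqP; lra.
rewrite E.
have -> : final_constant * ((1 + nm k) * x ^+ 5 + nm k ^+ 2 * x ^+ 4) =
  (2 * ratio_error e k + 8) * x ^+ 5 + 210 * x ^+ 2 * D +
  (8 * nm k * x ^+ 5 + 420 * x ^+ 5 +
     (404 * subset_bound R ^+ 2 + 218) * (nm k ^+ 2 * x ^+ 4)).
  by rewrite /final_constant /ratio_error /D; ring.
have r0 : 0 <= 8 * nm k * x ^+ 5 + 420 * x ^+ 5 +
    (404 * subset_bound R ^+ 2 + 218) * (nm k ^+ 2 * x ^+ 4).
  have x5 : 0 <= x ^+ 5 by rewrite exprn_ge0// ltW.
  have x4 : 0 <= nm k ^+ 2 * x ^+ 4 by rewrite mulr_ge0 ?sqr_ge0// exprn_ge0// ltW.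
  have h1 : 0 <= nm k * x ^+ 5 by exact: mulr_ge0.
  have h2 : 0 <= subset_bound R ^+ 2 * (nm k ^+ 2 * x ^+ 4) by rewrite mulr_ge0// sqr_ge0.
  lra.
move: diff hT1 r0; rewrite !ler_norml; lra.
Qed.

End WeightedSum.

Lemma euler_ratio (R : realType) (K : fieldExtType rat) (iota : {rmorphism K -> R[i]})
    (a : ringOfIntegers K) :
  (euler a)%:R = phi_ratio (int_embed iota) a * nm (int_embed iota) a ^+ 2 :> R.
Proof.
rewrite /euler /phi_ratio; have [->|a0] := eqVneq a 0; first by rewrite mul0r.
rewrite /card_units /euler_ideal divfK// expf_eq0/= /nm cmod_eq0.
by apply: contra_neq a0 => h; apply: (@int_embed_inj _ _ iota); rewrite h rmorph0.
Qed.

Theorem theorem4p1 (R : realType) :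
  exists C : R, 0 < C /\
  forall (K : fieldExtType rat) (iota : {rmorphism K -> R[i]}),
    imaginary_quadratic iota ->
    principal_ideal_ring (ringOfIntegers K) ->
  forall (k : ringOfIntegers K) (m : set (ringOfIntegers K)),
    is_ideal m -> m <> [set 0] ->
  exists c : R, 0 < c <= 1 /\
  forall (z : R[i]) (theta x : R),
    z != 0 -> 0 < theta <= 2 * pi -> 1 <= x ->
    `| \sum_(a \in m `&` embed iota @^-1` angular_sector z theta x)
           ((euler a)%:R * (euler (a + k))%:R : R)
       - theta * c / (3 * Num.sqrt `|ratr (discriminant K)|) * x ^+ 6 |
    <= C * ((1 + Num.sqrt (abs_norm iota k)) * x ^+ 5 + abs_norm iota k * x ^+ 4).
Proof.
exists (final_constant R); split.
  by rewrite /final_constant; have := sqr_ge0 (subset_bound R); lra.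
move=> K iota [dimK nonreal] pid k m mI m0.
have [w wP] := int_embed_plane_order dimK nonreal.
have [g gE] := pid m mI; rewrite principal_idealE in gE.
have g0 : g != 0.
  apply/eqP => g0; apply: m0; rewrite gE g0; apply/seteqP; split=> [a [u ->]|a ->].
    by rewrite mulr0.
  exact: odvd0.
have [c [c01 H]] := weighted_sum_asymp wP pid k g0.
exists c; split=> // z theta x z0 th x1.
rewrite (sqrt_discriminant dimK nonreal wP) /abs_norm sqrtr_sqr.
rewrite (ger0_norm (cmod_ge0 _)) gE.
under eq_fsbigr do rewrite !(euler_ratio iota).
exact: H.
Qed.
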